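(* Let $X=(X_t)_{t\ge 0}$ be the directionally reinforced random walk in $\mathbb{R}^d$ with direction set $U$, direction chain $\eta$ and holding times $(T_n)_{n\ge1}$. Suppose that there is a function $h\in\mathcal{R}_\alpha$ with $\alpha\in(0,1)$ such that $\lim_{t\to\infty}h(t)\cdot P(T_1>t)$ exists and belongs to $(0,\infty)$. Then $\dfrac{X_t}{t}$ converges weakly in $\mathbb{R}^d$, as $t\to\infty$, to a non-degenerate limit.
   Context: Setting. Fix $d\in\mathbb{N}$ and a finite set $U$ of distinct unit vectors in $\mathbb{R}^d$ containing at least two elements. Let $s_1:=0<s_2<s_3<\cdots$ be random times such that the intervals $T_n:=s_{n+1}-s_n$, $n\in\mathbb{N}$, are independent and identically distributed. Let $\eta=(\eta_n)_{n\ge1}$ be an irreducible stationary Markov chain on $U$, independent of $(s_n)_{n\in\mathbb{N}}$. For $t>0$ let $N_t:=\sup\{k\ge1:s_k\le t\}$. The directionally reinforced random walk is defined by $X_0=0$ and $$X_t=\sum_{i=1}^{N_t-1}\eta_iT_i+(t-s_{N_t})\eta_{N_t},\qquad t>0.$$ Notation. A function $h:\mathbb{R}_+\to\mathbb{R}$ is regularly varying of index $\alpha\in\mathbb{R}$ if $h(t)=t^\alpha L(t)$ for some $L:\mathbb{R}_+\to\mathbb{R}$ such that $\lim_{t\to\infty}L(\lambda t)/L(t)=1$ for all $\lambda>0$; $\mathcal{R}_\alpha$ is the set of all such functions. A law in $\mathbb{R}^d$ is called non-degenerate if it is not concentrated at a single point. *)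

(* Defs.v *)
From HB Require Import structures.
From mathcomp Require Import all_boot all_order all_algebra finmap.
From mathcomp Require Import all_classical all_reals all_analysis.

Set Implicit Arguments.
Unset Strict Implicit.
Unset Printing Implicit Defensive.

Import Order.TTheory GRing.Theory Num.Theory.
Import numFieldNormedType.Exports.

Local Open Scope classical_set_scope.
Local Open Scope ring_scope.

(* R^d with its Borel sigma-algebra. The library norm on 'rV[R]_d is the sup
   norm; its topology is the usual one, but unit vectors refer to [enorm]. *)
Notation borelV R d := (g_sigma_algebraType (@open 'rV[R]_d)).

Definition enorm (R : realType) (d : nat) (u : 'rV[R]_d) : R :=
  Num.sqrt (\sum_(i < d) u ord0 i ^+ 2).

Section probability_notions.
Context {R : realType} {dO : measure_display} {Omega : measurableType dO}.
Variable P : probability Omega R.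

Definition mutually_independent {d'} {E : measurableType d'}
    (X : nat -> {RV P >-> E}) : Prop :=
  forall (J : {fset nat}) (B : nat -> set E),
    (forall j, measurable (B j)) ->
    P (\bigcap_(j in [set` J]) (X j @^-1` B j)) =
    (\prod_(j <- J) P (X j @^-1` B j))%E.

Definition identically_distributed {d'} {E : measurableType d'}
    (X : nat -> {RV P >-> E}) : Prop :=
  forall n (B : set E), measurable B ->
    distribution P (X n) B = distribution P (X 0%N) B.

Definition process_sigma_algebra {d'} {E : measurableType d'}
    (X : nat -> {RV P >-> E}) : set (set Omega) :=
  <<s \bigcup_n g_sigma_algebra_preimage (X n) >>.

Definition independent_processes {d1 d2}
    {E1 : measurableType d1} {E2 : measurableType d2}
    (X : nat -> {RV P >-> E1}) (Y : nat -> {RV P >-> E2}) : Prop :=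
  forall A B, process_sigma_algebra X A -> process_sigma_algebra Y B ->
    P (A `&` B) = (P A * P B)%E.

End probability_notions.

Section markov.
Context {R : realType} {d : nat}.
Variables (U : {fset 'rV[R]_d}) (p : 'rV[R]_d -> 'rV[R]_d -> R).

(* Only the values of p on U x U are relevant. *)
Definition transition_matrix : Prop :=
  (forall u v, u \in U -> v \in U -> 0 <= p u v) /\
  (forall u, u \in U -> \sum_(v <- U) p u v = 1).

Fixpoint transition_power (n : nat) (u v : 'rV[R]_d) : R :=
  if n is m.+1 then \sum_(w <- U) p u w * transition_power m w v
  else (u == v)%:R.

Definition irreducible_matrix : Prop :=
  forall u v, u \in U -> v \in U -> exists n, 0 < transition_power n u v.

Context {dO : measure_display} {Omega : measurableType dO}.
Variables (P : probability Omega R) (eta : nat -> {RV P >-> borelV R d}).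

(* {eta_k = u_0, ..., eta_(k+n) = u_n} *)
Definition path_event (k n : nat) (u : nat -> 'rV[R]_d) : set Omega :=
  \bigcap_(i in [set i | (i <= n)%N]) (eta (k + i)%N @^-1` [set u i]).

(* The Markov property P(eta_(n+1) = u_(n+1) | eta_0 = u_0, ..., eta_n = u_n) =
   p(u_n, u_(n+1)), multiplied out so that conditioning on null events is
   harmless. *)
Definition markov_chain : Prop :=
  (forall n w, eta n w \in U) /\
  (forall n (u : nat -> 'rV[R]_d), (forall i, u i \in U) ->
    P (path_event 0 n.+1 u) =
    (P (path_event 0 n u) * (p (u n) (u n.+1))%:E)%E).

Definition stationary_chain : Prop :=
  forall k n (u : nat -> 'rV[R]_d), (forall i, u i \in U) ->
    P (path_event k n u) = P (path_event 0 n u).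

Definition irreducible_stationary_markov_chain : Prop :=
  [/\ transition_matrix, irreducible_matrix, markov_chain & stationary_chain].

End markov.

Section walk.
Context {R : realType} {d : nat} {Omega : Type}.
Variables (s : nat -> Omega -> R) (eta : nat -> Omega -> 'rV[R]_d).

(* All sequences are indexed from 0, i.e., s 0, eta 0 and s 1 - s 0 stand for
   s_1, eta_1 and T_1. Hence [renewal_index t] is N_t - 1 in terms of
   N_t = sup {k >= 1 : s_k <= t}. It is 0 by convention when the set is
   unbounded; this happens with probability 0 for i.i.d. positive increments. *)
Definition renewal_index (t : R) (w : Omega) : nat :=
  supremum 0%N [set k | s k w <= t].

(* At t = 0 the formula gives 0 if s 0 = 0 and s is increasing. *)
Definition drrw (t : R) (w : Omega) : 'rV[R]_d :=
  let N := renewal_index t w in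
  \sum_(i < N) (s i.+1 w - s i w) *: eta i w + (t - s N w) *: eta N w.

End walk.

(* h is only constrained on (0, +oo): t^a need not make sense at 0. No
   measurability of L is required. *)
Definition regularly_varying (R : realType) (h : R -> R) (a : R) : Prop :=
  exists L : R -> R,
    (forall t, 0 < t -> h t = t `^ a * L t) /\
    (forall l, 0 < l -> L (l * t) / L t @[t --> +oo] --> (1 : R)).

Definition nondegenerate_law (R : realType) (d : nat)
    (mu : probability (borelV R d) R) : Prop :=
  ~ exists x : 'rV[R]_d, mu [set x] = 1%E.

(* Weak convergence, as t --> +oo, of the laws of the random vectors Y t. *)
Definition cvg_weakly (R : realType) (d : nat) (dO : measure_display)
    (Omega : measurableType dO) (P : probability Omega R)
    (Y : R -> Omega -> 'rV[R]_d) (mu : probability (borelV R d) R) : Prop :=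
  forall f : 'rV[R]_d -> R, continuous f ->
    (exists M : R, forall x, `|f x| <= M) ->
    (\int[P]_w (f (Y t w))%:E)%E @[t --> +oo] --> (\int[mu]_x (f x)%:E)%E.

(* Main.v *)
Require Import Defs.
From HB Require Import structures.
From mathcomp Require Import all_boot all_order all_algebra finmap.
From mathcomp Require Import all_classical all_reals all_analysis.
From mathcomp Require Import measurable_realfun.
From mathcomp Require Import ring lra zify.

(** The walk moves at unit speed, so the laws of [X_t / t] are carried by one
    compact ball and have limit points in law.  The theorem then reduces to two
    facts about means: [E f (X_t / t)] converges for every bounded continuous
    [f], which makes the limit point the weak limit, and the limit is not a
    point mass.

    _Limit points._  A point of the ball is coded by the cells of finer and
    finer grids that contain it.  Along an ultrafilter the distribution
    functions of all codes converge, and their quantile functions, with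
    Lebesgue measure on [[0, 1)], produce a random point
    ([limit_law_exists]).

    _Rounding._  For a large integer [M], round every holding time down to a
    multiple of [t / M] and cap it at [t].  Only the rare holding times above
    [t / M] survive.  At the horizon the position changes by at most twice the
    sum of the holding times that begin before [t], each truncated at [t / M].
    A holding time is independent of its starting time, at most
    [1 / P (T > t)] steps are expected to begin before [t], and by Karamata's
    estimate the truncated mean at [x] is [O (x P (T > x))] because the index is
    below 1.  So after division by [t] the rounding error is of order
    [M ^ (a - 1)] in mean ([karamata_bound], [grid_compare]).

    _The rounded walk._  For fixed [M], as [t] grows, the number of cells that a
    surviving holding time covers has a limiting law, given by differences of
    [k ^ (- a)] ([cvg_pareto_weight]), and survival becomes rare.  Many steps of
    the direction chain take place between two surviving ones, so the
    directions seen at the latter should become independent with the stationary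
    law.  The proof of this averaging works for periodic chains too: the limiting
    value function [hbar] is perturbed by a corrector, of the order of the
    survival rate, that solves a Poisson equation for the chain and absorbs the
    dependence on the current direction ([poisson_equation], [generator_le]).
    Summing the remaining errors over the [O (1 / P (T > t))] steps before the
    horizon shows that the mean of [f] converges to a value depending on [M]
    only ([grid_walk_mean], [expect_near_grid_limit]).  Letting [M] grow, the
    means of [f (X_t / t)] satisfy the Cauchy criterion
    ([cvg_expect_rescaled_walk]).

    _Non-degeneracy._  Fix a direction [u] and a small [dl].  About
    [1 / P (T > dl t)] steps begin before time [dl t]; each independently has
    direction [u] and lasts longer than [t] with probability comparable with
    [P (T > t)].  So with probability bounded below some such step occurs, and
    then [X_t / t] is within [2 dl] of [u] ([sum_last_step_in_ge],
    [tent_mean_ge]).  A point mass as limit would have to sit at every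
    direction, and there are two. *)

Set Implicit Arguments.
Unset Strict Implicit.
Unset Printing Implicit Defensive.
Import Order.TTheory GRing.Theory Num.Theory.
Import numFieldNormedType.Exports.
Local Open Scope classical_set_scope.
Local Open Scope ring_scope.

(** * Means and probabilities as real numbers *)

Section expectation.
Context {dO : measure_display} {Omega : measurableType dO} {R : realType}.
Variable P : probability Omega R.
Implicit Types (phi psi : Omega -> R) (A : set Omega).

(** Bounded random variables have finite means and are closed under the
    operations used below, so that means can be handled as real numbers. *)
Definition bounded_measurable phi :=
  measurable_fun [set: Omega] phi /\ exists M, forall w, `|phi w| <= M.

Definition expect phi : R := \int[P]_w phi w.

Definition prob A : R := fine (P A).

Lemma probE A : measurable A -> P A = (prob A)%:E.
Proof. by move=> mA; rewrite /prob fineK// fin_num_measure. Qed.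

Lemma bm_integrable phi : bounded_measurable phi ->
  P.-integrable [set: Omega] (EFin \o phi).
Proof.
case=> mphi [M phiM]; apply: measurable_bounded_integrable => //.
  exact: le_lt_trans (probability_le1 P measurableT) (ltry _).
exists M; split => [|r Mr w _]; first exact: num_real.
exact: le_trans (phiM w) (ltW Mr).
Qed.

Lemma bm_cst c : bounded_measurable (fun=> c).
Proof. by split; [exact: measurable_cst | exists `|c|]. Qed.

Lemma bmD phi psi : bounded_measurable phi -> bounded_measurable psi ->
  bounded_measurable (fun w => phi w + psi w).
Proof.
move=> [mf [M fM]] [mg [N gN]]; split; first exact: measurable_funD.
by exists (M + N) => w; rewrite (le_trans (ler_normD _ _))// lerD.
Qed.

Lemma bmN phi : bounded_measurable phi -> bounded_measurable (fun w => - phi w).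
Proof.
move=> [mf [M fM]]; split; last by exists M => w; rewrite normrN.
exact: measurable_funN.
Qed.

Lemma bmB phi psi : bounded_measurable phi -> bounded_measurable psi ->
  bounded_measurable (fun w => phi w - psi w).
Proof. by move=> bf bg; apply: bmD => //; exact: bmN. Qed.

Lemma bmM phi psi : bounded_measurable phi -> bounded_measurable psi ->
  bounded_measurable (fun w => phi w * psi w).
Proof.
move=> [mf [M fM]] [mg [N gN]]; split; first exact: measurable_funM.
by exists (M * N) => w; rewrite normrM ler_pM.
Qed.

Lemma bm_norm phi : bounded_measurable phi -> bounded_measurable (fun w => `|phi w|).
Proof.
move=> [mf [M fM]]; split; last by exists M => w; rewrite normr_id.
exact: measurableT_comp.
Qed.

Lemma bm_sum (I : Type) (r : seq I) (Q : pred I) (F : I -> Omega -> R) :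
  (forall i, bounded_measurable (F i)) ->
  bounded_measurable (fun w => \sum_(i <- r | Q i) F i w).
Proof.
move=> bF; elim: r => [|i r IH].
  by under eq_fun do rewrite big_nil; exact: bm_cst.
under eq_fun do rewrite big_cons.
by case: (Q i) => //; exact: bmD.
Qed.

Lemma bm_indic A : measurable A -> bounded_measurable (\1_A : Omega -> R).
Proof.
move=> mA; split; first exact: measurable_indic.
by exists 1 => w; rewrite indicE; case: (_ \in _); rewrite ?normr1 ?normr0.
Qed.

Lemma eq_expect phi psi : phi =1 psi -> expect phi = expect psi.
Proof. by move=> e; apply: eq_Rintegral => w _; exact: e. Qed.

Lemma expectD phi psi : bounded_measurable phi -> bounded_measurable psi ->
  expect (fun w => phi w + psi w) = expect phi + expect psi.
Proof. by move=> bf bg; rewrite /expect RintegralD//; exact: bm_integrable. Qed.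

Lemma expectB phi psi : bounded_measurable phi -> bounded_measurable psi ->
  expect (fun w => phi w - psi w) = expect phi - expect psi.
Proof. by move=> bf bg; rewrite /expect RintegralB//; exact: bm_integrable. Qed.

Lemma expectZ c phi : bounded_measurable phi ->
  expect (fun w => c * phi w) = c * expect phi.
Proof. by move=> bf; rewrite /expect RintegralZl//; exact: bm_integrable. Qed.

Lemma expect_cst c : expect (fun=> c) = c.
Proof.
rewrite /expect Rintegral_cst// [X in fine X](_ : _ = 1%E) ?mulr1//.
exact: probability_setT.
Qed.

Lemma expect_sum (I : Type) (r : seq I) (Q : pred I) (F : I -> Omega -> R) :
  (forall i, bounded_measurable (F i)) ->
  expect (fun w => \sum_(i <- r | Q i) F i w) = \sum_(i <- r | Q i) expect (F i).
Proof.
move=> bF; elim: r => [|i r IH].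
  by rewrite big_nil; under eq_expect do rewrite big_nil; exact: expect_cst.
rewrite big_cons; under eq_expect do rewrite big_cons.
by case: (Q i) => //; rewrite expectD ?IH//; exact: bm_sum.
Qed.

Lemma expect_le phi psi : bounded_measurable phi -> bounded_measurable psi ->
  (forall w, phi w <= psi w) -> expect phi <= expect psi.
Proof. by move=> bf bg fg; apply: le_Rintegral => //; exact: bm_integrable. Qed.

Lemma expect_ge0 phi : (forall w, 0 <= phi w) -> 0 <= expect phi.
Proof. by move=> f0; exact: Rintegral_ge0. Qed.

Lemma expect_norm phi : bounded_measurable phi ->
  `|expect phi| <= expect (fun w => `|phi w|).
Proof. by move=> bf; apply: le_normr_Rintegral => //; exact: bm_integrable. Qed.

Lemma expect_indic A : measurable A -> expect \1_A = prob A.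
Proof. by move=> mA; rewrite /expect /Rintegral integral_indic// setIT. Qed.

Lemma expectE phi : bounded_measurable phi ->
  (\int[P]_w (phi w)%:E)%E = (expect phi)%:E.
Proof.
move=> bf; rewrite /expect /Rintegral fineK//.
by apply: integrable_fin_num => //; exact: bm_integrable.
Qed.

Lemma prob_ge0 A : 0 <= prob A.
Proof. exact: fine_ge0. Qed.

Lemma prob_le1 A : measurable A -> prob A <= 1.
Proof. by move=> mA; rewrite -lee_fin -probE// probability_le1. Qed.

Lemma prob_le A B : measurable A -> measurable B -> A `<=` B ->
  prob A <= prob B.
Proof.
by move=> mA mB AB; rewrite -lee_fin -!probE// le_measure// inE.
Qed.

Lemma prob_setC A : measurable A -> prob (~` A) = 1 - prob A.
Proof.
by move=> mA; rewrite /prob probability_setC// probE// -EFinB.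
Qed.

(** Finitely valued random elements enter through the indicators of their
    fibres, so that no sigma-algebra on the finite type has to be chosen. *)
Lemma finite_valued_indic (I : finType) (X : Omega -> I) (G : I -> R) w :
  G (X w) = \sum_i G i * \1_(X @^-1` [set i]) w.
Proof.
rewrite (bigD1 (X w))//= indicE mem_set//= mulr1 big1 ?addr0// => i iX.
rewrite indicE memNset ?mulr0// => /= e; move: iX.
by rewrite e eqxx.
Qed.

Lemma bm_finite (I : finType) (X : Omega -> I) (G : I -> R) :
  (forall i, measurable (X @^-1` [set i])) ->
  bounded_measurable (fun w => G (X w)).
Proof.
move=> mX; under eq_fun do rewrite (finite_valued_indic X G).
by apply: bm_sum => i; apply: bmM; [exact: bm_cst|exact: bm_indic].
Qed.

Lemma expect_finite (I : finType) (X : Omega -> I) (G : I -> R) :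
  (forall i, measurable (X @^-1` [set i])) ->
  expect (fun w => G (X w)) = \sum_i G i * prob (X @^-1` [set i]).
Proof.
move=> mX; under eq_expect do rewrite (finite_valued_indic X G).
rewrite expect_sum => [|i].
  by apply: eq_bigr => i _; rewrite expectZ ?expect_indic//; exact: bm_indic.
by apply: bmM; [exact: bm_cst|exact: bm_indic].
Qed.

End expectation.

(** * Clipped sums and the grid walk, for a fixed outcome *)

(** Cells, quantiles and rounded holding times are all the largest index that
    satisfies a threshold; they are used through their upper level sets, which
    are single threshold events. *)
Lemma leq_bigmax_antitone (Q : pred nat) M k :
  (forall i j, (0 < i <= j)%N -> (j <= M)%N -> Q j -> Q i) ->
  (k <= \max_(i < M.+1 | Q i) i)%N = (k == 0)%N || ((k <= M)%N && Q k).
Proof.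
move=> antiQ; case: k => [|k] /=; first by rewrite leq0n.
apply/idP/andP => [|[kM Qk]]; last first.
  exact: (@leq_bigmax_cond _ (fun i : 'I_M.+1 => Q i) (fun i => nat_of_ord i)
           (Ordinal (kM : (k.+1 < M.+1)%N)) Qk).
move=> kmax; suff [j [kj jM Qj]] : exists j, [/\ (k < j)%N, (j <= M)%N & Q j].
  split; first exact: leq_trans jM.
  exact: (antiQ k.+1 j).
have [/existsP[j /andP[Qj kj]]|] :=
    boolP [exists j : 'I_M.+1, Q j && (k < j)%N].
  by exists j; split => //; rewrite -ltnS.
rewrite negb_exists => /forallP nQ.
suff : (\max_(i < M.+1 | Q i) i <= k)%N by rewrite leqNgt kmax.
by apply/bigmax_leqP => i Qi; have := nQ i; rewrite Qi /= -leqNgt.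
Qed.

Section walk_at_fixed_time.
Context {R : realType} {d : nat} {Omega : Type}.
Variables (s : nat -> Omega -> R) (eta : nat -> Omega -> 'rV[R]_d).
Variables (w : Omega) (t : R).
Hypotheses (s0 : s 0%N w = 0) (s_incr : forall n, s n w < s n.+1 w).
Hypothesis (t_ge0 : 0 <= t).

Definition clip (i : nat) : R := Num.min (s i.+1 w) t - Num.min (s i w) t.

Lemma clock_le m n : (m <= n)%N -> s m w <= s n w.
Proof.
move=> /subnK <-; elim: (n - m)%N => // k IH.
by rewrite addSn (le_trans IH)// ltW.
Qed.

Lemma clip_ge0 i : 0 <= clip i.
Proof. by rewrite subr_ge0 le_min !ge_min clock_le// lexx orbT. Qed.

Lemma sum_clip n : \sum_(i < n) clip i = Num.min (s n w) t.
Proof.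
elim: n => [|n IH]; first by rewrite big_ord0 s0 min_l.
by rewrite big_ord_recr /= IH /clip addrC subrK.
Qed.

Lemma renewal_index_eq N : s N w <= t -> t < s N.+1 w ->
  renewal_index s t w = N.
Proof.
move=> sNt tsN; rewrite /renewal_index /supremum ifF; last first.
  by apply/negbTE/eqP => /seteqP[/(_ N sNt)].
case: xgetP => [k _ [kub klb]|/(_ N)[]].
  apply/eqP; rewrite eq_le; apply/andP; split.
    apply: klb => m /= smt; rewrite leEnat -ltnS ltnNge; apply/negP => Nm.
    by have := le_lt_trans smt tsN; rewrite ltNge clock_le.
  exact: kub.
split => [m /= smt|m]; last exact.
rewrite leEnat -ltnS ltnNge; apply/negP => Nm.
by have := le_lt_trans smt tsN; rewrite ltNge clock_le.
Qed.

Lemma renewal_index_ex n : t < s n w ->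
  exists N, [/\ (N < n)%N, s N w <= t & t < s N.+1 w].
Proof.
elim: n => [|n IH]; first by rewrite s0 ltNge t_ge0.
case: (leP (s n w) t) => [sn tsn|/IH[N [Nn]] *]; first by exists n.
by exists N; split => //; exact: ltnW.
Qed.

Lemma renewal_index_unbounded : (forall n, s n w <= t) ->
  renewal_index s t w = 0%N.
Proof.
move=> st; rewrite /renewal_index supremum_out// => -[_ [m]].
by move=> /(_ m.+1 (st _)); rewrite leEnat ltnn.
Qed.

(** The position at time [t] is a sum over any number of steps that takes the
    clock beyond [t], the steps being clipped at [t]; in this form the random
    number of steps has disappeared. *)
Lemma drrw_clip n : t < s n w ->
  drrw s eta t w = \sum_(i < n) clip i *: eta i w.
Proof.
move=> /renewal_index_ex[N [Nn sNt tsN]].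
rewrite /drrw (renewal_index_eq sNt tsN).
rewrite -(big_mkord xpredT (fun i => clip i *: eta i w)).
rewrite (@big_cat_nat _ _ _ N.+1)//= big_nat_recr//= big_mkord.
rewrite [X in _ = _ + X]big_nat_cond [X in _ = _ + X]big1 => [|i]; last first.
  rewrite andbT => /andP[Ni _].
  have tsi : t <= s i w by rewrite (le_trans (ltW tsN))// clock_le.
  by rewrite /clip !min_r ?subrr ?scale0r// (le_trans tsi)// clock_le.
rewrite addr0; congr (_ + _); last first.
  by rewrite /clip min_r ?(ltW tsN)// min_l.
apply: eq_bigr => i _; rewrite /clip !min_l//.
  by apply: le_trans sNt; rewrite clock_le// ltnW.
by apply: le_trans sNt; rewrite clock_le.
Qed.

Hypothesis (eta_le1 : forall n, `|eta n w| <= 1).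

Lemma clipped_walk_le n : `|\sum_(i < n) clip i *: eta i w| <= t.
Proof.
apply: le_trans (_ : Num.min (s n w) t <= t); last by rewrite ge_min lexx orbT.
rewrite -sum_clip (le_trans (ler_norm_sum _ _ _))// ler_sum// => i _.
by rewrite normrZ ger0_norm ?clip_ge0// ler_piMr ?clip_ge0.
Qed.

Lemma drrw_le : `|drrw s eta t w| <= t.
Proof.
have [[n tsn]|/forallNP st] := pselect (exists n, t < s n w).
  by rewrite (drrw_clip tsn) clipped_walk_le.
rewrite /drrw renewal_index_unbounded => [|n]; last first.
  by rewrite leNgt; apply/negP/st.
by rewrite big_ord0 add0r s0 subr0 normrZ ger0_norm// ler_piMr.
Qed.

Variables (b : nat -> nat) (M : nat) (delta : R).
Hypotheses (tE : t = M%:R * delta) (delta_ge0 : 0 <= delta).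
Hypothesis b_lower : forall i, (b i)%:R * delta <= s i.+1 w - s i w.
Hypothesis b_upper :
  forall i, (b i < M)%N -> s i.+1 w - s i w <= (b i).+1%:R * delta.

Fixpoint remaining (i : nat) : nat :=
  if i is k.+1 then (remaining k - b k)%N else M.

Lemma remaining_clock i : t - s i w <= (remaining i)%:R * delta.
Proof.
elim: i => [|i IH] /=; first by rewrite s0 subr0 tE.
case: (leqP (b i) (remaining i)) => [br|/ltnW rb].
  rewrite natrB// mulrBl; have := b_lower i; lra.
move: (rb); rewrite -subn_eq0 => /eqP ->.
have : (remaining i)%:R * delta <= (b i)%:R * delta.
  by rewrite ler_wpM2r// ler_nat.
have := b_lower i; lra.
Qed.

(** The grid clock runs behind the true one, so that a rounded step is cut at
    the horizon later than the true step; hence only the rounding of the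
    current step makes the true one longer. *)
Lemma clip_grid_le i :
  clip i - (minn (b i) (remaining i))%:R * delta <=
  ((s i w < t)%R)%:R * Num.min (s i.+1 w - s i w) delta.
Proof.
have Ti : s i w < s i.+1 w by [].
have bl := b_lower i; have rl := remaining_clock i.
have md : 0 <= (minn (b i) (remaining i))%:R * delta by rewrite mulr_ge0.
rewrite /clip; case: (ltP (s i w) t) => [st|ts] /=; last first.
  by rewrite (min_r (le_trans ts (ltW Ti))) subrr mul0r sub0r oppr_le0.
rewrite mul1r.
have bT : 0 <= (b i)%:R * delta by rewrite mulr_ge0.
have [bM|Mb] := ltnP (b i) M; last first.
  have tb : t <= (b i)%:R * delta by rewrite tE ler_wpM2r// ler_nat.
  have : t - s i w <= (minn (b i) (remaining i))%:R * delta.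
    by rewrite /minn; case: ifP => // _; have := clock_le (leq0n i); rewrite s0; lra.
  have := clock_le (leq0n i); rewrite s0 => si0 h.
  have h1 : Num.min (s i.+1 w) t <= t by rewrite ge_min lexx orbT.
  have h2 : 0 <= Num.min (s i.+1 w - s i w) delta by rewrite le_min delta_ge0 andbT; lra.
  lra.
have := b_upper bM; rewrite -natr1 mulrDl mul1r => bu.
have h1 : Num.min (s i.+1 w) t <= t by rewrite ge_min lexx orbT.
have h1' : Num.min (s i.+1 w) t <= s i.+1 w by rewrite ge_min lexx.
rewrite le_min; apply/andP; split; first lra.
by rewrite /minn; case: ifP => _; lra.
Qed.

(** Both families of steps run through the same stretch of time up to the
    clock, so that the total discrepancy is at most twice its positive part. *)
Lemma sum_clip_grid_le n :
  \sum_(i < n) `|clip i - (minn (b i) (remaining i))%:R * delta| <=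
  2 * \sum_(i < n) ((s i w < t)%R)%:R * Num.min (s i.+1 w - s i w) delta.
Proof.
have grid m : \sum_(i < m) (minn (b i) (remaining i))%:R * delta =
    t - (remaining m)%:R * delta.
  elim: m => [|m IH]; first by rewrite big_ord0 /= tE subrr.
  rewrite big_ord_recr /= IH /minn; case: ltnP => [br|rb].
    by rewrite natrB ?(ltnW br)//; ring.
  by move: (rb); rewrite -subn_eq0 => /eqP ->; ring.
have step i : `|clip i - (minn (b i) (remaining i))%:R * delta| <=
    2 * (((s i w < t)%R)%:R * Num.min (s i.+1 w - s i w) delta)
    - (clip i - (minn (b i) (remaining i))%:R * delta).
  have := clip_grid_le i.
  have : 0 <= ((s i w < t)%R)%:R * Num.min (s i.+1 w - s i w) delta.
    by rewrite mulr_ge0// le_min delta_ge0 andbT subr_ge0 ltW.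
  rewrite ler_norml => h1 h2; apply/andP; split; lra.
apply: le_trans (ler_sum _ (fun (i : 'I_n) _ => step i)) _.
rewrite big_split /= -mulr_sumr sumrN sumrB grid sum_clip.
rewrite lerBlDr lerDl.
have := remaining_clock n; rewrite /Num.min; case: ifP => _; first lra.
have : 0 <= (remaining n)%:R * delta by rewrite mulr_ge0.
lra.
Qed.

(** The walk of the rounded steps, with [t] as unit of length. *)
Fixpoint grid_position (i : nat) : 'rV[R]_d :=
  if i is k.+1 then
    grid_position k + ((minn (b k) (remaining k))%:R / M%:R) *: eta k w
  else 0.

Lemma grid_position_approx n : 0 < t ->
  `|t^-1 *: (\sum_(i < n) clip i *: eta i w) - grid_position n| <=
  t^-1 * (2 * \sum_(i < n) ((s i w < t)%R)%:R * Num.min (s i.+1 w - s i w) delta).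
Proof.
move=> t_gt0.
have gE : grid_position n =
    t^-1 *: \sum_(i < n) ((minn (b i) (remaining i))%:R * delta) *: eta i w.
  elim: n => [|n IH] /=; first by rewrite big_ord0 scaler0.
  rewrite big_ord_recr /= scalerDr -IH scalerA; congr (_ + _ *: _).
  rewrite tE invfM -!mulrA [delta^-1 * _]mulrCA mulVf ?mulr1 1?mulrC//.
  by move: t_gt0; rewrite tE; apply: contraTneq => ->; rewrite mulr0 ltxx.
rewrite gE -scalerBr normrZ ger0_norm ?invr_ge0// ler_pM2l ?invr_gt0//.
rewrite -sumrB (le_trans _ (sum_clip_grid_le n))//.
rewrite (le_trans (ler_norm_sum _ _ _))// ler_sum// => i _.
by rewrite -scalerBl normrZ ler_piMr.
Qed.

Lemma grid_position_le n : (0 < M)%N -> `|grid_position n| <= 1.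
Proof.
move=> M0; suff h : `|grid_position n| <= (M%:R - (remaining n)%:R) / M%:R.
  by rewrite (le_trans h)// ler_pdivrMr ?ltr0n// mul1r gerBl.
elim: n => [|n IH] /=; first by rewrite normr0 subrr mul0r.
rewrite (le_trans (ler_normD _ _))//.
have h : `|((minn (b n) (remaining n))%:R / M%:R) *: eta n w| <=
    (minn (b n) (remaining n))%:R / M%:R.
  by rewrite normrZ ger0_norm ?divr_ge0// ler_piMr// divr_ge0.
rewrite (le_trans (lerD IH h))// -mulrDl ler_wpM2r// ?invr_ge0//.
rewrite /minn; case: ltnP => [br|rb]; first by rewrite natrB ?(ltnW br)//; lra.
by move: (rb); rewrite -subn_eq0 => /eqP ->; lra.
Qed.

End walk_at_fixed_time.

(** * Quantization of the unit ball and Borel measurability *)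

Section measurability_tools.
Context {dO : measure_display} {Omega : measurableType dO} {R : realType}.

Lemma measurable_fun_nat (f : Omega -> nat) :
  (forall k, measurable [set w | (k <= f w)%N]) -> measurable_fun setT f.
Proof.
move=> mf _ B _; rewrite setTI.
have -> : f @^-1` B = \bigcup_(k in B)
    ([set w | (k <= f w)%N] `\` [set w | (k.+1 <= f w)%N]).
  apply/seteqP; split => [w Bw|w [k Bk [/= kf]]].
    by exists (f w) => //=; split => /=; [exact: leqnn|rewrite ltnn].
  by move=> /negP; rewrite -leqNgt => fk; have -> : f w = k by apply/eqP; rewrite eqn_leq fk.
apply: bigcup_measurable => k _; exact: measurableD.
Qed.

Lemma measurable_fibre_nat (f : Omega -> nat) (B : set nat) :
  measurable_fun setT f -> measurable (f @^-1` B).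
Proof. by move=> mf; rewrite -[X in measurable X]setTI; exact: mf. Qed.

Lemma measurable_finite_nat (I : finType) (X : Omega -> I) (g : I -> nat) :
  (forall i, measurable (X @^-1` [set i])) ->
  measurable_fun setT (fun w => g (X w)).
Proof.
move=> mX _ B _; rewrite setTI.
have -> : (fun w => g (X w)) @^-1` B = \bigcup_(i in [set i | B (g i)]) X @^-1` [set i].
  apply/seteqP; split => [w Bw|w [i Bi /= ->]//].
  by exists (X w).
by apply: fin_bigcup_measurable => //; exact: finite_finset.
Qed.

(** Uniform limits of discretizations are Borel: a point lies in an open set
    exactly when some discretization lies well inside it. *)
Lemma measurable_discretization (d : nat) (h : Omega -> 'rV[R]_d)
    (c : nat -> Omega -> nat) (dec : nat -> nat -> 'rV[R]_d) (e : nat -> R) :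
  (forall n, measurable_fun setT (c n)) ->
  (forall n w, `|h w - dec n (c n w)| <= e n) ->
  e @ \oo --> (0 : R) ->
  measurable_fun setT (h : Omega -> borelV R d).
Proof.
move=> mc hdec e0.
apply: (@measurability _ _ _ (borelV R d) setT _ (@open 'rV[R]_d)) => //.
move=> /= _ [V oV <-]; rewrite setTI.
have -> : h @^-1` V = \bigcup_n (c n @^-1`
    [set k | forall y, `|y - dec n k| <= e n -> V y]).
  apply/seteqP; split => [w Vw|w [n _ /=]]; last exact.
  have /nbhs_ballP[r /= r0 rV] : nbhs (h w) V by exact: open_nbhs_nbhs.
  have [n en] : exists n, e n < r / 2.
    have [N _ /(_ N (leqnn N)) eN] := cvgr_lt 0 e0 _ (divr_gt0 r0 (ltr0n _ 2)).
    by exists N.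
  exists n => // y /= ydec; apply: rV.
  rewrite -ball_normE /ball_ /=; have := hdec n w.
  have := ler_normB (h w - dec n (c n w)) (y - dec n (c n w)).
  rewrite opprB addrA subrK; lra.
by apply: bigcup_measurable => n _; exact: measurable_fibre_nat.
Qed.

End measurability_tools.

Section quantization.
Context {R : realType} {d : nat}.

Definition precision (n : nat) : R := n.+1%:R^-1.

Definition cell_index (n : nat) (x : R) : nat :=
  \max_(k < (n.+1 * 2).+1 | k%:R * precision n - 1 <= x) k.

Definition cell_type (n : nat) := {ffun 'I_d -> 'I_(n.+1 * 2).+1}.

Definition cell (n : nat) (y : 'rV[R]_d) : cell_type n :=
  [ffun i => inord (cell_index n (y ord0 i))].

Definition corner (n : nat) (c : cell_type n) : 'rV[R]_d :=
  \row_i ((c i)%:R * precision n - 1).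

Definition radix (n : nat) : nat := #|{: cell_type n}|.

(** The code of a point records its cells of all sizes down to the [n]-th, as
    the digits of an integer; so codes are nested, and the points with a given
    prefix of the code have consecutive codes. *)
Fixpoint cell_code (n : nat) (y : 'rV[R]_d) : nat :=
  if n is m.+1 then (cell_code m y * radix n + enum_rank (cell n y))%N
  else enum_rank (cell 0 y).

Fixpoint code_bound (n : nat) : nat :=
  if n is m.+1 then (code_bound m * radix n)%N else radix 0.

(** Only the last digit is read, as it determines the finest cell. *)
Definition decode_cell (n k : nat) : 'rV[R]_d :=
  corner (nth [ffun=> ord0] (enum {: cell_type n}) (k %% radix n)).

Lemma precision_gt0 n : 0 < precision n.
Proof. by rewrite invr_gt0 ltr0n. Qed.

Lemma cvg_precision : precision @ \oo --> (0 : R).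
Proof. exact: cvg_harmonic. Qed.

Lemma leq_cell_index n x k : (k <= cell_index n x)%N =
  (k == 0)%N || ((k <= n.+1 * 2)%N && (k%:R * precision n - 1 <= x)).
Proof.
apply: (@leq_bigmax_antitone (fun k => k%:R * precision n - 1 <= x)).
move=> i j /andP[_ ij] _; apply: le_trans.
by rewrite lerB// ler_wpM2r ?(ltW (precision_gt0 _))// ler_nat.
Qed.

Lemma cell_index_le n x : (cell_index n x <= n.+1 * 2)%N.
Proof.
by have := leqnn (cell_index n x); rewrite leq_cell_index => /orP[/eqP ->|/andP[]].
Qed.

Lemma cell_index_approx n x : `|x| <= 1 ->
  `|x - ((cell_index n x)%:R * precision n - 1)| <= precision n.
Proof.
rewrite ler_norml => /andP[x1 x2].
have p0 := precision_gt0 n.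
have pn : n.+1%:R * precision n = 1 by rewrite mulfV// pnatr_eq0.
rewrite ler_norml; apply/andP; split.
  have := leqnn (cell_index n x); rewrite leq_cell_index.
  by case/orP => [/eqP ->|/andP[_]]; lra.
have /negbT := ltnn (cell_index n x); rewrite leq_cell_index /= negb_and.
case/orP; last by rewrite -ltNge -natr1 mulrDl mul1r; lra.
rewrite -leqNgt => Nk.
have : (n.+1 * 2)%:R * precision n <= (cell_index n x)%:R * precision n.
  by rewrite ler_wpM2r ?(ltW p0)// ler_nat.
by rewrite natrM mulrAC pn; lra.
Qed.

Lemma coord_le_norm (y : 'rV[R]_d) i : `|y ord0 i| <= `|y|.
Proof.
rewrite [leRHS](_ : _ = mx_norm y)// mx_normrE; apply/bigmax_geP; right => /=.
by exists (ord0, i).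
Qed.

Lemma norm_le_coord (y : 'rV[R]_d) (e : R) : 0 <= e ->
  (forall i, `|y ord0 i| <= e) -> `|y| <= e.
Proof.
move=> e0 ye; rewrite [leLHS](_ : _ = mx_norm y)// mx_normrE; apply/bigmax_leP; split => //.
by move=> [i j] _ /=; rewrite ord1.
Qed.

Lemma corner_approx n (y : 'rV[R]_d) : `|y| <= 1 ->
  `|y - corner (cell n y)| <= precision n.
Proof.
move=> y1; apply: norm_le_coord => [|i]; first exact: ltW (precision_gt0 _).
rewrite !mxE ffunE inordK ?ltnS ?cell_index_le// cell_index_approx//.
exact: le_trans (coord_le_norm _ _) y1.
Qed.

Lemma corner_le1 n (c : cell_type n) : `|corner c| <= 1.
Proof.
apply: norm_le_coord => // i; rewrite mxE.
have p0 := precision_gt0 n.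
have : (c i)%:R * precision n <= (n.+1 * 2)%:R * precision n.
  by rewrite ler_wpM2r ?(ltW p0)// ler_nat -ltnS.
have -> : (n.+1 * 2)%:R * precision n = 2.
  by rewrite natrM mulrAC mulfV ?mul1r// pnatr_eq0.
have : 0 <= (c i)%:R * precision n by rewrite mulr_ge0// ltW.
by rewrite ler_norml; lra.
Qed.

Lemma decode_le1 n k : `|decode_cell n k| <= 1.
Proof. exact: corner_le1. Qed.

Lemma radix_gt0 n : (0 < radix n)%N.
Proof. by apply/card_gt0P; exists [ffun=> ord0]. Qed.

Lemma code_mod n y : (cell_code n y %% radix n)%N = enum_rank (cell n y).
Proof.
have r : (enum_rank (cell n y) < radix n)%N by exact: ltn_ord.
by case: n r => [|n] r /=; rewrite ?modnMDl modn_small.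
Qed.

Lemma cell_code_divS n y : (cell_code n.+1 y %/ radix n.+1)%N = cell_code n y.
Proof. by rewrite /= divnMDl ?radix_gt0// divn_small ?addn0// ltn_ord. Qed.

Lemma cell_code_lt n y : (cell_code n y < code_bound n)%N.
Proof.
elim: n => [|n IH] /=; first exact: ltn_ord.
by rewrite -ltn_divLR ?radix_gt0// divnMDl ?radix_gt0// divn_small ?addn0.
Qed.

Lemma decode_codeE n y : decode_cell n (cell_code n y) = corner (cell n y).
Proof. by rewrite /decode_cell code_mod nth_enum_rank. Qed.

Lemma decode_cell_code n (y : 'rV[R]_d) : `|y| <= 1 ->
  `|y - decode_cell n (cell_code n y)| <= precision n.
Proof. by move=> y1; rewrite decode_codeE corner_approx. Qed.

Context {dO : measure_display} {Omega : measurableType dO}.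

Lemma measurable_code n (Y : Omega -> 'rV[R]_d) :
  (forall i, measurable_fun setT (fun w => Y w ord0 i)) ->
  measurable_fun setT (fun w => cell_code n (Y w)).
Proof.
move=> mY.
have mcell m : measurable_fun setT (fun w => (enum_rank (cell m (Y w)) : nat)).
  apply: (measurable_finite_nat (fun c : cell_type m => (enum_rank c : nat))) => c.
  have -> : (fun w => cell m (Y w)) @^-1` [set c] = \bigcap_(i in [set: 'I_d])
      ((fun w => cell_index m (Y w ord0 i)) @^-1` [set k | inord k = c i]).
    apply/seteqP; split => [w <- i _ /=|w /= wc]; first by rewrite ffunE.
    by apply/ffunP => i; rewrite ffunE; exact: wc.
  apply: fin_bigcap_measurable => [|i _]; first exact: finite_finset.
  apply: measurable_fibre_nat; apply: measurable_fun_nat => k.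
  under eq_set do rewrite leq_cell_index.
  have mle : measurable [set w | k%:R * precision m - 1 <= Y w ord0 i].
    by rewrite -[X in measurable X]setTI; apply: measurable_fun_le.
  case: (k == 0)%N => /=.
    by rewrite [X in measurable X](_ : _ = setT)//; apply/seteqP; split.
  case: (k <= _)%N => //=.
  by rewrite [X in measurable X](_ : _ = set0)//; apply/seteqP; split.
elim: n => [|n IH] /=; first exact: mcell.
apply: measurable_fun_addn => //.
exact: (@measurableT_comp _ _ _ _ _ _ (fun k => (k * radix n.+1)%N)).
Qed.

Lemma measurable_coordinates (Y : Omega -> 'rV[R]_d) :
  (forall i, measurable_fun setT (fun w => Y w ord0 i)) ->
  (forall w, `|Y w| <= 1) ->
  measurable_fun setT (Y : Omega -> borelV R d).
Proof.
move=> mY Y1; apply: (@measurable_discretization _ _ _ _ _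
    (fun n w => cell_code n (Y w)) decode_cell precision).
- by move=> n; exact: measurable_code.
- by move=> n w; exact: decode_cell_code.
- exact: cvg_precision.
Qed.

Lemma measurable_continuous_comp (f : 'rV[R]_d -> R) (Y : Omega -> 'rV[R]_d) :
  continuous f -> measurable_fun setT (Y : Omega -> borelV R d) ->
  measurable_fun setT (f \o Y).
Proof.
move=> cf mY; apply: (measurability _ (RGenOpens.measurableE R)).
move=> _ [_ [a [b ->]] <-]; rewrite setTI comp_preimage.
rewrite -[X in measurable X]setTI; apply: mY => //.
apply: sub_sigma_algebra; apply: open_comp; last exact: interval_open.
by move=> x _; exact: cf.
Qed.

End quantization.

(** Uniform continuity on the unit ball, in the form in which it combines with
    estimates in mean: the modulus of continuity is below an affine function
    with arbitrarily small value at 0. *)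
Lemma continuous_affine_modulus (R : realType) (d : nat) (f : 'rV[R]_d -> R) :
  continuous f -> (exists M, forall x, `|f x| <= M) ->
  forall eps, 0 < eps -> exists2 C, 0 <= C &
    forall x y, `|x| <= 1 -> `|f x - f y| <= eps + C * `|x - y|.
Proof.
move=> cf [M fM] eps eps0.
have cB : compact [set x : 'rV[R]_d | `|x| <= 1].
  apply: bounded_closed_compact.
    by exists 1; split => // r r1 x /= /le_trans; apply; exact: ltW.
  rewrite (_ : mkset _ = (fun x : 'rV[R]_d => `|x|) @^-1` [set r | r <= 1])//.
  apply: closed_comp; last exact: closed_le.
  by move=> x _; exact: norm_continuous.
have [|dl /= dl0 dlf] := (compact_near_coveringP _).1 cB R (0^'+)
    (fun dl x => forall y, `|x - y| < dl -> `|f x - f y| <= eps) _.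
  move=> x _; have /nbhs_ballP[r /= r0 rf] : nbhs x [set y | `|f x - f y| < eps / 2].
    have /cvgrPdist_lt /(_ (eps / 2)) := cf x.
    by apply; rewrite divr_gt0.
  exists (ball x (r / 2), [set dl | dl < r / 2]).
    split => /=; first by apply: nbhsx_ballx; rewrite divr_gt0.
    by apply: nbhs_right_lt; rewrite divr_gt0.
  move=> [x' dl] [/=]; rewrite -ball_normE /ball_ /= => xx' dlr y x'y.
  have : `|f x - f x'| < eps / 2.
    by apply: rf; rewrite -ball_normE /ball_ /=; lra.
  have : `|f x - f y| < eps / 2.
    apply: rf; rewrite -ball_normE /ball_ /=.
    have := ler_normD (x - x') (x' - y); rewrite addrA subrK; lra.
  have := ler_normB (f x - f y) (f x - f x').
  have -> : f x - f y - (f x - f x') = f x' - f y by ring.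
  lra.
have dlf' := dlf (dl / 2); rewrite /ball_ /= sub0r normrN gtr0_norm ?divr_gt0// in dlf'.
have {}dlf' x : `|x| <= 1 -> forall y, `|x - y| < dl / 2 -> `|f x - f y| <= eps.
  by move=> x1; apply: dlf' => //; lra.
have M0 : 0 <= M := le_trans (normr_ge0 _) (fM 0).
exists (2 * M / (dl / 2)); first by rewrite !mulr_ge0// invr_ge0 ltW// divr_gt0.
move=> x y x1; have [xy|xy] := ltP `|x - y| (dl / 2).
  by rewrite (le_trans (dlf' _ x1 _ xy))// lerDl !mulr_ge0// invr_ge0 ltW// divr_gt0.
have : 2 * M <= 2 * M / (dl / 2) * `|x - y|.
  rewrite -{1}[2 * M](divfK (_ : dl / 2 != 0)) ?gt_eqF ?divr_gt0//.
  by rewrite ler_wpM2l// !mulr_ge0// invr_ge0 ltW// divr_gt0.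
have := ler_normB (f x) (f y); have := fM x; have := fM y; lra.
Qed.

(** Compactness of the unit interval. *)
Lemma ultra_cvg_unit_interval (R : realType) (T : Type) (F : set_system T)
    (phi : T -> R) : UltraFilter F -> (forall t, 0 <= phi t <= 1) ->
  exists l : R, phi @ F --> l.
Proof.
move=> UF phi01.
have UphiF : UltraFilter (phi @ F).
  split => [|G PG phiG]; first exact: fmap_proper_filter.
  apply/seteqP; split => [A GA|]; last exact: phiG.
  have [//|FnA] := in_ultra_setVsetC (phi @^-1` A) UF.
  have GnA : G (~` A) by apply: phiG.
  by have /filter_ex[x []] : G (A `&` ~` A) by exact: filterI.
have := @segment_compact R 0 1; rewrite compact_ultra => /(_ _ UphiF)[|l [_ ?]].
  by apply: (@filterE _ F) => t; rewrite /= in_itv; exact: phi01.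
by exists l.
Qed.

Section lebesgue_unit_interval.
Context {R : realType}.

Let mD : measurable (`[0, 1[%classic : set (measurableTypeR R)).
Proof. exact: measurable_itv. Qed.

Definition lebesgue01 : set (measurableTypeR R) -> \bar R :=
  mrestr (@lebesgue_measure R) mD.

HB.instance Definition _ := Measure.on lebesgue01.

Let lebesgue01_setT : lebesgue01 setT = 1%E.
Proof.
rewrite /lebesgue01 /mrestr setTI lebesgue_measure_itv /= lte_fin ltr01.
by rewrite sube0.
Qed.

HB.instance Definition _ :=
  Measure_isProbability.Build _ _ R lebesgue01 lebesgue01_setT.

Lemma prob_lebesgue01 (A : set (measurableTypeR R)) (a b : R) : a <= b ->
  A `&` `[0, 1[%classic = `[a, b[%classic -> prob lebesgue01 A = b - a.
Proof.
move=> ab Aab; rewrite /prob /= /lebesgue01 /mrestr /= Aab lebesgue_measure_itv /=.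
rewrite lte_fin; case: ltP => [_|ba] //=.
by have -> : a = b; [apply/eqP; rewrite eq_le ab|rewrite subrr].
Qed.

End lebesgue_unit_interval.

Lemma cvg_sum_seq (R : realType) (T : Type) (F : set_system T) (I : Type)
    (r : seq I) (f : I -> T -> R) (l : I -> R) : Filter F ->
  (forall i, f i @ F --> l i) ->
  (fun t => \sum_(i <- r) f i t) @ F --> \sum_(i <- r) l i.
Proof.
move=> FF fl; elim: r => [|i r IH].
  by rewrite big_nil; under eq_fun do rewrite big_nil; exact: cvg_cst.
by rewrite big_cons; under eq_fun do rewrite big_cons; apply: cvgD.
Qed.

(** * Limit points in law of a bounded family of random vectors *)

Lemma in_set_bool (T : Type) (Q : T -> bool) w : (w \in [set v | Q v]) = Q w.
Proof. by apply/idP/idP; rewrite inE. Qed.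

Section limit_law.
Context {R : realType} {d : nat} {dO : measure_display}.
Context {Omega : measurableType dO}.
Variables (P : probability Omega R) (Y : R -> Omega -> 'rV[R]_d).
Hypothesis mY : forall t i, measurable_fun setT (fun w => Y t w ord0 i).
Hypothesis Y_le1 : forall t w, `|Y t w| <= 1.

Local Notation decode_cell := (@decode_cell R d).
Local Notation precision := (@precision R).
Local Notation radix := (@radix d).
Local Notation code_bound := (@code_bound d).

(** Distribution functions rather than point probabilities: for nested codes
    they are restrictions of one another, which passes to the limit. *)
Definition code_cdf (n j : nat) (t : R) : R :=
  prob P [set w | (cell_code n (Y t w) < j)%N].

Let mcode n j t : measurable [set w | (cell_code n (Y t w) < j)%N].
Proof.
exact: (@measurable_fibre_nat _ _ _ [set k | (k < j)%N] (measurable_code n (mY t))).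
Qed.

Let mcode1 n j t : measurable [set w | cell_code n (Y t w) == j].
Proof.
exact: (@measurable_fibre_nat _ _ _ [set k | k == j] (measurable_code n (mY t))).
Qed.

Lemma code_cdf01 n j t : 0 <= code_cdf n j t <= 1.
Proof. by rewrite prob_ge0 prob_le1. Qed.

Lemma code_cdf_le n i j t : (i <= j)%N -> code_cdf n i t <= code_cdf n j t.
Proof. by move=> ij; apply: prob_le => // w /= /leq_trans; exact. Qed.

Lemma code_cdf0 n t : code_cdf n 0 t = 0.
Proof.
rewrite /code_cdf /prob (_ : [set w | _] = set0) ?measure0//.
by apply/seteqP; split.
Qed.

Lemma code_cdf1 n t : code_cdf n (code_bound n) t = 1.
Proof.
rewrite /code_cdf /prob (_ : [set w | _] = setT) ?probability_setT//.
by apply/seteqP; split => // w _; exact: cell_code_lt.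
Qed.

Lemma code_cdf_refine n j t :
  code_cdf n.+1 (j * radix n.+1)%N t = code_cdf n j t.
Proof.
rewrite /code_cdf; congr (prob P _); apply: eq_set => w.
by rewrite -ltn_divLR ?radix_gt0// cell_code_divS.
Qed.

Lemma code_cdfS n j t : code_cdf n j.+1 t =
  code_cdf n j t + prob P [set w | cell_code n (Y t w) == j].
Proof.
rewrite /code_cdf -!expect_indic// -expectD; [|exact: bm_indic..].
apply: eq_expect => w; rewrite !indicE -natrD; congr (_%:R).
by rewrite !in_set_bool ltnS leq_eqVlt; case: ltngtP.
Qed.

Section limit_along_an_ultrafilter.
Variables (F : set_system R) (UF : UltraFilter F) (c : nat -> nat -> R).
Hypothesis cvg_c : forall n j, code_cdf n j @ F --> c n j.

Let lim_unique (phi : R -> R) (l m : R) :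
  phi @ F --> l -> phi @ F --> m -> l = m.
Proof. by move=> h1 h2; rewrite -(cvg_lim _ h1)// (cvg_lim _ h2). Qed.

Lemma lim_cdf0 n : c n 0 = 0.
Proof.
apply: (@lim_unique (code_cdf n 0)) => //.
by rewrite (_ : code_cdf n 0 = cst 0); [exact: cvg_cst|apply/funext => t; exact: code_cdf0].
Qed.

Lemma lim_cdf1 n : c n (code_bound n) = 1.
Proof.
apply: (@lim_unique (code_cdf n (code_bound n))) => //.
by rewrite (_ : code_cdf n _ = cst 1); [exact: cvg_cst|apply/funext => t; exact: code_cdf1].
Qed.

Lemma lim_cdf_refine n j : c n.+1 (j * radix n.+1)%N = c n j.
Proof.
apply: (@lim_unique (code_cdf n j)) => //.
rewrite (_ : code_cdf n j = code_cdf n.+1 (j * radix n.+1)%N)//.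
by apply/funext => t; rewrite code_cdf_refine.
Qed.

Lemma lim_cdf_le n i j : (i <= j)%N -> c n i <= c n j.
Proof.
move=> ij; rewrite -subr_ge0.
apply: (cvgr_to_ge (cvgB (@cvg_c n j) (@cvg_c n i))).
by apply: (@filterE _ F) => t; rewrite /= subr_ge0 code_cdf_le.
Qed.

(** The quantile function of the limits of the laws of the codes, on the unit
    interval with Lebesgue measure. *)
Definition quantile_code (n : nat) (x : R) : nat :=
  \max_(k < (code_bound n).+1 | c n k <= x) k.

Lemma leq_quantile n (x : R) k : (k <= quantile_code n x)%N =
  (k == 0)%N || ((k <= code_bound n)%N && (c n k <= x)).
Proof.
apply: (@leq_bigmax_antitone (fun k => c n k <= x)) => i j /andP[_ ij] _.
by apply: le_trans; exact: lim_cdf_le.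
Qed.

Lemma quantile_itv n (x : R) j : 0 <= x < 1 -> (j < code_bound n)%N ->
  (quantile_code n x == j) = (c n j <= x < c n j.+1).
Proof.
move=> /andP[x0 x1] jb; rewrite eqn_leq [in RHS]ltNge andbC leq_quantile.
rewrite [(quantile_code n x <= j)%N]leqNgt leq_quantile jb /= (ltnW jb) /=; congr (_ && _).
by case: eqP => // ->; rewrite lim_cdf0 x0.
Qed.

Lemma quantile_lt n (x : R) : x < 1 -> (quantile_code n x < code_bound n)%N.
Proof.
move=> x1; rewrite ltnNge leq_quantile leqnn lim_cdf1 [_ <= x]leNgt x1 /= orbF.
suff : (0 < code_bound n)%N by case: (code_bound n).
by elim: n => [|n IH] /=; rewrite ?muln_gt0 ?radix_gt0 ?IH.
Qed.

Lemma quantile_divS n (x : R) :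
  (quantile_code n.+1 x %/ radix n.+1)%N = quantile_code n x.
Proof.
have e k : (k <= quantile_code n.+1 x %/ radix n.+1)%N =
    (k <= quantile_code n x)%N.
  rewrite leq_divRL ?radix_gt0// !leq_quantile /= leq_pmul2r ?radix_gt0//.
  by rewrite muln_eq0 [radix n.+1 == 0%N]eqn0Ngt radix_gt0 orbF lim_cdf_refine.
by apply/eqP; rewrite eqn_leq -e leqnn e leqnn.
Qed.

(** Only codes of positive limiting probability are quantiles, and these are
    codes of actual points. *)
Lemma quantile_occurs n (x : R) : 0 <= x < 1 ->
  exists t w, cell_code n (Y t w) = quantile_code n x.
Proof.
move=> x01; have jb : (quantile_code n x < code_bound n)%N.
  by case/andP: x01 => _; exact: quantile_lt.
have := quantile_itv x01 jb; rewrite eqxx => /esym/andP[cx xc].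
apply: contrapT => /forallNP no.
suff e : c n (quantile_code n x).+1 = c n (quantile_code n x).
  by have := le_lt_trans cx xc; rewrite e ltxx.
apply: (@lim_unique (code_cdf n (quantile_code n x))) => //.
rewrite (_ : code_cdf n (quantile_code n x) = code_cdf n (quantile_code n x).+1)//.
apply/funext => t; rewrite code_cdfS (_ : [set w | _] = set0).
  by rewrite /prob measure0 addr0.
by apply/seteqP; split => // w /= /eqP h; apply: (no t); exists w.
Qed.

Lemma quantile_prefix m n (x : R) (y : 'rV[R]_d) : (m <= n)%N ->
  cell_code n y = quantile_code n x -> cell_code m y = quantile_code m x.
Proof.
move=> /subnK <-; elim: (n - m)%N => // k IH.
by rewrite addSn => e; apply: IH; rewrite -cell_code_divS e quantile_divS.
Qed.

(** Changes nothing almost surely and makes the quantiles total on the line. *)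
Definition clamp01 (x : R) : R := if (0 <= x) && (x < 1) then x else 0.

Lemma clamp01_itv x : 0 <= clamp01 x < 1.
Proof. by rewrite /clamp01; case: ifP => //; rewrite lexx ltr01. Qed.

(** Both quantiles are codes of one and the same value of [Y]. *)
Lemma quantile_cauchy m n (x : R) : (m <= n)%N ->
  `|decode_cell m (quantile_code m (clamp01 x)) -
    decode_cell n (quantile_code n (clamp01 x))| <= precision m + precision n :> R.
Proof.
move=> mn; have [t [w cw]] := quantile_occurs n (clamp01_itv x).
rewrite -cw -(quantile_prefix mn cw).
have := decode_cell_code m (Y_le1 t w); have := decode_cell_code n (Y_le1 t w).
set u := decode_cell m _; set v := decode_cell n _ => yv yu.
have -> : u - v = (Y t w - v) - (Y t w - u) by rewrite opprB [RHS]addrC addrA subrK.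
by rewrite (le_trans (ler_normB _ _))// addrC lerD.
Qed.

Definition limit_point (x : R) : 'rV[R]_d :=
  lim ((fun n => decode_cell n (quantile_code n (clamp01 x))) @ \oo).

Lemma precision_le m n : (m <= n)%N -> precision n <= precision m :> R.
Proof. by move=> mn; rewrite lef_pV2 ?posrE ?ltr0n// ler_nat ltnS. Qed.

Lemma precision_small (e : R) : 0 < e -> exists n, precision n < e.
Proof.
move=> e0; have [N _ /(_ N (leqnn N)) eN] := cvgr_lt 0 cvg_precision _ e0.
by exists N.
Qed.

Lemma cvg_limit_point (x : R) :
  (fun n => decode_cell n (quantile_code n (clamp01 x))) @ \oo --> limit_point x.
Proof.
apply: cauchy_cvg; apply: cauchy_exP => e e0.
have [N eN] := precision_small (divr_gt0 e0 (ltr0n _ 2)).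
exists (decode_cell N (quantile_code N (clamp01 x))).
exists N => // n /= Nn; rewrite -ball_normE /ball_ /=.
by have := quantile_cauchy x Nn; have := precision_le Nn; lra.
Qed.

Lemma limit_point_approx n (x : R) :
  `|limit_point x - decode_cell n (quantile_code n (clamp01 x))| <=
  2 * precision n.
Proof.
rewrite distrC; set u := decode_cell _ _.
have h : (fun m => `|u - decode_cell m (quantile_code m (clamp01 x))|) @ \oo -->
    `|u - limit_point x|.
  by apply: cvg_norm; apply: cvgB; [exact: cvg_cst|exact: cvg_limit_point].
apply: (cvgr_to_le h); exists n => // m /= nm.
have := quantile_cauchy x nm; have := precision_le nm; rewrite /u; lra.
Qed.

Lemma limit_point_le1 (x : R) : `|limit_point x| <= 1.
Proof.
have h : (fun n => `|decode_cell n (quantile_code n (clamp01 x))|) @ \oo -->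
    `|limit_point x| by apply: cvg_norm; exact: cvg_limit_point.
apply: (cvgr_to_le h).
by apply: nearW => n; exact: decode_le1.
Qed.

Lemma measurable_quantile n : measurable_fun [set: measurableTypeR R]
  (fun x => quantile_code n (clamp01 x)).
Proof.
apply: measurable_fun_nat => k; under eq_set do rewrite leq_quantile.
have mclamp : measurable_fun [set: measurableTypeR R] clamp01.
  apply: measurable_fun_ifT => //.
  by apply: measurable_and; [exact: measurable_fun_ler|exact: measurable_fun_ltr].
have mle : measurable [set x : measurableTypeR R | c n k <= clamp01 x].
  by rewrite -[X in measurable X]setTI; apply: measurable_fun_le.
case: (k == 0)%N => /=.
  by rewrite [X in measurable X](_ : _ = setT)//; apply/seteqP; split.
case: (k <= _)%N => //=.
by rewrite [X in measurable X](_ : _ = set0)//; apply/seteqP; split.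
Qed.

Lemma measurable_limit_point :
  measurable_fun setT (limit_point : measurableTypeR R -> borelV R d).
Proof.
apply: (@measurable_discretization _ _ _ _ _
    (fun n x => quantile_code n (clamp01 x)) decode_cell (fun n => 2 * precision n)).
- exact: measurable_quantile.
- exact: limit_point_approx.
- by rewrite -[X in _ --> X](mulr0 (2 : R)); apply: cvgM; [exact: cvg_cst|exact: cvg_precision].
Qed.

Lemma prob_quantile n j : (j < code_bound n)%N ->
  prob (@lebesgue01 R) [set x | quantile_code n (clamp01 x) == j] =
  c n j.+1 - c n j.
Proof.
move=> jb; have cj0 : 0 <= c n j by rewrite -(lim_cdf0 n) lim_cdf_le.
have cj1 : c n j.+1 <= 1 by rewrite -(lim_cdf1 n) lim_cdf_le.
apply: prob_lebesgue01; first exact: lim_cdf_le.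
apply/seteqP; split => x /=; rewrite !in_itv /=.
  by move=> [+ x01]; rewrite /clamp01 x01 (quantile_itv x01 jb).
move=> /andP[cx xc].
have x01 : 0 <= x < 1 by rewrite (le_trans cj0)//= (lt_le_trans xc).
by rewrite /clamp01 x01 (quantile_itv x01 jb) cx.
Qed.

(** Finitely many codes: the convergence of their probabilities suffices, and
    neither continuity of [f] nor the mass of cell boundaries matters. *)
Lemma cvg_expect_decode n (f : 'rV[R]_d -> R) :
  expect P (fun w => f (decode_cell n (cell_code n (Y t w)))) @[t --> F] -->
  expect (@lebesgue01 R) (fun x => f (decode_cell n (quantile_code n (clamp01 x)))).
Proof.
have ql x : (quantile_code n (clamp01 x) < code_bound n)%N.
  by apply: quantile_lt; case/andP: (clamp01_itv x).
have -> := @expect_finite _ _ _ (@lebesgue01 R) 'I_(code_bound n)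
  (fun x => Ordinal (ql x)) (fun i => f (decode_cell n i)); last first.
  move=> i; rewrite [X in measurable X](_ : _ =
    (fun x => quantile_code n (clamp01 x)) @^-1` [set k | k = i :> nat]).
    exact: measurable_fibre_nat (measurable_quantile n).
  by apply/seteqP; split => x /= => [<-//|e]; exact/val_inj.
have e t : expect P (fun w => f (decode_cell n (cell_code n (Y t w)))) =
    \sum_(i < code_bound n) f (decode_cell n i) *
      (code_cdf n i.+1 t - code_cdf n i t).
  have -> := @expect_finite _ _ _ P 'I_(code_bound n)
    (fun w => Ordinal (cell_code_lt n (Y t w))) (fun i => f (decode_cell n i)).
    apply: eq_bigr => i _; rewrite code_cdfS [_ + _ - _]addrAC subrr add0r.
    congr (_ * prob P _); apply/seteqP.
    by split => w /= => [<-|/eqP e]; [exact: eqxx|exact/val_inj].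
  move=> i; rewrite [X in measurable X](_ : _ = [set w | cell_code n (Y t w) == i]).
    exact: mcode1.
  by apply/seteqP; split => w /= => [<-|/eqP e]; [exact: eqxx|exact/val_inj].
under eq_fun do rewrite e.
apply: cvg_sum_seq => i; apply: cvgM; first exact: cvg_cst.
rewrite [X in prob _ X](_ : _ = [set x | quantile_code n (clamp01 x) == i]).
  by rewrite prob_quantile//; apply: cvgB; exact: cvg_c.
by apply/seteqP; split => x /= => [<-|/eqP ee]; [exact: eqxx|exact/val_inj].
Qed.

(** The error of decoding is uniform in [t], so that the limits in [t] and in
    the size of the cells can be exchanged. *)
Lemma expect_limit_point (f : 'rV[R]_d -> R) (l : R) : continuous f ->
  (exists M, forall x, `|f x| <= M) ->
  expect P (f \o Y t) @[t --> F] --> l ->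
  expect (@lebesgue01 R) (f \o limit_point) = l.
Proof.
move=> cf bf fl; apply/eqP; rewrite -subr_eq0 -normr_le0.
apply/ler_addgt0Pr => e e0; rewrite add0r.
have [C C0 fC] := continuous_affine_modulus cf bf (divr_gt0 e0 (ltr0n _ 4)).
have [n Cn] : exists n, C * (2 * precision n) <= e / 4.
  have C1 : 0 < C + 1 by rewrite ltr_wpDl.
  have [n nn] := precision_small (divr_gt0 (divr_gt0 e0 (ltr0n R 8)) C1).
  exists n; have p0 := precision_gt0 (R := R) n.
  have : (C + 1) * precision n <= e / 8 by rewrite mulrC -ler_pdivlMr// ltW.
  rewrite mulrDl; lra.
have mb (g : 'rV[R]_d -> R) d' (T : measurableType d') (Z : T -> 'rV[R]_d) :
    (exists M, forall x, `|g x| <= M) -> measurable_fun setT (g \o Z) ->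
    bounded_measurable (g \o Z).
  by move=> [M gM] mg; split => //; exists M => w; exact: gM.
have bY t : bounded_measurable (f \o Y t).
  by apply: mb => //; apply: measurable_continuous_comp => //; exact: measurable_coordinates.
have bl : bounded_measurable (f \o limit_point : measurableTypeR R -> R).
  apply: mb => //; apply: (@measurable_continuous_comp _ _ _ (measurableTypeR R)) => //.
  exact: measurable_limit_point.
have bd (d' : measure_display) (T : measurableType d') (k : T -> nat) :
    measurable_fun setT k -> bounded_measurable (fun w => f (decode_cell n (k w))).
  move=> mk; apply: (mb f _ _ (fun w => decode_cell n (k w))) => //.
  exact: (@measurableT_comp _ _ _ _ _ _ (fun i => f (decode_cell n i))).
have bq : bounded_measurable (fun x : measurableTypeR R =>
    f (decode_cell n (quantile_code n (clamp01 x)))).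
  by apply: bd; exact: measurable_quantile.
have bc t : bounded_measurable (fun w => f (decode_cell n (cell_code n (Y t w)))).
  by apply: bd; exact: measurable_code.
have h1 t : `|expect P (f \o Y t) -
    expect P (fun w => f (decode_cell n (cell_code n (Y t w))))| <= e / 2.
  rewrite -expectB// (le_trans (expect_norm _ (bmB _ _)))//.
  rewrite -[leRHS](expect_cst P).
  apply: expect_le => [||w]; [exact/bm_norm/bmB|exact: bm_cst|].
  rewrite (le_trans (fC _ _ (Y_le1 _ _)))//.
  have := ler_wpM2l C0 (decode_cell_code n (Y_le1 t w)).
  have := precision_gt0 (R := R) n; have := mulr_ge0 C0 (ltW (precision_gt0 (R := R) n)); lra.
have h2 : `|expect (@lebesgue01 R) (f \o limit_point) -
    expect (@lebesgue01 R) (fun x => f (decode_cell n (quantile_code n (clamp01 x))))|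
    <= e / 2.
  rewrite -expectB// (le_trans (expect_norm _ (bmB _ _)))//.
  rewrite -[leRHS](expect_cst (@lebesgue01 R)).
  apply: expect_le => [||x]; [exact/bm_norm/bmB|exact: bm_cst|].
  rewrite (le_trans (fC _ _ (limit_point_le1 _)))//.
  have := ler_wpM2l C0 (limit_point_approx n x); lra.
have h3 : `|l - expect (@lebesgue01 R)
    (fun x => f (decode_cell n (quantile_code n (clamp01 x))))| <= e / 2.
  apply: (cvgr_to_le (cvg_norm (cvgB fl (cvg_expect_decode (n := n) (f := f))))).
  by apply: (@filterE _ F) => t; exact: h1.
set A := expect _ _ in h2 *; set B := expect _ _ in h2 h3.
have := ler_normB (A - B) (l - B).
have -> : A - B - (l - B) = A - l by ring.
lra.
Qed.

End limit_along_an_ultrafilter.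

(** Compactness: limits are taken along one ultrafilter, simultaneously for all
    cells of all sizes, and the limit law is that of the random point with these
    limiting cell probabilities. *)
Lemma limit_law_exists : exists mu : probability (borelV R d) R,
  forall f : 'rV[R]_d -> R, continuous f -> (exists M, forall x, `|f x| <= M) ->
  forall l : R, expect P (f \o Y t) @[t --> +oo] --> l ->
  (\int[mu]_x (f x)%:E)%E = l%:E.
Proof.
have [F [UF yF]] := ultraFilterLemma (@proper_pinfty_nbhs R).
have /choice[c cP] (nj : nat * nat) :
    exists l : R, code_cdf nj.1 nj.2 @ F --> l.
  by apply: ultra_cvg_unit_interval => t; exact: code_cdf01.
have cvg_c n j : code_cdf n j @ F --> c (n, j) by exact: (cP (n, j)).
pose g := limit_point (fun n j => c (n, j)).
have mg : measurable_fun setT (g : measurableTypeR R -> borelV R d).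
  exact: (measurable_limit_point UF cvg_c).
pose X : {RV (@lebesgue01 R) >-> borelV R d} :=
  HB.pack (g : measurableTypeR R -> borelV R d) (isMeasurableFun.Build _ _ _ _ _ mg).
exists (distribution (@lebesgue01 R) X) => f cf bf l fl.
rewrite -(expect_limit_point UF cvg_c cf bf (cvg_trans (cvg_app _ yF) fl)).
have bmf : bounded_measurable (f : borelV R d -> R).
  split; last by [].
  by have := @measurable_continuous_comp R d _ (borelV R d) f id cf; apply; exact: measurable_id.
rewrite integral_distribution; last 2 first.
- by case: bmf => mf _; exact/measurable_EFinP.
- apply: bm_integrable; case: bmf => mf [M fM]; split; last by exists M => x; exact: fM.
  exact: (@measurable_continuous_comp _ _ _ (measurableTypeR R) f g cf mg).
rewrite expectE//; split; last by case: bf => M fM; exists M => x; exact: fM.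
exact: (@measurable_continuous_comp _ _ _ (measurableTypeR R) f g cf mg).
Qed.

End limit_law.

(** * The Poisson equation of a finite irreducible chain *)

(** The image of [1 - p] is contained in the functions of mean zero under the
    invariant law, and has the same dimension since the harmonic functions are
    constant.  The solution operator [Q] is a pseudo-inverse of [1 - p]. *)
Lemma poisson_equation (R : fieldType) (I : finType) (p : I -> I -> R)
    (pi : I -> R) :
  (forall v, \sum_u pi u * p u v = pi v) ->
  (exists u, pi u != 0) ->
  (forall chi : I -> R, (forall u, chi u = \sum_v p u v * chi v) ->
     forall u v, chi u = chi v) ->
  exists Q : I -> I -> R, forall phi : I -> R, \sum_u pi u * phi u = 0 ->
    forall u, \sum_v Q u v * phi v -
              \sum_v p u v * (\sum_w Q v w * phi w) = phi u.
Proof.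
move=> pi_inv [u0 pi_u0] harmonic.
(* [A] is the transpose of [1 - p], as matrices act on row vectors here. *)
pose n := #|I|; pose A : 'M[R]_n :=
  \matrix_(v, u) ((u == v)%:R - p (enum_val u) (enum_val v)).
pose piV : 'cV[R]_n := \col_u pi (enum_val u).
have sumE (F : I -> R) : \sum_(i < n) F (enum_val i) = \sum_u F u.
  by rewrite -big_enum_val; apply: eq_bigl.
have rowA (x : 'rV[R]_n) u : (x *m A) ord0 u =
    x ord0 u - \sum_v p (enum_val u) (enum_val v) * x ord0 v.
  rewrite mxE; under eq_bigr do rewrite mxE mulrBr.
  rewrite sumrB; congr (_ - _); last by apply: eq_bigr => v _; rewrite mulrC.
  rewrite (bigD1 u)//= eqxx mulr1 big1 ?addr0// => v vu.
  by rewrite eq_sym (negbTE vu) mulr0.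
have ApiV : A *m piV = 0.
  apply/matrixP => v j; rewrite !mxE.
  under eq_bigr do rewrite !mxE mulrBl.
  rewrite sumrB (bigD1 v)//= eqxx mul1r big1 ?addr0 => [|u uv]; last first.
    by rewrite (negbTE uv) mul0r.
  rewrite -[in X in X - _]pi_inv (sumE (fun u => p u (enum_val v) * pi u)).
  by apply/eqP; rewrite subr_eq0; apply/eqP/eq_bigr => u _; rewrite mulrC.
have rk_pi : \rank (kermx piV) = n.-1.
  rewrite mxrank_ker; suff -> : \rank piV = 1%N by rewrite subn1.
  apply/eqP; rewrite eqn_leq rank_leq_col lt0n mxrank_eq0.
  apply: contra pi_u0 => /eqP/matrixP/(_ (enum_rank u0) ord0).
  by rewrite !mxE enum_rankK => ->.
(* The left kernel of [A] consists of harmonic functions. *)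
have rk_A : (n.-1 <= \rank A)%N.
  have : (kermx A <= (const_mx 1 : 'rV[R]_n))%MS.
    apply/rV_subP => x /sub_kermxP xA.
    have h u v : x ord0 u = x ord0 v.
      have := harmonic (fun i => x ord0 (enum_rank i)) _ (enum_val u) (enum_val v).
      rewrite !enum_valK; apply => i.
      have := rowA x (enum_rank i); rewrite xA mxE enum_rankK => /esym/eqP.
      rewrite subr_eq0 => /eqP ->.
      rewrite -(sumE (fun v => p i v * x ord0 (enum_rank v))).
      by apply: eq_bigr => k _; rewrite enum_valK.
    apply/sub_rVP; exists (x ord0 (enum_rank u0)); apply/rowP => v.
    by rewrite !mxE mulr1; exact: h.
  move=> /mxrankS; rewrite mxrank_ker => /leq_trans /(_ (rank_leq_row _)).
  by move=> h; lia.
have kA : (kermx piV <= A)%MS.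
  have AK : (A <= kermx piV)%MS by apply/sub_kermxP.
  by rewrite -(geq_leqif (mxrank_leqif_sup AK)) rk_pi.
exists (fun u v => pinvmx A (enum_rank v) (enum_rank u)) => phi phi0 u.
pose x : 'rV[R]_n := \row_i phi (enum_val i).
have xA : x *m pinvmx A *m A = x.
  apply: mulmxKpV; apply: submx_trans kA; apply/sub_kermxP.
  apply/matrixP => i j; rewrite !mxE; under eq_bigr do rewrite !mxE.
  by rewrite (sumE (fun u => phi u * pi u)) -[RHS]phi0; apply: eq_bigr => k _; rewrite mulrC.
have xQ i : (x *m pinvmx A) ord0 (enum_rank i) =
    \sum_v pinvmx A (enum_rank v) (enum_rank i) * phi v.
  rewrite mxE -(sumE (fun v => pinvmx A (enum_rank v) (enum_rank i) * phi v)).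
  by apply: eq_bigr => k _; rewrite mxE enum_valK mulrC.
have := rowA (x *m pinvmx A) (enum_rank u); rewrite xA mxE enum_rankK xQ => ->.
congr (_ - _); rewrite -(sumE (fun v => p u v *
  (\sum_w pinvmx A (enum_rank w) (enum_rank v) * phi w))).
by apply: eq_bigr => k _; rewrite -xQ enum_valK.
Qed.

(** * Regularly varying tails and truncated means *)

Section regularly_varying_tail.
Context {R : realType}.
Variables (h F : R -> R) (a c : R).
Hypotheses (a_lt1 : a < 1) (c_gt0 : 0 < c).
Hypothesis h_rv : regularly_varying h a.
Hypothesis hF : h t * F t @[t --> +oo] --> c.
Hypothesis F_ge0 : forall x, 0 <= F x.
Hypothesis F_le : forall x y, x <= y -> F y <= F x.

Lemma tail_gt0 x : 0 < F x.
Proof.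
have [M [_ hM]] := cvgr_gt c hF _ c_gt0.
pose y := Num.max x (M + 1).
have yM : M < y by rewrite lt_max ltrDl ltr01 orbT.
have /= Fy := hM _ yM.
apply: lt_le_trans (F_le (_ : x <= y)); last by rewrite le_max lexx.
by rewrite lt_neqAle F_ge0 andbT eq_sym; apply: contraTneq Fy => ->; rewrite mulr0 ltxx.
Qed.

Lemma cvg_scale_pinfty (l : R) : 0 < l -> l * t @[t --> +oo] --> +oo.
Proof. by move=> l0; apply: gt0_cvgMry => //; exact: cvg_id. Qed.

(** The constant [c] cancels in the ratio, so that the tail is regularly varying
    with the index opposite to that of [h]. *)
Lemma tail_ratio (l : R) : 0 < l -> F (l * t) / F t @[t --> +oo] --> l `^ (- a).
Proof.
move=> l0; have [L [hL Lrv]] := h_rv.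
have hFl : h (l * t) * F (l * t) @[t --> +oo] --> c.
  exact: (@cvg_comp _ _ _ (fun t => l * t) (fun t => h t * F t) _ _ _ (cvg_scale_pinfty l0) hF).
have r1 : (h (l * t) * F (l * t)) / (h t * F t) * (l `^ a * (L (l * t) / L t))^-1
    @[t --> +oo] --> c / c * (l `^ a * 1)^-1.
  apply: cvgM; first by apply: cvgM => //; apply: cvgV => //; rewrite gt_eqF.
  apply: cvgV; first by rewrite mulr1 gt_eqF// powR_gt0.
  by apply: cvgM; [exact: cvg_cst|exact: Lrv].
rewrite divff ?gt_eqF// mul1r mulr1 -powRN in r1.
apply: cvg_trans r1; apply: near_eq_cvg; near=> t.
have t0 : 0 < t by near: t; exact: nbhs_pinfty_gt.
have lt0 : 0 < l * t by exact: mulr_gt0.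
have ht : 0 < h t * F t by near: t; exact: (cvgr_gt c hF).
have hlt : 0 < h (l * t) * F (l * t) by near: t; exact: (cvgr_gt c hFl).
have Lt0 : L t != 0.
  by apply: contraTneq ht; rewrite hL// => ->; rewrite mulr0 mul0r ltxx.
have Llt0 : L (l * t) != 0.
  by apply: contraTneq hlt; rewrite (hL _ lt0) => ->; rewrite mulr0 mul0r ltxx.
rewrite (hL _ lt0) hL// powRM ?(ltW l0) ?(ltW t0)//.
have := tail_gt0 t; have := tail_gt0 (l * t).
have := powR_gt0 a l0; have := powR_gt0 a t0.
move: (t `^ a) (l `^ a) (F (l * t)) (F t) => x y z v x0 y0 z0 v0.
by field; rewrite Lt0 Llt0 !gt_eqF.
Unshelve. all: by end_near. Qed.

(** Karamata's bound for truncated means, by induction on dyadic scales: as the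
    index is less than 1, the tail loses less than a factor 2 from one scale to
    the next, so the contributions of the scales form a geometric series that
    the largest scale dominates. *)
Lemma karamata_bound (G : R -> R) : (forall x, 0 <= x -> G x <= x) ->
  (forall x, 0 < x -> G x <= G (x / 2) + x / 2 * F (x / 2)) ->
  exists K x0, [/\ 0 < K, 0 < x0 & forall x, x0 <= x -> G x <= K * x * F x].
Proof.
move=> Gx Gx2.
have two_a : 2^-1 < (2 : R) `^ (- a).
  rewrite powRN ltf_pV2 ?posrE ?powR_gt0//.
  rewrite -[ltRHS]powRr1// /powR pnatr_eq0 /= ltr_expR ltr_pM2r//.
  by rewrite ln_gt0// ltr1n.
(* [th] lies strictly between [1 / 2] and [2 ^ (- a)]: the second bound gives
   [F (x / 2) <= F x / th] for large [x], the first makes the ratio [rho] of the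
   geometric series less than 1. *)
pose th := (2^-1 + (2 : R) `^ (- a)) / 2.
have [th1 th2] : 2^-1 < th /\ th < (2 : R) `^ (- a) by rewrite /th; split; lra.
have th0 : 0 < th by lra.
have [M [_ hM]] := cvgr_gt _ (tail_ratio (ltr0n R 2)) _ th2.
pose x0 := Num.max 1 (M + 1).
have x00 : 0 < x0 by rewrite lt_max ltr01.
have Fhalf x : 2 * x0 <= x -> F (x / 2) <= F x / th.
  move=> xx; have Mx : M < x / 2.
    have : M + 1 <= x0 by rewrite le_max lexx orbT.
    lra.
  have /= := hM _ Mx; rewrite [2 * (x / 2)]mulrC divfK// ltr_pdivlMr ?tail_gt0// => /ltW.
  by rewrite ler_pdivlMr// mulrC.
pose rho := (2 * th)^-1.
have rho0 : 0 < rho by rewrite invr_gt0 mulr_gt0.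
have rho1 : rho < 1 by rewrite invf_lt1 ?mulr_gt0//; lra.
have F0 := tail_gt0 (2 * x0).
(* The first value gives [(K + 1) * rho <= K], which closes the induction step;
   the second lets [G x <= x] suffice up to the initial scale [2 * x0]. *)
pose K := Num.max (rho / (1 - rho)) (F (2 * x0))^-1.
have K1 : rho <= K * (1 - rho).
  by rewrite -ler_pdivrMr ?subr_gt0// le_max lexx.
have K2 : 1 <= K * F (2 * x0).
  by rewrite -ler_pdivrMr// div1r le_max lexx orbT.
have K0 : 0 < K by rewrite lt_max invr_gt0 F0 orbT.
have ind n x : x0 <= x -> x <= 2 ^+ n * (2 * x0) -> G x <= K * x * F x.
  elim: n x => [|n IH] x xx0 xn.
    have {}xn : x <= 2 * x0 by rewrite expr0 mul1r in xn.
    have x_ge0 : 0 <= x by rewrite (le_trans _ xx0)// ltW.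
    rewrite (le_trans (Gx _ x_ge0))// -mulrA mulrCA ler_peMr//.
    by rewrite (le_trans K2)// ler_wpM2l ?(ltW K0)// F_le.
  have [xs|xs] := leP x (2 * x0).
    by apply: IH => //; rewrite (le_trans xs)// ler_peMl ?mulr_ge0 ?exprn_ege1 ?ler1n// ltW.
  have x_gt0 : 0 < x by lra.
  have Gh : G (x / 2) <= K * (x / 2) * F (x / 2).
    by apply: IH; [lra|rewrite exprS in xn; lra].
  have Fh := Fhalf _ (ltW xs).
  apply: le_trans (Gx2 _ x_gt0) _.
  apply: le_trans (_ : (K + 1) * (x / 2) * (F x / th) <= _).
    have : (K + 1) * (x / 2) * F (x / 2) <= (K + 1) * (x / 2) * (F x / th).
      by rewrite ler_wpM2l// mulr_ge0// ?divr_ge0 ?addr_ge0 ?(ltW K0) ?(ltW x_gt0).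
    lra.
  have -> : (K + 1) * (x / 2) * (F x / th) = (K + 1) * rho * (x * F x).
    by rewrite /rho; field; rewrite gt_eqF.
  rewrite -[K * x * F x]mulrA ler_wpM2r ?mulr_ge0 ?(ltW x_gt0)//; lra.
exists K, x0; split => // x xx0.
have [n xn] : exists n, x <= 2 ^+ n * (2 * x0).
  exists (Num.bound (x / (2 * x0))); rewrite -ler_pdivrMr ?mulr_gt0//.
  have x1 : 0 <= x / (2 * x0).
    by rewrite divr_ge0 ?mulr_ge0 ?(ltW x00)// (le_trans _ xx0)// ltW.
  apply: le_trans (ltW (archi_boundP x1)) _.
  by rewrite -natrX ler_nat ltnW// ltn_expl.
exact: ind xn.
Qed.

End regularly_varying_tail.

(** * Holding times and the clock *)

Section grid_index.
Context {R : realType}.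
Variables (M : nat) (delta : R).

(** With a strict inequality, the index of a holding time is at least a given
    [k > 0] exactly on a tail event of the holding time. *)
Definition grid_index (x : R) : nat :=
  \max_(k < M.+1 | k%:R * delta < x) k.

Hypothesis delta_ge0 : 0 <= delta.

Lemma leq_grid_index x k : (k <= grid_index x)%N =
  (k == 0)%N || ((k <= M)%N && (k%:R * delta < x)).
Proof.
apply: (@leq_bigmax_antitone (fun k => k%:R * delta < x)) => i j /andP[_ ij] _.
by apply: le_lt_trans; rewrite ler_wpM2r// ler_nat.
Qed.

Lemma grid_index_le x : (grid_index x <= M)%N.
Proof.
by have := leqnn (grid_index x); rewrite leq_grid_index => /orP[/eqP ->|/andP[]].
Qed.

Lemma grid_index_lower x : 0 <= x -> (grid_index x)%:R * delta <= x.
Proof.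
move=> x0; have := leqnn (grid_index x); rewrite leq_grid_index.
by case/orP => [/eqP ->|/andP[_ /ltW//]]; rewrite mul0r.
Qed.

Lemma grid_index_upper x : (grid_index x < M)%N ->
  x <= (grid_index x).+1%:R * delta.
Proof.
move=> gM; have := ltnn (grid_index x); rewrite leq_grid_index gM /=.
by move=> /negbT; rewrite -leNgt.
Qed.

Lemma measurable_grid_index k :
  measurable [set x : measurableTypeR R | grid_index x = k].
Proof.
suff mf : measurable_fun setT (grid_index : measurableTypeR R -> nat).
  exact: (measurable_fibre_nat [set k] mf).
apply: measurable_fun_nat => j; under eq_set do rewrite leq_grid_index.
case: (j == 0)%N => /=.
  by rewrite [X in measurable X](_ : _ = setT)//; apply/seteqP; split.
case: (j <= M)%N => /=.
  rewrite [X in measurable X](_ : _ = `]j%:R * delta, +oo[%classic)//.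
  by apply/seteqP; split => x /=; rewrite in_itv /= andbT.
by rewrite [X in measurable X](_ : _ = set0)//; apply/seteqP; split.
Qed.

End grid_index.

Section renewal_estimates.
Context {R : realType} {dO : measure_display} {Omega : measurableType dO}.
Variables (P : probability Omega R) (s T : nat -> {RV P >-> R}).
Hypotheses (s_0 : forall w, s 0%N w = 0)
  (s_incr : forall n w, s n w < s n.+1 w)
  (T_def : forall n w, T n w = s n.+1 w - s n w)
  (T_indep : mutually_independent T)
  (T_ident : identically_distributed T).

Definition tail (x : R) : R := prob P [set w | x < T 0%N w].

Definition truncated_mean (x : R) : R :=
  expect P (fun w => Num.min (T 0%N w) x).

Lemma T_gt0 n w : 0 < T n w.
Proof. by rewrite T_def subr_gt0. Qed.

Lemma measurable_T_preimage n (B : set R) : measurable B -> measurable (T n @^-1` B).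
Proof. by move=> mB; rewrite -[X in measurable X]setTI; exact: measurable_funP. Qed.

Lemma measurable_T_gt n x : measurable [set w | x < T n w].
Proof.
rewrite (_ : [set w | _] = T n @^-1` `]x, +oo[%classic); first exact: measurable_T_preimage.
by apply/seteqP; split => w /=; rewrite in_itv /= andbT.
Qed.

Lemma measurable_s_lt n t : measurable [set w | s n w < t].
Proof.
rewrite (_ : [set w | _] = s n @^-1` `]-oo, t[%classic).
  by rewrite -[X in measurable X]setTI; exact: measurable_funP.
by apply/seteqP; split => w /=; rewrite in_itv.
Qed.

Lemma measurable_s_le n t : measurable [set w | s n w <= t].
Proof.
rewrite (_ : [set w | _] = s n @^-1` `]-oo, t]%classic).
  by rewrite -[X in measurable X]setTI; exact: measurable_funP.
by apply/seteqP; split => w /=; rewrite in_itv.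
Qed.

Lemma prob_T n (B : set R) : measurable B ->
  prob P (T n @^-1` B) = prob P (T 0%N @^-1` B).
Proof. by move=> mB; rewrite /prob; congr fine; exact: T_ident. Qed.

Lemma prob_box n (B : nat -> set R) : (forall j, measurable (B j)) ->
  prob P (\bigcap_(i in `I_n) (T i @^-1` B i)) =
  \prod_(i < n) prob P (T 0%N @^-1` B i).
Proof.
move=> mB; have := T_indep [fset i in iota 0 n]%fset mB.
have -> : [set` [fset i in iota 0 n]%fset] = `I_n.
  by apply/seteqP; split => i /=; rewrite !inE mem_iota.
rewrite (perm_big (iota 0 n)) => [|]; last first.
  by apply: uniq_perm; rewrite ?fset_uniq ?iota_uniq// => i; rewrite !inE.
have -> : iota 0 n = index_iota 0 n by rewrite /index_iota subn0.
move=> PE; rewrite /prob PE big_mkord.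
have : (forall j, P (T j @^-1` B j) = (prob P (T 0%N @^-1` B j))%:E).
  by move=> j; rewrite probE ?prob_T//; exact: measurable_T_preimage.
move=> e; under eq_bigr do rewrite e.
by rewrite prodEFin.
Qed.

Lemma tail_le x y : x <= y -> tail y <= tail x.
Proof.
by move=> xy; apply: prob_le; [exact: measurable_T_gt..|move=> w /=; exact: le_lt_trans].
Qed.

Lemma tail01 x : 0 <= tail x <= 1.
Proof. by rewrite prob_ge0 prob_le1//; exact: measurable_T_gt. Qed.

Lemma cvg_tail0 : tail t @[t --> +oo] --> 0.
Proof.
have := cvg_ccdfy0 (T 0%N) => /fine_cvg.
rewrite (_ : fine \o ccdf (T 0%N) = tail)//; apply/funext => x.
rewrite /tail /prob /ccdf /distribution /pushforward /=; congr (fine (P _)).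
by apply/seteqP; split => w /=; rewrite in_itv /= andbT.
Qed.

Lemma T_le_s n j w : (j < n)%N -> T j w <= s n w.
Proof.
move=> jn; rewrite T_def.
have sm := @clock_le _ _ (fun n => s n : _ -> _) w (s_incr ^~ w).
have := sm _ _ jn; have := sm _ _ (leq0n j); rewrite s_0; lra.
Qed.

(** A product event that contains [{s n <= t}]: its probability is explicit, and
    it is independent of the [n]-th holding time. *)
Definition all_below (t : R) (n : nat) : set Omega :=
  \bigcap_(i in `I_n) (T i @^-1` `]-oo, t]).

Lemma measurable_all_below t n : measurable (all_below t n).
Proof. by apply: fin_bigcap_measurable => // i _; exact: measurable_T_preimage. Qed.

Lemma prob_T_le t : prob P (T 0%N @^-1` `]-oo, t]) = 1 - tail t.
Proof.
rewrite -prob_setC; last exact: measurable_T_gt.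
by congr (prob P _); apply/seteqP; split => w /=; rewrite in_itv /= leNgt => /negP.
Qed.

Lemma prob_all_below t n : prob P (all_below t n) = (1 - tail t) ^+ n.
Proof.
rewrite (prob_box _ (fun=> measurable_itv _)) prodr_const card_ord.
by rewrite prob_T_le.
Qed.

Lemma all_below_s t n w : s n w <= t -> all_below t n w.
Proof. by move=> st i /= jn; rewrite in_itv /= (le_trans _ st)// T_le_s. Qed.

Lemma prob_s_le t n : prob P [set w | s n w <= t] <= (1 - tail t) ^+ n.
Proof.
rewrite -prob_all_below; apply: prob_le; [exact: measurable_s_le|exact: measurable_all_below|].
by move=> w; exact: all_below_s.
Qed.

(** Geometric series; it bounds the expected number of steps begun before
    time [t]. *)
Lemma sum_survival_le t n : 0 < tail t ->
  \sum_(i < n) (1 - tail t) ^+ i <= (tail t)^-1.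
Proof.
move=> t0; rewrite -[leRHS]mul1r ler_pdivlMr// mulrC.
have := subrX1 (1 - tail t) n.
have -> : 1 - tail t - 1 = - tail t by ring.
rewrite mulNr => /eqP; rewrite -eqr_oppLR opprB => /eqP <-.
by rewrite gerBl exprn_ge0// subr_ge0; case/andP: (tail01 t).
Qed.

Lemma bm_truncated n x : 0 <= x ->
  bounded_measurable (fun w => Num.min (T n w) x).
Proof.
move=> x0; split; first by apply: measurable_minr => //; exact: measurable_funP.
exists x => w; rewrite ger0_norm ?ge_min ?lexx ?orbT//.
by rewrite le_min x0 (ltW (T_gt0 _ _)).
Qed.

Lemma truncated_mean_le x : 0 <= x -> truncated_mean x <= x.
Proof.
move=> x0; rewrite -[leRHS](expect_cst P).
apply: expect_le => [||w]; [exact: bm_truncated|exact: bm_cst|].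
by rewrite ge_min lexx orbT.
Qed.

(** Dyadic recursion: what is between [x / 2] and [x] counts for at most
    [x / 2]. *)
Lemma truncated_mean_half x : 0 < x ->
  truncated_mean x <= truncated_mean (x / 2) + x / 2 * tail (x / 2).
Proof.
move=> x0; have x20 : 0 <= x / 2 by rewrite divr_ge0// ltW.
have bi := bm_indic (measurable_T_gt 0 (x / 2)).
rewrite /tail -expect_indic; last exact: measurable_T_gt.
rewrite -expectZ// -expectD; [|exact: bm_truncated|by apply: bmM => //; exact: bm_cst].
apply: expect_le => [||w]; [exact: bm_truncated (ltW x0)| |].
  by apply: bmD; [exact: bm_truncated|apply: bmM => //; exact: bm_cst].
rewrite indicE in_set_bool; case: ltP => Tx /=.
  by rewrite mulr1 ge_min; apply/orP; right; lra.
by rewrite mulr0 addr0 ge_min lexx.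
Qed.

(** By approximation of the truncated holding time on a fine grid, to the cells
    of which the independence applies. *)
Lemma expect_indep_minT (A : set Omega) n x : measurable A -> 0 < x ->
  (forall B : set R, measurable B ->
     prob P (A `&` T n @^-1` B) = prob P A * prob P (T 0%N @^-1` B)) ->
  expect P (fun w => \1_A w * Num.min (T n w) x) = prob P A * truncated_mean x.
Proof.
move=> mA x0 AB; apply/eqP; rewrite -subr_eq0 -normr_le0.
apply/ler_addgt0Pr => e e0; rewrite add0r.
have [N xN] : exists N : nat, 2 * x / N.+1%:R <= e.
  have x1 : 0 <= 2 * x / e by rewrite divr_ge0 ?mulr_ge0// ltW.
  exists (Num.bound (2 * x / e)); rewrite ler_pdivrMr ?ltr0n// -ler_pdivrMl//.
  rewrite mulrC (le_trans (ltW (archi_boundP x1)))// ler_nat; exact: leqnSn.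
pose dl := x / N.+1%:R.
have dl0 : 0 <= dl by rewrite divr_ge0// ltW.
pose k m w := grid_index N.+1 dl (T m w).
have kmin m w : `|Num.min (T m w) x - (k m w)%:R * dl| <= dl.
  have xE : N.+1%:R * dl = x by rewrite /dl mulrC divfK// pnatr_eq0.
  have k1 := grid_index_lower N.+1 dl0 (ltW (T_gt0 m w)).
  have k2 : (k m w)%:R * dl <= x.
    by rewrite -xE ler_wpM2r// ler_nat grid_index_le.
  have : (k m w)%:R * dl <= Num.min (T m w) x by rewrite le_min k1.
  have : Num.min (T m w) x <= (k m w)%:R * dl + dl.
    have [kN|] := ltnP (k m w) N.+1.
      have := grid_index_upper dl0 kN.
      rewrite -natr1 mulrDl mul1r ge_min => kk; apply/orP; left; exact: kk.
    move=> kN; have {kN} kN : k m w = N.+1.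
      by apply/eqP; rewrite eqn_leq kN grid_index_le.
    by rewrite ge_min kN xE; apply/orP; right; lra.
  rewrite ler_norml; lra.
have mk m i : measurable [set w | k m w = i].
  exact: (measurable_T_preimage m (measurable_grid_index N.+1 dl0 i)).
pose kk m w : 'I_N.+2 := inord (k m w).
have kkE m (i : 'I_N.+2) : kk m @^-1` [set i] = [set w | k m w = i].
  apply/seteqP; split => w /= => [<-|e']; first by rewrite inordK// ltnS grid_index_le.
  by apply/val_inj; rewrite /= inordK ?ltnS ?grid_index_le.
have kfin m w : (k m w)%:R * dl =
    \sum_(i < N.+2) i%:R * dl * \1_([set w | k m w = i]) w.
  rewrite -[in LHS](_ : (kk m w : nat) = k m w); last first.
    by rewrite inordK// ltnS grid_index_le.
  rewrite (finite_valued_indic (kk m) (fun i => i%:R * dl)).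
  by apply: eq_bigr => i _; rewrite kkE.
have bk m : bounded_measurable (fun w => (k m w)%:R * dl).
  under eq_fun do rewrite kfin.
  by apply: bm_sum => i; apply: bmM; [exact: bm_cst|exact: bm_indic].
have bA : bounded_measurable (\1_A : Omega -> R) by exact: bm_indic.
have E0 : expect P (fun w => (k 0%N w)%:R * dl) =
    \sum_(i < N.+2) i%:R * dl * prob P [set w | k 0%N w = i].
  under eq_expect do rewrite kfin.
  rewrite expect_sum => [|i].
    by apply: eq_bigr => i _; rewrite expectZ ?expect_indic//; exact: bm_indic.
  by apply: bmM; [exact: bm_cst|exact: bm_indic].
have En : expect P (fun w => \1_A w * ((k n w)%:R * dl)) =
    prob P A * expect P (fun w => (k 0%N w)%:R * dl).
  under eq_expect do rewrite kfin mulr_sumr.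
  rewrite E0 expect_sum => [|i]; last first.
    by apply: bmM => //; apply: bmM; [exact: bm_cst|exact: bm_indic].
  rewrite mulr_sumr; apply: eq_bigr => i _.
  have -> : expect P (fun w => \1_A w * (i%:R * dl * \1_([set w | k n w = i]) w)) =
      expect P (fun w => i%:R * dl * \1_(A `&` [set w | k n w = i]) w).
    by apply: eq_expect => w; rewrite indicI mulrCA.
  have mAk : measurable (A `&` [set w | k n w = i]) by exact: measurableI.
  rewrite expectZ; last exact: bm_indic.
  have e1 : prob P (A `&` [set w | k n w = i]) =
      prob P A * prob P [set w | k 0%N w = i].
    exact: (AB [set y | grid_index N.+1 dl y = i]
               (measurable_grid_index N.+1 dl0 i)).
  by rewrite expect_indic// e1; ring.
have bm m : bounded_measurable (fun w => Num.min (T m w) x).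
  by apply: bm_truncated; exact: ltW.
have d1 : `|expect P (fun w => \1_A w * Num.min (T n w) x) -
    expect P (fun w => \1_A w * ((k n w)%:R * dl))| <= dl.
  rewrite -expectB; [|exact: bmM..].
  rewrite (le_trans (expect_norm P (bmB (bmM bA (bm n)) (bmM bA (bk n)))))//.
  rewrite -[leRHS](expect_cst P).
  apply: expect_le => [||w]; [exact/bm_norm/bmB/bmM/bk/bA/bmM|exact: bm_cst|].
  rewrite -mulrBr normrM indicE; case: (_ \in _); rewrite ?normr1 ?mul1r ?kmin//.
  by rewrite normr0 mul0r.
have d2 : `|truncated_mean x - expect P (fun w => (k 0%N w)%:R * dl)| <= dl.
  rewrite -expectB// (le_trans (expect_norm P (bmB (bm 0%N) (bk 0%N))))//.
  rewrite -[leRHS](expect_cst P).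
  by apply: expect_le => //; [exact/bm_norm/bmB|exact: bm_cst].
have pA : 0 <= prob P A <= 1 by rewrite prob_ge0 prob_le1.
rewrite En in d1.
have d3 : `|prob P A * truncated_mean x -
    prob P A * expect P (fun w => (k 0%N w)%:R * dl)| <= dl.
  rewrite -mulrBr normrM ger0_norm ?prob_ge0//.
  by case/andP: pA => pA0 pA1; rewrite (le_trans _ d2)// ler_piMl.
have e2 : 2 * x / N.+1%:R = dl + dl by rewrite /dl; ring.
rewrite e2 in xN.
set X := expect _ _ in d1 *; set Z := prob P A * expect _ _ in d1 d3.
have := ler_normB (X - Z) (prob P A * truncated_mean x - Z).
have -> : X - Z - (prob P A * truncated_mean x - Z) =
  X - prob P A * truncated_mean x by ring.
lra.
Qed.

Lemma prob_all_below_indep t n (B : set R) : measurable B ->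
  prob P (all_below t n `&` T n @^-1` B) =
  prob P (all_below t n) * prob P (T 0%N @^-1` B).
Proof.
move=> mB; pose B' i : set R := if (i < n)%N then `]-oo, t]%classic else B.
have mB' i : measurable (B' i) by rewrite /B'; case: ifP.
have -> : all_below t n `&` T n @^-1` B = \bigcap_(i in `I_n.+1) (T i @^-1` B' i).
  apply/seteqP; split => [w [wb wB] i /= |w wB'].
    rewrite ltnS leq_eqVlt => /orP[/eqP -> |ni]; first by rewrite /B' ltnn.
    by rewrite /B' ni; exact: wb.
  split => [i /= ni|]; last by have := wB' n (ltnSn n); rewrite /B' /= ltnn.
  by have := wB' i (ltnW ni : (i < n.+1)%N); rewrite /B' /= ni.
rewrite prob_box// big_ord_recr /= {2}/B' ltnn prob_all_below; congr (_ * _).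
rewrite -prob_T_le (eq_bigr (fun=> prob P (T 0%N @^-1` `]-oo, t]))).
  by rewrite prodr_const card_ord.
by move=> i _; rewrite /B' ltn_ord.
Qed.

Lemma expect_min_before t x n : 0 < x ->
  expect P (fun w => ((s n w < t)%R)%:R * Num.min (T n w) x) <=
  (1 - tail t) ^+ n * truncated_mean x.
Proof.
move=> x0; have mA := measurable_all_below t n; have x_ge0 := ltW x0.
rewrite -prob_all_below -(expect_indep_minT mA x0 (@prob_all_below_indep t n)).
apply: expect_le => [||w].
- under eq_fun do rewrite -(@in_set_bool _ (fun w => s n w < t)) -indicE.
  by apply: bmM; [exact/bm_indic/measurable_s_lt|exact: bm_truncated].
- by apply: bmM; [exact: bm_indic|exact: bm_truncated].
- have m0 : 0 <= Num.min (T n w) x by rewrite le_min x_ge0 (ltW (T_gt0 _ _)).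
  rewrite ler_wpM2r// indicE; case: ltP => // st.
  by rewrite mem_set//; exact/all_below_s/ltW.
Qed.

End renewal_estimates.

(** * States driven by a chain and by independent marks *)

(** A state driven by a Markov chain [xi] and an independent sequence [beta] of
    independent marks, both with finitely many values. *)
Section driven_state.
Context {R : realType} {dO : measure_display} {Omega : measurableType dO}.
Variables (P : probability Omega R) (B I : finType) (S : Type).
Variables (beta : nat -> Omega -> B) (xi : nat -> Omega -> I).
Variables (q : B -> R) (p : I -> I -> R).
Variables (step : S -> B -> I -> S) (st0 : S).
Hypothesis mbeta : forall n b, measurable (beta n @^-1` [set b]).
Hypothesis mxi : forall n i, measurable (xi n @^-1` [set i]).

(** The chain is recorded one step further than the marks when [m = n.+1]: step
    [n] uses [beta n] and [xi n], and only then does the chain move. *)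
Definition cylinder (n m : nat) (b : nat -> B) (u : nat -> I) : set Omega :=
  \bigcap_(i in `I_n) (beta i @^-1` [set b i]) `&`
  \bigcap_(i in `I_m) (xi i @^-1` [set u i]).

Hypothesis prob_cylinder : forall n b u,
  prob P (cylinder n.+1 n.+2 b u) =
  prob P (cylinder n n.+1 b u) * (q (b n) * p (u n) (u n.+1)).

Fixpoint state_of (n : nat) (b : nat -> B) (u : nat -> I) : S :=
  if n is m.+1 then step (state_of m b u) (b m) (u m) else st0.

Definition state (n : nat) (w : Omega) : S :=
  state_of n (beta ^~ w) (xi ^~ w).

Lemma eq_state_of n b u b' u' :
  (forall i, (i < n)%N -> b i = b' i /\ u i = u' i) ->
  state_of n b u = state_of n b' u'.
Proof.
elim: n => //= n IH e; have [-> ->] := e n (ltnSn n).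
by rewrite IH// => i ni; apply: e; exact: ltnW.
Qed.

Variables (b0 : B) (i0 : I).

Definition marks n w : n.-tuple B := [tuple beta i w | i < n].
Definition trajectory n w : n.-tuple I := [tuple xi i w | i < n].

Lemma nth_marks n w i : (i < n)%N -> nth b0 (marks n w) i = beta i w.
Proof. by move=> ni; rewrite (nth_mktuple (fun i : 'I_n => beta i w) b0 (Ordinal ni)). Qed.

Lemma nth_trajectory n w i : (i < n)%N -> nth i0 (trajectory n w) i = xi i w.
Proof. by move=> ni; rewrite (nth_mktuple (fun i : 'I_n => xi i w) i0 (Ordinal ni)). Qed.

Lemma history_cylinder n m (b : n.-tuple B) (u : m.-tuple I) :
  (fun w => (marks n w, trajectory m w)) @^-1` [set (b, u)] =
  cylinder n m (nth b0 b) (nth i0 u).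
Proof.
apply/seteqP; split => [w [<- <-]|w [bw uw]].
  by split => i /= im; rewrite ?nth_marks ?nth_trajectory.
congr (_, _); apply: eq_from_tnth => i; rewrite tnth_mktuple.
  by rewrite (tnth_nth b0); exact: (bw i (ltn_ord i)).
by rewrite (tnth_nth i0); exact: (uw i (ltn_ord i)).
Qed.

Lemma measurable_cylinder n m b u : measurable (cylinder n m b u).
Proof.
by apply: measurableI; apply: fin_bigcap_measurable.
Qed.

Lemma history_step_cylinder n (b : n.-tuple B) (u : n.+1.-tuple I) b1 u1 :
  (fun w => ((marks n w, trajectory n.+1 w), (beta n w, xi n.+1 w))) @^-1`
    [set ((b, u), (b1, u1))] =
  cylinder n.+1 n.+2 (nth b0 (rcons b b1)) (nth i0 (rcons u u1)).
Proof.
have sb : size b = n by rewrite size_tuple.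
have su : size u = n.+1 by rewrite size_tuple.
apply/seteqP; split => [w [<- <- <- <-]|w [bw uw]].
  split => i im; rewrite /preimage /mkset nth_rcons size_tuple.
    have : (i < n.+1)%N by []; rewrite ltnS leq_eqVlt.
    by case/orP => [/eqP ->|im']; [rewrite ltnn eqxx|rewrite im' nth_marks].
  have : (i < n.+2)%N by []; rewrite ltnS leq_eqVlt.
  by case/orP => [/eqP ->|im']; [rewrite ltnn eqxx|rewrite im' nth_trajectory].
have h1 : marks n w = b.
  apply: eq_from_tnth => i; rewrite tnth_mktuple (tnth_nth b0).
  by have := bw i (ltnW (ltn_ord i : (i < n)%N)); rewrite /= nth_rcons sb ltn_ord.
have h2 : trajectory n.+1 w = u.
  apply: eq_from_tnth => i; rewrite tnth_mktuple (tnth_nth i0).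
  by have := uw i (ltnW (ltn_ord i : (i < n.+1)%N)); rewrite /= nth_rcons su ltn_ord.
have := bw n (ltnSn n); have := uw n.+1 (ltnSn n.+1).
by rewrite /= !nth_rcons sb su !ltnn !eqxx h1 h2 => -> ->.
Qed.

Lemma state_history n (G : S -> I -> R) w :
  G (state n w) (xi n w) =
  G (state_of n (nth b0 (marks n w)) (nth i0 (trajectory n.+1 w)))
    (nth i0 (trajectory n.+1 w) n).
Proof.
rewrite nth_trajectory//; congr (G _ _); apply: eq_state_of => i ni.
by rewrite nth_marks// nth_trajectory// ltnW.
Qed.

Lemma bm_state n (G : S -> I -> R) :
  bounded_measurable (fun w => G (state n w) (xi n w)).
Proof.
under eq_fun do rewrite state_history.
apply: (@bm_finite _ _ _ (n.-tuple B * n.+1.-tuple I)%type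
  (fun w => (marks n w, trajectory n.+1 w))
  (fun h => G (state_of n (nth b0 h.1) (nth i0 h.2)) (nth i0 h.2 n))).
by move=> [b u]; rewrite history_cylinder; exact: measurable_cylinder.
Qed.

(** One step of the Markov property of the pair of the state and the chain,
    obtained by summation over the finitely many histories. *)
Lemma expect_state n (G : S -> I -> R) :
  expect P (fun w => G (state n.+1 w) (xi n.+1 w)) =
  expect P (fun w => \sum_b \sum_v
    q b * p (xi n w) v * G (step (state n w) b (xi n w)) v).
Proof.
pose K (h : n.-tuple B * n.+1.-tuple I) (b : B) (v : I) :=
  G (step (state_of n (nth b0 h.1) (nth i0 h.2)) b (nth i0 h.2 n)) v.
pose L (h : n.-tuple B * n.+1.-tuple I) :=
  \sum_b \sum_v q b * p (nth i0 h.2 n) v * K h b v.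
transitivity (expect P (fun w => (fun z => K z.1 z.2.1 z.2.2)
    ((marks n w, trajectory n.+1 w), (beta n w, xi n.+1 w)))).
  apply: eq_expect => w /=; rewrite /K /= nth_trajectory//.
  congr (G (step _ _ _) _); apply: eq_state_of => i ni.
  by rewrite nth_marks// nth_trajectory// ltnW.
transitivity (expect P (fun w => L (marks n w, trajectory n.+1 w))); last first.
  apply: eq_expect => w; rewrite /L /K /= nth_trajectory//.
  apply: eq_bigr => b _; apply: eq_bigr => v _.
  rewrite (@eq_state_of n _ _ (beta^~ w) (xi^~ w))// => i ni.
  by rewrite nth_marks// nth_trajectory// ltnW.
rewrite (@expect_finite _ _ _ P ((n.-tuple B * n.+1.-tuple I) * (B * I))%type
  (fun w => ((marks n w, trajectory n.+1 w), (beta n w, xi n.+1 w)))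
  (fun z => K z.1 z.2.1 z.2.2)); last first.
  by move=> [[b u] [b1 u1]]; rewrite history_step_cylinder; exact: measurable_cylinder.
rewrite (@expect_finite _ _ _ P (n.-tuple B * n.+1.-tuple I)%type
  (fun w => (marks n w, trajectory n.+1 w)) L); last first.
  by move=> [b u]; rewrite history_cylinder; exact: measurable_cylinder.
pose C (h : n.-tuple B * n.+1.-tuple I) (b : B) (v : I) : R :=
  prob P (cylinder n.+1 n.+2 (nth b0 (rcons h.1 b)) (nth i0 (rcons h.2 v))).
transitivity (\sum_(h : n.-tuple B * n.+1.-tuple I) \sum_(bv : B * I)
    K h bv.1 bv.2 * C h bv.1 bv.2).
  rewrite (pair_bigA _ (fun h bv => K h bv.1 bv.2 * C h bv.1 bv.2))/=.
  by apply: eq_bigr => -[[b u] [b1 u1]] _; rewrite history_step_cylinder.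
apply: eq_bigr => -[b u] _; rewrite history_cylinder /L mulr_suml.
rewrite -(pair_bigA _ (fun b1 v => K (b, u) b1 v * C (b, u) b1 v))/=.
apply: eq_bigr => b1 _; rewrite mulr_suml; apply: eq_bigr => v _.
rewrite /C prob_cylinder /=.
have -> : cylinder n n.+1 (nth b0 (rcons b b1)) (nth i0 (rcons u v)) =
    cylinder n n.+1 (nth b0 b) (nth i0 u).
  by congr (_ `&` _); apply: eq_bigcapr => i /= ni; rewrite nth_rcons size_tuple ni.
by rewrite !nth_rcons !size_tuple !ltnn !eqxx ltnSn /=; ring.
Qed.

End driven_state.

(** * The mean of a function of the grid walk *)

Section perturbed_test_function.
Context {R : realType} {d : nat} {I : finType}.
Variables (M : nat) (dir : I -> 'rV[R]_d) (p : I -> I -> R) (pi : I -> R).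
Variables (r q : 'I_M.+1 -> R) (Q : I -> I -> R) (f : 'rV[R]_d -> R) (B : R).
Hypotheses (p_ge0 : forall u v, 0 <= p u v)
  (p_sum : forall u, \sum_v p u v = 1).
Hypotheses (pi_ge0 : forall u, 0 <= pi u) (pi_sum : \sum_u pi u = 1).
Hypotheses (r_ge0 : forall b, 0 <= r b) (r_sum : \sum_(b | b != ord0) r b = 1).
Hypotheses (q_ge0 : forall b, 0 <= q b) (q_sum : \sum_b q b = 1).
Hypothesis poissonQ : forall phi : I -> R, \sum_u pi u * phi u = 0 ->
  forall u, \sum_v Q u v * phi v - \sum_v p u v * (\sum_w Q v w * phi w) = phi u.
Hypothesis f_le : forall y, `|f y| <= B.

(** A state is the remaining number of grid cells before the horizon, and the
    current position. *)
Definition grid_step (x : nat * 'rV[R]_d) (b : 'I_M.+1) (u : I) : nat * 'rV[R]_d :=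
  ((x.1 - b)%N, x.2 + ((minn b x.1)%:R / M%:R) *: dir u).

(** Mean of [f] at the horizon for the limiting walk, whose steps have
    independent directions with law [pi] and cover independent numbers of cells
    with law [r].  Each step covers at least one cell, so that a recursion depth
    of at least the remaining number of cells yields the value. *)
Fixpoint limit_value (n : nat) (x : nat * 'rV[R]_d) : R :=
  if n is m.+1 then
    if x.1 == 0%N then f x.2
    else \sum_u pi u * \sum_(b | b != ord0) r b * limit_value m (grid_step x b u)
  else f x.2.

Lemma bound_ge0 : 0 <= B.
Proof. exact: le_trans (normr_ge0 _) (f_le 0). Qed.

Lemma weighted_sum_le (J : finType) (Z : pred J) (c F : J -> R) (D : R) :
  (forall j, 0 <= c j) -> (forall j, `|F j| <= D) ->
  `|\sum_(j | Z j) c j * F j| <= (\sum_(j | Z j) c j) * D.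
Proof.
move=> c0 FD; rewrite (le_trans (ler_norm_sum _ _ _))// mulr_suml ler_sum// => j _.
by rewrite normrM ger0_norm// ler_wpM2l.
Qed.

Lemma limit_value_le n x : `|limit_value n x| <= B.
Proof.
elim: n x => [|n IH] x /=; first exact: f_le.
case: eqP => // _.
have h u : `|\sum_(b | b != ord0) r b * limit_value n (grid_step x b u)| <= B.
  by rewrite (le_trans (weighted_sum_le _ r_ge0 (fun b => IH _)))// r_sum mul1r.
by rewrite (le_trans (weighted_sum_le _ pi_ge0 h))// pi_sum mul1r.
Qed.

Lemma limit_value_stable n x : (x.1 <= n)%N ->
  limit_value n.+1 x = limit_value n x.
Proof.
elim: n x => [|n IH] x xn; first by move: xn; rewrite leqn0 /= => ->.
rewrite [LHS]/= [RHS]/=; case: eqP => // /eqP x0.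
apply: eq_bigr => u _; congr (_ * _); apply: eq_bigr => b b0; congr (_ * _).
have b_gt0 : (0 < b)%N by rewrite lt0n.
apply: IH => /=; lia.
Qed.

Local Notation hbar := (limit_value M).

Lemma limit_value_fix x : (x.1 <= M)%N -> x.1 != 0%N ->
  hbar x = \sum_u pi u * \sum_(b | b != ord0) r b * hbar (grid_step x b u).
Proof. by move=> xM x0; rewrite -(limit_value_stable xM) /= (negbTE x0). Qed.

Lemma limit_value_absorbed n y : limit_value n (0%N, y) = f y.
Proof. by case: n. Qed.

Lemma grid_step_absorbed x b u : x.1 = 0%N -> grid_step x b u = x.
Proof.
by case: x => j y /= ->; rewrite /grid_step /= minn0 mul0r scale0r addr0 sub0n.
Qed.

Lemma grid_step0 x u : grid_step x ord0 u = x.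
Proof. by case: x => j y; rewrite /grid_step /= min0n mul0r scale0r addr0 subn0. Qed.

(** Mean change of [hbar] in a jump with direction [u]; only its average over
    the stationary law vanishes. *)
Definition drift (x : nat * 'rV[R]_d) (u : I) : R :=
  \sum_(b | b != ord0) r b * (hbar (grid_step x b u) - hbar x).

Lemma drift_mean0 x : (x.1 <= M)%N -> \sum_u pi u * drift x u = 0.
Proof.
move=> xM; have [x0|x0] := eqVneq x.1 0%N.
  rewrite big1// => u _; rewrite /drift big1 ?mulr0// => b _.
  by rewrite grid_step_absorbed// subrr mulr0.
transitivity (\sum_u (pi u * \sum_(b | b != ord0) r b * hbar (grid_step x b u) -
    pi u * hbar x)).
  apply: eq_bigr => u _; rewrite /drift -mulrBr; congr (_ * _).
  under eq_bigr do rewrite mulrBr.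
  by rewrite sumrB -mulr_suml r_sum mul1r.
by rewrite sumrB -mulr_suml pi_sum mul1r -limit_value_fix// subrr.
Qed.

(** The solution of the Poisson equation with right-hand side [drift x]. *)
Definition corrector (x : nat * 'rV[R]_d) (u : I) : R := \sum_v Q u v * drift x v.

Definition corrector_bound : R := \sum_u \sum_v `|Q u v| * (2 * B).

Lemma value_diff_le x y : `|hbar x - hbar y| <= 2 * B.
Proof.
have := ler_normB (hbar x) (hbar y); have := limit_value_le M x.
have := limit_value_le M y; lra.
Qed.

Lemma corrector_le x u : `|corrector x u| <= corrector_bound.
Proof.
have dr v : `|drift x v| <= 2 * B.
  rewrite (le_trans (weighted_sum_le _ r_ge0 (fun b => value_diff_le _ x)))//.
  by rewrite r_sum mul1r.
rewrite /corrector_bound (bigD1 u)//= (le_trans (ler_norm_sum _ _ _))//.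
apply: (@le_trans _ _ (\sum_v `|Q u v| * (2 * B))).
  by apply: ler_sum => v _; rewrite normrM ler_wpM2l.
by rewrite lerDl sumr_ge0// => i _; rewrite sumr_ge0// => v _; rewrite !mulr_ge0// bound_ge0.
Qed.

Lemma corrector_bound_ge0 : 0 <= corrector_bound.
Proof. by rewrite !sumr_ge0// => u _; rewrite sumr_ge0// => v _; rewrite !mulr_ge0// bound_ge0. Qed.

Definition jump_rate : R := \sum_(b | b != ord0) q b.

(** The corrector removes the dependence of the drift on the current direction,
    which is of first order in the jump rate; only the law of a jump given that
    there is one, and terms of second order, are left. *)
Definition test_function (x : nat * 'rV[R]_d) (u : I) : R :=
  hbar x + jump_rate * corrector x u.

Definition generator_bound : R :=
  2 * B * (\sum_(b | b != ord0) `|q b - jump_rate * r b|) +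
  2 * corrector_bound * jump_rate ^+ 2.

Lemma jump_rate_ge0 : 0 <= jump_rate.
Proof. by rewrite sumr_ge0. Qed.

Lemma generator_bound_ge0 : 0 <= generator_bound.
Proof.
have := bound_ge0; have := corrector_bound_ge0 => ? ?.
by rewrite addr_ge0// ?mulr_ge0// ?sumr_ge0// ?sqr_ge0.
Qed.

(** To first order in the jump rate the mean change of [test_function] in one
    step is the rate times the sum of the drift, from [hbar], and of its
    opposite, from the move of the chain inside the corrector; these cancel by
    the Poisson equation. *)
Lemma generator_le x u : (x.1 <= M)%N ->
  `|\sum_b \sum_v q b * p u v * test_function (grid_step x b u) v -
    test_function x u| <= (x.1 != 0%N)%:R * generator_bound.
Proof.
move=> xM.
have e0 : \sum_b \sum_v q b * p u v * test_function (grid_step x b u) v -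
    test_function x u =
  \sum_b q b * (hbar (grid_step x b u) - hbar x) +
  jump_rate * (\sum_b q b * (\sum_v p u v *
     (corrector (grid_step x b u) v - corrector x v)) +
     (\sum_v p u v * corrector x v - corrector x u)).
  have e1 : \sum_b q b * (hbar (grid_step x b u) - hbar x) =
      \sum_b q b * hbar (grid_step x b u) - hbar x.
    by under eq_bigr do rewrite mulrBr; rewrite sumrB -mulr_suml q_sum mul1r.
  have e2 : \sum_b q b * (\sum_v p u v *
     (corrector (grid_step x b u) v - corrector x v)) =
     \sum_b q b * (\sum_v p u v * corrector (grid_step x b u) v) -
     \sum_v p u v * corrector x v.
    transitivity (\sum_b (q b * (\sum_v p u v * corrector (grid_step x b u) v) -
        q b * (\sum_v p u v * corrector x v))).
      apply: eq_bigr => b _; rewrite -mulrBr -sumrB; congr (_ * _).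
      by apply: eq_bigr => v _; rewrite mulrBr.
    by rewrite sumrB -mulr_suml q_sum mul1r.
  have e3 : \sum_b \sum_v q b * p u v * test_function (grid_step x b u) v =
      \sum_b q b * hbar (grid_step x b u) +
      jump_rate * \sum_b q b * (\sum_v p u v * corrector (grid_step x b u) v).
    rewrite [jump_rate * _]mulr_sumr -big_split /=; apply: eq_bigr => b _.
    rewrite /test_function; transitivity (q b * (\sum_v (p u v * hbar (grid_step x b u) +
       jump_rate * (p u v * corrector (grid_step x b u) v)))).
      by rewrite mulr_sumr; apply: eq_bigr => v _; ring.
    rewrite big_split /= -mulr_suml p_sum mul1r -mulr_sumr; ring.
  rewrite e1 e2 e3 /test_function; ring.
have po : \sum_v p u v * corrector x v - corrector x u = - drift x u.
  by rewrite -(poissonQ (drift_mean0 xM) u) opprB.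
have [x0|x0] := eqVneq x.1 0%N.
  rewrite mul0r e0 po /drift !big1.
  - by rewrite !(oppr0, addr0, mulr0, normr0).
  - by move=> b _; rewrite grid_step_absorbed// subrr mulr0.
  - move=> b _; rewrite big1 ?mulr0// => v _.
    by rewrite grid_step_absorbed// subrr mulr0.
  - by move=> b _; rewrite grid_step_absorbed// subrr mulr0.
(* A holding time shorter than a cell leaves the state unchanged. *)
have drop0 (F : 'I_M.+1 -> R) : F ord0 = 0 -> \sum_b F b = \sum_(b | b != ord0) F b.
  by move=> F0; rewrite (bigD1 ord0)//= F0 add0r.
rewrite mul1r e0 po drop0; last by rewrite grid_step0 subrr mulr0.
rewrite [X in jump_rate * (X - _)]drop0; last first.
  by rewrite big1 ?mulr0// => v _; rewrite grid_step0 subrr mulr0.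
have -> : \sum_(b | b != ord0) q b * (hbar (grid_step x b u) - hbar x) =
   \sum_(b | b != ord0) (q b - jump_rate * r b) * (hbar (grid_step x b u) - hbar x) +
   jump_rate * drift x u.
  by rewrite /drift mulr_sumr -big_split; apply: eq_bigr => b _ /=; ring.
set X := \sum_(b | b != ord0) (q b - _) * _.
set Y := \sum_(b | b != ord0) q b * _.
have -> : X + jump_rate * drift x u + jump_rate * (Y - drift x u) = X + jump_rate * Y.
  by ring.
have hX : `|X| <= 2 * B * (\sum_(b | b != ord0) `|q b - jump_rate * r b|).
  rewrite /X (le_trans (ler_norm_sum _ _ _))// mulr_sumr ler_sum// => b _.
  by rewrite normrM mulrC ler_wpM2r// value_diff_le.
have hY : `|Y| <= jump_rate * (2 * corrector_bound).
  apply: weighted_sum_le => // b.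
  have h v : `|corrector (grid_step x b u) v - corrector x v| <= 2 * corrector_bound.
    have := ler_normB (corrector (grid_step x b u) v) (corrector x v).
    have := corrector_le (grid_step x b u) v; have := corrector_le x v; lra.
  by rewrite (le_trans (weighted_sum_le _ (p_ge0 u) h))// p_sum mul1r.
rewrite (le_trans (ler_normD _ _))// lerD// normrM ger0_norm ?jump_rate_ge0//.
have -> : 2 * corrector_bound * jump_rate ^+ 2 = jump_rate * (jump_rate * (2 * corrector_bound)).
  by ring.
by rewrite ler_wpM2l ?jump_rate_ge0.
Qed.

Context {dO : measure_display} {Omega : measurableType dO}.
Variables (P : probability Omega R).
Variables (beta : nat -> Omega -> 'I_M.+1) (xi : nat -> Omega -> I) (i0 : I).
Hypothesis mbeta : forall n b, measurable (beta n @^-1` [set b]).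
Hypothesis mxi : forall n i, measurable (xi n @^-1` [set i]).
Hypothesis prob_cylinder : forall n b u,
  prob P (cylinder beta xi n.+1 n.+2 b u) =
  prob P (cylinder beta xi n n.+1 b u) * (q (b n) * p (u n) (u n.+1)).

Local Notation st := (state beta xi grid_step (M, 0)).

Lemma state_le n w : ((st n w).1 <= M)%N.
Proof.
elim: n => [|n IH]; first exact: leqnn.
by rewrite /state /= (leq_trans (leq_subr _ _)).
Qed.

Let bms n (G : nat * 'rV[R]_d -> I -> R) :
  bounded_measurable (fun w => G (st n w) (xi n w)).
Proof. exact: (bm_state grid_step (M, 0) mbeta mxi ord0 i0). Qed.

Lemma measurable_nonabsorbed n : measurable [set w | (st n w).1 != 0%N].
Proof.
have [h _] := bms n (fun x _ => (x.1 != 0%N)%:R).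
have := h measurableT [set 1] (measurable_set1 _); rewrite setTI.
congr measurable; apply/seteqP; split => w /=.
  by case: (_ != _) => // /eqP; rewrite eq_sym oner_eq0.
by move=> ->.
Qed.

Lemma nonabsorbed_indic n w :
  ((st n w).1 != 0%N)%:R = \1_([set w | (st n w).1 != 0%N]) w :> R.
Proof. by rewrite indicE in_set_bool. Qed.

(** The mean of the test function drifts by at most [generator_bound] per step
    before absorption.  It is close to [hbar] at both ends, and [hbar] is [f]
    after absorption. *)
Theorem grid_walk_mean n :
  `|expect P (fun w => f (st n w).2) - hbar (M, 0)| <=
  2 * B * prob P [set w | (st n w).1 != 0%N] +
  2 * corrector_bound * jump_rate +
  generator_bound * \sum_(i < n) prob P [set w | (st i w).1 != 0%N].
Proof.
pose Phi m := expect P (fun w => test_function (st m w) (xi m w)).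
have incr m : `|Phi m.+1 - Phi m| <=
    generator_bound * prob P [set w | (st m w).1 != 0%N].
  rewrite /Phi (expect_state grid_step (M, 0) mbeta mxi prob_cylinder ord0 i0).
  have b1 := bms m (fun x u => \sum_b \sum_v q b * p u v * test_function (grid_step x b u) v).
  have b2 := bms m test_function.
  rewrite -expectB// (le_trans (expect_norm P (bmB b1 b2)))//.
  rewrite -expect_indic; last exact: measurable_nonabsorbed.
  rewrite -expectZ; last exact/bm_indic/measurable_nonabsorbed.
  apply: expect_le => [||w]; first exact/bm_norm/bmB.
    by apply: bmM; [exact: bm_cst|exact/bm_indic/measurable_nonabsorbed].
  by rewrite -nonabsorbed_indic mulrC; apply: generator_le; exact: state_le.
have tele : `|Phi n - Phi 0%N| <=
    generator_bound * \sum_(i < n) prob P [set w | (st i w).1 != 0%N].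
  elim: n => [|n IH]; first by rewrite subrr normr0 big_ord0 mulr0.
  rewrite big_ord_recr mulrDr -(subrKA (Phi n)) addrC.
  by rewrite (le_trans (ler_normD _ _))// lerD.
have Phi_h m : `|Phi m - expect P (fun w => hbar (st m w))| <=
    corrector_bound * jump_rate.
  have b1 := bms m (fun x _ => hbar x).
  have b2 := bms m test_function.
  rewrite /Phi -expectB// (le_trans (expect_norm P (bmB b2 b1)))//.
  rewrite -[leRHS](expect_cst P); apply: expect_le => [||w].
  - exact/bm_norm/bmB.
  - exact: bm_cst.
  - rewrite /test_function addrAC subrr add0r normrM mulrC.
    by rewrite (ger0_norm jump_rate_ge0) ler_wpM2r ?jump_rate_ge0// corrector_le.
have f_h : `|expect P (fun w => f (st n w).2) - expect P (fun w => hbar (st n w))| <=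
    2 * B * prob P [set w | (st n w).1 != 0%N].
  have b1 := bms n (fun x _ => hbar x).
  have b2 := bms n (fun x _ => f x.2).
  rewrite -expectB// (le_trans (expect_norm P (bmB b2 b1)))//.
  rewrite -expect_indic; last exact: measurable_nonabsorbed.
  rewrite -expectZ; last exact/bm_indic/measurable_nonabsorbed.
  apply: expect_le => [||w]; first exact/bm_norm/bmB.
    by apply: bmM; [exact: bm_cst|exact/bm_indic/measurable_nonabsorbed].
  rewrite -nonabsorbed_indic; case: (st n w) => j y /=; have [->|j0] := eqVneq j 0%N.
    by rewrite limit_value_absorbed subrr normr0 mulr0.
  rewrite mulr1; have := ler_normB (f y) (hbar (j, y)).
  have := f_le y; have := limit_value_le M (j, y); lra.
have h0 := Phi_h 0%N; rewrite /state /= expect_cst in h0.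
have hn := Phi_h n.
move: f_h tele h0 hn; set A := expect P _; set A' := expect P _.
rewrite !ler_norml; lra.
Qed.

End perturbed_test_function.

(** * The chain of directions *)

Lemma measurable_set1_borelV (R : realType) (d : nat) (u : 'rV[R]_d) :
  measurable ([set u] : set (borelV R d)).
Proof.
rewrite -[X in measurable X]setCK; apply: measurableC.
apply: sub_sigma_algebra; apply: closed_openC.
exact: (accessible_closed_set1 (hausdorff_accessible (@norm_hausdorff _ _))).
Qed.

Section direction_chain.
Context {R : realType} {d : nat} {dO : measure_display}.
Context {Omega : measurableType dO}.
Variables (U : {fset 'rV[R]_d}) (P : probability Omega R).
Variables (s T : nat -> {RV P >-> R}) (eta : nat -> {RV P >-> borelV R d}).
Variable (p : 'rV[R]_d -> 'rV[R]_d -> R).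
Hypotheses (T_def : forall n w, T n w = s n.+1 w - s n w)
  (T_indep : mutually_independent T)
  (T_ident : identically_distributed T)
  (eta_chain : irreducible_stationary_markov_chain U p eta)
  (eta_s_indep : independent_processes eta s).

Lemma eta_in n w : eta n w \in U.
Proof. by case: eta_chain => _ _ [h _] _. Qed.

(** Directions as elements of a finite type, so that functions on [U] form a
    finite-dimensional space and histories are finite in number. *)
Definition direction (n : nat) (w : Omega) : U := [` eta_in n w]%fset.

Lemma measurable_eta1 n (u : 'rV[R]_d) : measurable (eta n @^-1` [set u]).
Proof.
rewrite -[X in measurable X]setTI; apply: measurable_funP => //.
exact: measurable_set1_borelV.
Qed.

Lemma direction_fibre n (u : U) :
  direction n @^-1` [set u] = eta n @^-1` [set val u].
Proof.
by apply/seteqP; split => w /= => [<-//|e]; exact/val_inj.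
Qed.

Lemma measurable_direction n (u : U) : measurable (direction n @^-1` [set u]).
Proof. by rewrite direction_fibre; exact: measurable_eta1. Qed.

Lemma direction_path n (u : nat -> U) :
  \bigcap_(i in `I_n.+1) (direction i @^-1` [set u i]) =
  path_event eta 0 n (fun i => val (u i)).
Proof.
apply/seteqP; split => w h i /= ni.
  by have := h i ni; rewrite add0n => <-.
by apply/val_inj; have := h i ni; rewrite add0n.
Qed.

Definition p_in (u v : U) : R := p (val u) (val v).

Definition stationary_law (u : U) : R := prob P (direction 0 @^-1` [set u]).

Lemma measurable_path n (u : nat -> U) :
  measurable (\bigcap_(i in `I_n.+1) (direction i @^-1` [set u i])).
Proof. by apply: fin_bigcap_measurable => // i _; exact: measurable_direction. Qed.

Lemma prob_pathS n (u : nat -> U) :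
  prob P (\bigcap_(i in `I_n.+2) (direction i @^-1` [set u i])) =
  prob P (\bigcap_(i in `I_n.+1) (direction i @^-1` [set u i])) *
  p_in (u n) (u n.+1).
Proof.
have m1 := measurable_path n u.
rewrite direction_path in m1; rewrite !direction_path /prob.
have [_ _ [_ mk] _] := eta_chain; rewrite mk => [|i]; last exact: valP.
by rewrite [X in fine (X * _)%E]probE.
Qed.

Lemma prob_direction n (u : U) : prob P (direction n @^-1` [set u]) = stationary_law u.
Proof.
rewrite /stationary_law !direction_fibre /prob; congr fine.
case: eta_chain => _ _ _ /(_ n 0%N (fun=> val u)).
have e k : path_event eta k 0 (fun=> val u) = eta k @^-1` [set val u].
  apply/seteqP; split => w /=; first by move=> /(_ 0%N (leqnn 0)); rewrite /= addn0.
  by move=> h i /=; rewrite leqn0 => /eqP ->; rewrite addn0.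
by rewrite !e; apply => _; exact: valP.
Qed.

Lemma p_in_ge0 u v : 0 <= p_in u v.
Proof. by case: eta_chain => -[p0 _] _ _ _; apply: p0; exact: valP. Qed.

Lemma p_in_sum u : \sum_v p_in u v = 1.
Proof.
case: eta_chain => -[_ p1] _ _ _; rewrite -(p1 (val u) (valP u)).
by rewrite (big_seq_fsetE _ _ xpredT (fun v => p (val u) v)).
Qed.

Lemma stationary_law_ge0 u : 0 <= stationary_law u. Proof. exact: prob_ge0. Qed.

Lemma stationary_law_sum : \sum_u stationary_law u = 1.
Proof.
have := @expect_finite _ _ _ P U (direction 0) (fun=> 1) (measurable_direction 0).
rewrite expect_cst => ->; apply: eq_bigr => u _; by rewrite mul1r.
Qed.

Lemma stationary_law_inv v : \sum_u stationary_law u * p_in u v = stationary_law v.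
Proof.
have mv := measurable_direction 1 v.
rewrite -(prob_direction 1 v) -expect_indic//.
have e w : \1_(direction 1 @^-1` [set v]) w = \sum_u
    \1_(direction 1 @^-1` [set v] `&` direction 0 @^-1` [set u]) w :> R.
  under eq_bigr do rewrite indicI; rewrite -mulr_sumr.
  have := finite_valued_indic (direction 0) (fun=> 1 : R) w.
  by under eq_bigr do rewrite mul1r; move=> <-; rewrite mulr1.
under [RHS]eq_expect do rewrite e.
have mI u : measurable (direction 1 @^-1` [set v] `&` direction 0 @^-1` [set u]).
  by apply: measurableI => //; exact: measurable_direction.
rewrite expect_sum => [|u]; last exact: bm_indic.
apply: eq_bigr => u _; rewrite expect_indic//.
have := prob_pathS 0 (fun i => if i == 0%N then u else v).
rewrite /= (_ : \bigcap_(i in `I_1) _ = direction 0 @^-1` [set u]).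
  rewrite -/(stationary_law u) => <-; congr (prob P _).
  apply/seteqP; split => w /=; first by move=> h; split; [exact: (h 1%N)|exact: (h 0%N)].
  by move=> [h1 h0] [|[|i]] //=.
by apply/seteqP; split => w /=; [move=> /(_ 0%N); exact|move=> h [|i]].
Qed.

Local Notation tp n u v := (transition_power U p n (val (u : U)) (val (v : U))).

Lemma transition_powerS n (u v : U) : tp n.+1 u v = \sum_w p_in u w * tp n w v.
Proof.
by rewrite /= (big_seq_fsetE _ _ xpredT (fun w => p (val u) w * transition_power U p n w (val v))).
Qed.

Lemma transition_power_ge0 n (u v : U) : 0 <= tp n u v.
Proof.
elim: n u => [|n IH] u; first by rewrite /= ler0n.
by rewrite transition_powerS sumr_ge0// => w _; rewrite mulr_ge0// p_in_ge0.
Qed.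

Lemma harmonic_transition_power (chi : U -> R) n u :
  (forall v, chi v = \sum_w p_in v w * chi w) ->
  chi u = \sum_v tp n u v * chi v.
Proof.
move=> h; elim: n u => [|n IH] u.
  rewrite (bigD1 u)//= eqxx mul1r big1 ?addr0// => v vu.
  by rewrite (inj_eq val_inj) eq_sym (negbTE vu) mul0r.
under eq_bigr do rewrite transition_powerS mulr_suml.
rewrite exchange_big /= [LHS]h; apply: eq_bigr => w _; rewrite [in LHS]IH mulr_sumr.
by apply: eq_bigr => v _; rewrite mulrA.
Qed.

(** Maximum principle: an average of values that attains their maximum is an
    average of maxima, and irreducibility gives every point positive weight in
    some such average. *)
Lemma harmonic_cst (chi : U -> R) :
  (forall u, chi u = \sum_v p_in u v * chi v) -> forall u v, chi u = chi v.
Proof.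
move=> h u v.
pose m := [arg max_(i > u) chi i]%O.
have mmax i : chi i <= chi m by rewrite /m; case: arg_maxP => // j _; exact.
suff e w : chi w = chi m by rewrite !e.
have [_ irr _ _] := eta_chain.
have [n tpn] := irr (val m) (val w) (valP m) (valP w).
have tp1 : \sum_v tp n m v = 1.
  have -> : 1 = \sum_v tp n m v * 1; last by apply: eq_bigr => i _; rewrite mulr1.
  apply: (@harmonic_transition_power (fun=> 1)) => i.
  by under eq_bigr do rewrite mulr1; rewrite p_in_sum.
have z : \sum_v tp n m v * (chi m - chi v) = 0.
  under eq_bigr do rewrite mulrBr.
  by rewrite sumrB -mulr_suml tp1 mul1r -harmonic_transition_power// subrr.
have z_ge0 i : 0 <= tp n m i * (chi m - chi i).
  by rewrite mulr_ge0 ?transition_power_ge0// subr_ge0.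
have /(_ w isT)/eqP := psumr_eq0P (fun i _ => z_ge0 i) z.
by rewrite mulf_eq0 gt_eqF//= subr_eq0 => /eqP.
Qed.

Lemma stationary_law_transition_power n v : \sum_u stationary_law u * tp n u v = stationary_law v.
Proof.
elim: n v => [|n IH] v.
  rewrite (bigD1 v)//= eqxx mulr1 big1 ?addr0// => u uv.
  by rewrite (inj_eq val_inj) (negbTE uv) mulr0.
under eq_bigr do rewrite transition_powerS mulr_sumr.
rewrite exchange_big /= -[RHS]IH; apply: eq_bigr => w _.
by under eq_bigr do rewrite mulrA; rewrite -mulr_suml stationary_law_inv.
Qed.

(** Some point has positive mass, and by irreducibility invariance spreads it to
    every point. *)
Lemma stationary_law_gt0 v : 0 < stationary_law v.
Proof.
have [u pu] : exists u, 0 < stationary_law u.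
  apply: contrapT => /forallNP h; have := stationary_law_sum; rewrite big1 => [|u _].
    by move=> /eqP; rewrite eq_sym oner_eq0.
  by apply/eqP; rewrite eq_le stationary_law_ge0 andbT leNgt; apply/negP/h.
have [_ irr _ _] := eta_chain.
have [n tpn] := irr (val u) (val v) (valP u) (valP v).
rewrite -(stationary_law_transition_power n) (bigD1 u)//= ltr_pwDl ?mulr_gt0// sumr_ge0// => i _.
by rewrite mulr_ge0 ?stationary_law_ge0 ?transition_power_ge0.
Qed.

Let sigma_eta := \bigcup_n g_sigma_algebra_preimage (eta n).
Let sigma_s := \bigcup_n g_sigma_algebra_preimage (s n).

Lemma process_eta_path n (u : nat -> U) : process_sigma_algebra eta
  (\bigcap_(i in `I_n) (direction i @^-1` [set u i])).
Proof.
suff : measurable (\bigcap_(i in `I_n) (direction i @^-1` [set u i]) :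
  set (g_sigma_algebraType sigma_eta)) by [].
apply: fin_bigcap_measurable => // i _; rewrite direction_fibre.
apply: sub_sigma_algebra; exists i => //.
exists [set val (u i)]; last by rewrite setTI.
exact: measurable_set1_borelV.
Qed.

Lemma process_s_T n (B : nat -> set R) : (forall i, measurable (B i)) ->
  process_sigma_algebra s (\bigcap_(i in `I_n) (T i @^-1` B i)).
Proof.
move=> mB; suff : measurable (\bigcap_(i in `I_n) (T i @^-1` B i) :
  set (g_sigma_algebraType sigma_s)) by [].
have ms k : measurable_fun setT (s k : g_sigma_algebraType sigma_s -> R).
  move=> _ C mC; rewrite setTI; apply: sub_sigma_algebra; exists k => //.
  by exists C => //; rewrite setTI.
apply: fin_bigcap_measurable => // i _.
have mTi : measurable_fun setT (T i : g_sigma_algebraType sigma_s -> R).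
  rewrite (_ : (T i : _ -> _) = (fun w => s i.+1 w - s i w)).
    exact: measurable_funB.
  by apply/funext => w; exact: T_def.
by rewrite -[X in measurable X]setTI; exact: mTi.
Qed.

Section marks.
Variables (M : nat) (delta : R).
Hypothesis delta_ge0 : 0 <= delta.

Definition mark (n : nat) (w : Omega) : 'I_M.+1 :=
  inord (grid_index M delta (T n w)).

Definition mark_law (b : 'I_M.+1) : R := prob P (mark 0 @^-1` [set b]).

Lemma mark_fibre n (b : 'I_M.+1) :
  mark n @^-1` [set b] = T n @^-1` [set x | grid_index M delta x = b].
Proof.
apply/seteqP; split => w /= => [<-|e]; first by rewrite inordK// ltnS grid_index_le.
by apply/val_inj; rewrite /= inordK ?ltnS ?grid_index_le.
Qed.

Lemma measurable_mark n (b : 'I_M.+1) : measurable (mark n @^-1` [set b]).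
Proof. by rewrite mark_fibre; apply: measurable_T_preimage; exact: measurable_grid_index. Qed.

Lemma mark_law_ge0 b : 0 <= mark_law b. Proof. exact: prob_ge0. Qed.

Lemma mark_law_sum : \sum_b mark_law b = 1.
Proof.
have := @expect_finite _ _ _ P _ (mark 0) (fun=> 1) (measurable_mark 0).
by rewrite expect_cst => ->; apply: eq_bigr => u _; rewrite mul1r.
Qed.

(** The marks are functions of the holding times, which are independent of each
    other and of the directions. *)
Lemma prob_cylinder_split n m (b : nat -> 'I_M.+1) (u : nat -> U) :
  prob P (cylinder mark direction n m b u) =
  \prod_(i < n) mark_law (b i) *
  prob P (\bigcap_(i in `I_m) (direction i @^-1` [set u i])).
Proof.
pose B i := [set x | grid_index M delta x = b i].
have mB i : measurable (B i) by exact: measurable_grid_index.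
have bE : \bigcap_(i in `I_n) (mark i @^-1` [set b i]) =
    \bigcap_(i in `I_n) (T i @^-1` B i).
  by apply: eq_bigcapr => i _; rewrite mark_fibre.
rewrite /cylinder bE setIC /prob.
rewrite (eta_s_indep (process_eta_path m u) (process_s_T n mB)).
have m1 : measurable (\bigcap_(i in `I_n) (T i @^-1` B i)).
  by apply: fin_bigcap_measurable => // i _; exact: measurable_T_preimage.
have m2 : measurable (\bigcap_(i in `I_m) (direction i @^-1` [set u i])).
  by apply: fin_bigcap_measurable => // i _; exact: measurable_direction.
rewrite (probE P m1) (probE P m2) -EFinM /= mulrC; congr (_ * _).
rewrite (prob_box T_indep T_ident n mB).
by apply: eq_bigr => i _; rewrite /mark_law mark_fibre.
Qed.

Lemma prob_cylinderS n (b : nat -> 'I_M.+1) (u : nat -> U) :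
  prob P (cylinder mark direction n.+1 n.+2 b u) =
  prob P (cylinder mark direction n n.+1 b u) *
    (mark_law (b n) * p_in (u n) (u n.+1)).
Proof. by rewrite !prob_cylinder_split big_ord_recr /= prob_pathS; ring. Qed.

End marks.

End direction_chain.

(** * Comparison of the walk with the grid walk *)

(** Cauchy's criterion: the limits of the approximations are not asked to
    converge themselves. *)
Lemma cvg_of_approximations (R : realType) (g : R -> R) :
  (forall e, 0 < e -> exists l : R, \forall t \near +oo, `|g t - l| <= e) ->
  exists l : R, g t @[t --> +oo] --> l.
Proof.
move=> h; suff : cvg (g t @[t --> +oo]) by move=> /cvg_ex[l]; exists l.
apply: cauchy_cvg; apply: cauchy_exP => e e0.
have [l hl] := h _ (divr_gt0 e0 (ltr0n R 2)); exists l.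
apply: filterS hl => t; rewrite -ball_normE /ball_ /= distrC => h1.
by rewrite (le_lt_trans h1)// ltr_pdivrMr// ltr_pMr// ltr1n.
Qed.

Section rescaled_walk.
Context {R : realType} {d : nat} {dO : measure_display}.
Context {Omega : measurableType dO}.
Variables (U : {fset 'rV[R]_d}) (P : probability Omega R).
Variables (s T : nat -> {RV P >-> R}) (eta : nat -> {RV P >-> borelV R d}).
Variable (p : 'rV[R]_d -> 'rV[R]_d -> R).
Hypotheses (U_unit : forall u, u \in U -> enorm u = 1)
  (s_0 : forall w, s 0%N w = 0)
  (s_incr : forall n w, s n w < s n.+1 w)
  (T_def : forall n w, T n w = s n.+1 w - s n w)
  (T_indep : mutually_independent T)
  (T_ident : identically_distributed T)
  (eta_chain : irreducible_stationary_markov_chain U p eta)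
  (eta_s_indep : independent_processes eta s).

Local Notation F := (tail T).
Local Notation walk := (drrw (fun n => s n) (fun n => eta n)).

(** The value 0 for [t <= 0] keeps the whole family in the unit ball, so that
    it has limit points in law. *)
Definition rescaled_walk (t : R) (w : Omega) : 'rV[R]_d :=
  if 0 < t then t^-1 *: walk t w else 0.

Lemma unit_le1 u : u \in U -> `|u| <= 1.
Proof.
move=> uU; apply: norm_le_coord => // i; rewrite -(U_unit uU) /enorm.
rewrite -(sqrtr_sqr (u ord0 i)) ler_wsqrtr//.
by rewrite (bigD1 i)//= lerDl sumr_ge0// => j _; exact: sqr_ge0.
Qed.

Lemma eta_le1 n w : `|eta n w| <= 1.
Proof. by apply: unit_le1; exact: (eta_in eta_chain). Qed.

Lemma rescaled_walk_le1 t w : `|rescaled_walk t w| <= 1.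
Proof.
rewrite /rescaled_walk; case: ifPn => [t0|_]; last by rewrite normr0.
rewrite normrZ ger0_norm ?invr_ge0 ?(ltW t0)// mulrC ler_pdivrMr// mul1r.
by apply: drrw_le => //; [exact: ltW|move=> n; exact: eta_le1].
Qed.

Lemma measurable_coord_eta n i : measurable_fun setT (fun w => eta n w ord0 i).
Proof.
apply: (@measurable_continuous_comp _ _ _ _ (fun y => y ord0 i) (eta n)).
  exact: coord_continuous.
exact: measurable_funP.
Qed.

Lemma measurable_rescaled_walk t i :
  measurable_fun setT (fun w => rescaled_walk t w ord0 i).
Proof.
have [t0|t0] := boolP (0 < t); last first.
  rewrite (_ : (fun w => _) = cst 0); first exact: measurable_cst.
  by apply/funext => w; rewrite /rescaled_walk (negbTE t0) mxE.
(* If the clock never exceeds [t], the renewal index is 0 and the rescaled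
   position is the first direction: this is the value given by [else] for all
   [n]. *)
pose h (n : nat) (w : Omega) : R := if t < s n w
  then t^-1 * \sum_(k < n) clip (fun n => s n) w t k * eta k w ord0 i
  else eta 0%N w ord0 i.
rewrite (_ : (fun w => _) = (fun w => (t^-1 *: walk t w) ord0 i)); last first.
  by apply/funext => w; rewrite /rescaled_walk t0.
apply: (@measurable_fun_cvg _ _ _ _ h) => [n|w _].
  apply: measurable_fun_ifT.
  - by apply: measurable_fun_ltr => //; exact: measurable_funP.
  - apply: measurable_funM => //; apply: measurable_sum => k.
    apply: measurable_funM; last exact: measurable_coord_eta.
    by apply: measurable_funB; apply: measurable_minr => //; exact: measurable_funP.
  - exact: measurable_coord_eta.
have sm := @clock_le _ _ (fun n => s n : _ -> _) w (s_incr ^~ w).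
have [[n tn]|/forallNP st] := pselect (exists n, t < s n w).
  apply: cvg_near_cst; exists n => // m /= nm.
  have tm : t < s m w := lt_le_trans tn (sm _ _ nm).
  rewrite /h tm (@drrw_clip _ _ _ _ _ w t _ _ _ m)//; last exact: ltW.
  rewrite mxE summxE; congr (_ * _); apply: eq_bigr => k _.
  by rewrite mxE.
apply: cvg_near_cst; apply: nearW => m.
rewrite /h ifF; last by apply/negbTE/negP/st.
rewrite /drrw renewal_index_unbounded => [|n]; last by rewrite leNgt; apply/negP/st.
by rewrite big_ord0 add0r s_0 subr0 scalerA mulVf ?gt_eqF// scale1r.
Qed.

Lemma bm_rescaled_walk (f : 'rV[R]_d -> R) t : continuous f ->
  (exists B, forall x, `|f x| <= B) ->
  bounded_measurable (fun w => f (rescaled_walk t w)).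
Proof.
move=> cf [B fB]; split; last by exists B => w; exact: fB.
apply: (@measurable_continuous_comp _ _ _ _ f (rescaled_walk t)) => //.
apply: measurable_coordinates; first exact: measurable_rescaled_walk.
exact: rescaled_walk_le1.
Qed.

Section one_grid.
Variables (M : nat) (t : R).
Hypotheses (M_gt0 : (0 < M)%N) (t_gt0 : 0 < t).

Local Notation delta := (t / M%:R).
Local Notation st := (state (mark T M delta) (direction eta_chain)
  (grid_step (val : U -> _)) (M, 0)).

Let delta_ge0 : 0 <= delta. Proof. by rewrite divr_ge0// ltW. Qed.
Let MR_gt0 : 0 < M%:R :> R. Proof. by rewrite ltr0n. Qed.
Let tE : t = M%:R * delta. Proof. by rewrite mulrC divfK// gt_eqF. Qed.

Let b w i := grid_index M delta (T i w).

Lemma state_grid n w :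
  st n w = (remaining (b w) M n, grid_position (fun n => eta n) w (b w) M n).
Proof.
elim: n => [//|n IH]; rewrite [LHS]/state /= -[state_of _ _ _ _ _]/(st n w) IH.
by rewrite /grid_step /= /mark inordK// ltnS grid_index_le.
Qed.

(** A holding time longer than [t] covers all [M] cells and leads to
    absorption. *)
Lemma active_all_below n w : (st n w).1 != 0%N -> all_below T t n w.
Proof.
rewrite state_grid /= => rem i /= ni; rewrite in_itv /= leNgt; apply/negP => tT.
move: rem; apply/negP; rewrite negbK.
have bM : b w i = M.
  apply/eqP; rewrite /b eqn_leq grid_index_le//= leq_grid_index//.
  by rewrite leqnn -tE tT orbT.
elim: n ni => [//|n IH] /=; rewrite ltnS leq_eqVlt => /orP[/eqP <-|/IH/eqP ->]; last by [].
rewrite bM subn_eq0; elim: (i : nat) => //= k kM; exact: leq_trans (leq_subr _ _) kM.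
Qed.

Let V i w : R := ((s i w < t)%R)%:R * Num.min (T i w) delta.

(** When the clock has passed [t], only the rounding errors remain; otherwise
    both positions are in the unit ball. *)
Lemma grid_dist_le n w : `|rescaled_walk t w - (st n w).2| <=
  2 * \1_([set w | s n w <= t]) w + t^-1 * 2 * \sum_(i < n) V i w.
Proof.
have V0 : 0 <= \sum_(i < n) V i w.
  rewrite sumr_ge0// => i _; rewrite mulr_ge0// le_min delta_ge0 andbT ltW//.
  exact: (T_gt0 s_incr T_def).
have el := fun n => eta_le1 n w.
have bl i : (b w i)%:R * delta <= s i.+1 w - s i w.
  by rewrite -T_def grid_index_lower// ltW// (T_gt0 s_incr T_def).
have bu i : (b w i < M)%N -> s i.+1 w - s i w <= (b w i).+1%:R * delta.
  by rewrite -T_def => ?; exact: grid_index_upper.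
rewrite state_grid /=; have [sA|/negP sA] := boolP (s n w <= t); last first.
  rewrite indicE memNset// mulr0 add0r /rescaled_walk t_gt0.
  rewrite (@drrw_clip _ _ _ _ _ w t _ _ _ n) ?(ltW t_gt0)//; last first.
    by rewrite ltNge; apply/negP.
  have := @grid_position_approx _ _ _ (fun n => s n) (fun n => eta n) w t
    (s_0 w) (s_incr^~ w) (ltW t_gt0) el (b w) M delta tE delta_ge0 bl bu n t_gt0.
  have -> : \sum_(i < n) ((s i w < t)%R)%:R * Num.min (s i.+1 w - s i w) delta =
      \sum_(i < n) V i w by apply: eq_bigr => i _; rewrite /V T_def.
  by rewrite -mulrA.
rewrite indicE mem_set// mulr1.
have := @grid_position_le _ _ _ (fun n => eta n) w el (b w) M n M_gt0.
have := rescaled_walk_le1 t w; have := ler_normB (rescaled_walk t w)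
   (grid_position (fun n => eta n) w (b w) M n).
have : 0 <= t^-1 * 2 * \sum_(i < n) V i w.
  by rewrite !mulr_ge0// invr_ge0 ltW.
lra.
Qed.

Lemma bm_grid (u0 : U) (f : 'rV[R]_d -> R) n :
  bounded_measurable (fun w => f (st n w).2).
Proof.
apply: (bm_state (grid_step (val : U -> _)) (M, 0) _ _ ord0 u0 n (fun x _ => f x.2)).
- by move=> m k; exact: measurable_mark.
- exact: (measurable_direction eta_chain).
Qed.

(** Each holding time that begins before
    time [t] contributes at most its truncation at one grid cell; it is
    independent of its starting time, and the expected number of such holding
    times is at most the inverse of the tail at [t]. *)
Lemma grid_compare (u0 : U) (f : 'rV[R]_d -> R) (eps C : R) n :
  continuous f -> (exists B, forall x, `|f x| <= B) -> 0 < F t -> 0 <= C ->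
  (forall x y, `|x| <= 1 -> `|f x - f y| <= eps + C * `|x - y|) ->
  `|expect P (fun w => f (rescaled_walk t w)) - expect P (fun w => f (st n w).2)|
  <= eps + C * (2 * (1 - F t) ^+ n + 2 * truncated_mean T delta / (t * F t)).
Proof.
move=> cf bf F0 C0 fC; have delta_gt0 : 0 < delta by rewrite divr_gt0.
pose A := [set w | s n w <= t].
have mA : measurable A by exact: measurable_s_le.
have bV i : bounded_measurable (V i).
  have -> : V i = (fun w => \1_([set w | s i w < t]) w * Num.min (T i w) delta).
    by apply/funext => w; rewrite indicE in_set_bool.
  exact: bmM (bm_indic (measurable_s_lt s i t)) (bm_truncated s_incr T_def i delta_ge0).
have bsum : bounded_measurable (fun w => \sum_(i < n) V i w) by exact: bm_sum.
have b1 : bounded_measurable (fun w => 2 * \1_A w : R).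
  exact: bmM (bm_cst 2) (bm_indic mA).
have b2 : bounded_measurable (fun w => t^-1 * 2 * \sum_(i < n) V i w).
  by apply: bmM => //; exact: bm_cst.
have b3 := bmD b1 b2.
have b4 : bounded_measurable (fun w => C * (2 * \1_A w + t^-1 * 2 * \sum_(i < n) V i w)).
  by apply: bmM => //; exact: bm_cst.
have bY := bm_rescaled_walk t cf bf.
have bG := bm_grid u0 f n.
rewrite -expectB// (le_trans (expect_norm P (bmB bY bG)))//.
apply: (@le_trans _ _ (expect P (fun w =>
    eps + C * (2 * \1_A w + t^-1 * 2 * \sum_(i < n) V i w)))).
  apply: expect_le => [||w]; first exact/bm_norm/bmB.
    by apply: bmD => //; exact: bm_cst.
  apply: le_trans (fC _ _ (rescaled_walk_le1 _ _)) _.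
  by rewrite lerD2l ler_wpM2l// grid_dist_le.
rewrite expectD//; last exact: bm_cst.
rewrite expect_cst lerD2l expectZ// ler_wpM2l// expectD// expectZ; last exact: bm_indic.
rewrite expect_indic// lerD//.
  by rewrite ler_wpM2l//; exact: prob_s_le.
rewrite expectZ// expect_sum//.
have gm0 : 0 <= truncated_mean T delta.
  by apply: expect_ge0 => w; rewrite le_min delta_ge0 andbT ltW// (T_gt0 s_incr T_def).
have : \sum_(i < n) expect P (V i) <= (F t)^-1 * truncated_mean T delta.
  apply: le_trans (_ : \sum_(i < n) (1 - F t) ^+ i * truncated_mean T delta <= _).
    by apply: ler_sum => i _; exact: expect_min_before.
  by rewrite -mulr_suml ler_wpM2r//; exact: sum_survival_le.
have -> : 2 * truncated_mean T delta / (t * F t) =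
    t^-1 * 2 * ((F t)^-1 * truncated_mean T delta) by rewrite invfM; ring.
by move=> h; rewrite ler_wpM2l// mulr_ge0// invr_ge0 ltW.
Qed.

Lemma measurable_active (u0 : U) n : measurable [set w | (st n w).1 != 0%N].
Proof.
apply: measurable_nonabsorbed u0 _ _ _; last exact: (measurable_direction eta_chain).
by move=> m k; exact: measurable_mark.
Qed.

Lemma prob_active_le (u0 : U) n :
  prob P [set w | (st n w).1 != 0%N] <= (1 - F t) ^+ n.
Proof.
rewrite -(prob_all_below T_indep T_ident); apply: prob_le.
- exact: measurable_active.
- exact: measurable_all_below.
- by move=> w; exact: active_all_below.
Qed.

End one_grid.
End rescaled_walk.

(** * Convergence of the means *)

Section convergence_of_means.
Context {R : realType} {d : nat} {dO : measure_display}.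
Context {Omega : measurableType dO}.
Variables (U : {fset 'rV[R]_d}) (P : probability Omega R).
Variables (s T : nat -> {RV P >-> R}) (eta : nat -> {RV P >-> borelV R d}).
Variables (p : 'rV[R]_d -> 'rV[R]_d -> R) (h : R -> R) (a c : R) (u0 : U).
Hypotheses (U_unit : forall u, u \in U -> enorm u = 1)
  (s_0 : forall w, s 0%N w = 0)
  (s_incr : forall n w, s n w < s n.+1 w)
  (T_def : forall n w, T n w = s n.+1 w - s n w)
  (T_indep : mutually_independent T)
  (T_ident : identically_distributed T)
  (eta_chain : irreducible_stationary_markov_chain U p eta)
  (eta_s_indep : independent_processes eta s)
  (a_lt1 : a < 1) (c_gt0 : 0 < c)
  (h_rv : regularly_varying h a)
  (hF : h t * tail T t @[t --> +oo] --> c).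

Local Notation F := (tail T).

Let F_ge0 x : 0 <= F x. Proof. by case/andP: (tail01 T x). Qed.
Let F_le x y (xy : x <= y) : F y <= F x. Proof. exact: tail_le. Qed.
Let F_gt0 x : 0 < F x. Proof. exact: (tail_gt0 c_gt0 hF F_ge0 F_le). Qed.
Let F_ratio (l : R) (l_gt0 : 0 < l) :
  F (l * t) / F t @[t --> +oo] --> l `^ (- a).
Proof. exact: (tail_ratio c_gt0 h_rv hF F_ge0 F_le l_gt0). Qed.

Lemma truncated_mean_karamata : exists K x0, [/\ 0 < K, 0 < x0 &
  forall x, x0 <= x -> truncated_mean T x <= K * x * F x].
Proof.
apply: (karamata_bound a_lt1 c_gt0 h_rv hF F_ge0 F_le).
- by move=> x; exact: (truncated_mean_le s_incr T_def).
- by move=> x; exact: (truncated_mean_half s_incr T_def).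
Qed.

Section grid_of_size_M.
Variable M : nat.
Hypothesis M_gt0 : (0 < M)%N.

Let MR_gt0 : 0 < M%:R :> R. Proof. by rewrite ltr0n. Qed.

Local Notation q t := (mark_law (M := M) T (t / M%:R)).

(** The limiting law of the number of grid cells covered by a holding time that
    covers at least one; the last weight collects all holding times above [t]. *)
Definition pareto_weight (b : 'I_M.+1) : R :=
  if b == ord0 then 0 else
  b%:R `^ (- a) - (if (b < M)%N then b.+1%:R `^ (- a) else 0).

Lemma prob_mark_ge (t : R) k : 0 < t -> (0 < k <= M)%N ->
  prob P [set w | (k <= mark T M (t / M%:R) 0 w)%N] = F (k%:R * (t / M%:R)).
Proof.
move=> t0 /andP[k0 kM]; have d0 : 0 <= t / M%:R by rewrite divr_ge0// ltW.
rewrite /tail; congr (prob P _); apply: eq_set => w.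
rewrite /mark inordK ?ltnS ?grid_index_le// leq_grid_index// kM /=.
by rewrite eqn0Ngt k0.
Qed.

Lemma measurable_mark_ge (t : R) k : 0 < t ->
  measurable [set w | (k <= mark T M (t / M%:R) 0 w)%N].
Proof.
move=> t0; have d0 : 0 <= t / M%:R by rewrite divr_ge0// ltW.
have mm : measurable_fun setT (fun w => (mark T M (t / M%:R) 0 w : nat)).
  apply: (measurable_finite_nat (fun i : 'I_M.+1 => (i : nat))) => i.
  exact: measurable_mark.
exact: (measurable_fibre_nat [set j | (k <= j)%N] mm).
Qed.

Lemma mark_lawE (t : R) b : 0 < t -> b != ord0 ->
  q t b = F (b%:R * (t / M%:R)) -
    (if (b < M)%N then F (b.+1%:R * (t / M%:R)) else 0).
Proof.
move=> t0 b0; have d0 : 0 <= t / M%:R by rewrite divr_ge0// ltW.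
have b_gt0 : (0 < b)%N by rewrite lt0n.
have bM1 : (0 < b <= M)%N by rewrite b_gt0 leq_ord.
rewrite -(prob_mark_ge t0 bM1).
have -> : (if (b < M)%N then F (b.+1%:R * (t / M%:R)) else 0) =
    prob P [set w | (b.+1 <= mark T M (t / M%:R) 0 w)%N].
  case: ifPn => bM; first by rewrite prob_mark_ge.
  rewrite /prob (_ : [set w | _] = set0) ?measure0//; apply/seteqP; split => // w /=.
  by rewrite ltnNge; apply/negP; rewrite negbK (leq_trans (leq_ord _))// leqNgt.
have m1 := measurable_mark_ge b t0; have m2 := measurable_mark_ge b.+1 t0.
have m3 := measurable_mark T d0 0 b.
apply/esym/eqP; rewrite subr_eq /mark_law -!expect_indic// -expectD; [|exact: bm_indic..].
apply/eqP/eq_expect => w; rewrite !indicE -natrD; congr (_%:R).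
rewrite !in_set_bool.
have -> : (w \in mark T M (t / M%:R) 0 @^-1` [set b]) = (mark T M (t / M%:R) 0 w == b :> nat).
  by apply/idP/idP => [|/eqP e]; rewrite inE; [move=> /= ->|exact/val_inj].
by case: ltngtP.
Qed.

Lemma jump_rateE (t : R) : 0 < t -> jump_rate (q t) = F (t / M%:R).
Proof.
move=> t0; have d0 : 0 <= t / M%:R by rewrite divr_ge0// ltW.
have := mark_law_sum T M d0; rewrite (bigD1 ord0)//= => /esym/eqP.
rewrite addrC -subr_eq /jump_rate => /eqP <-.
have -> : F (t / M%:R) = prob P [set w | (1 <= mark T M (t / M%:R) 0 w)%N].
  by rewrite prob_mark_ge ?mul1r.
have m3 := measurable_mark T d0 0 (ord0 : 'I_M.+1).
rewrite /mark_law -prob_setC//; congr (prob P _).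
apply/seteqP; split => w /=.
  by move=> h0; rewrite lt0n; apply/eqP => h1; apply: h0; exact/val_inj.
by move=> + h0; rewrite h0.
Qed.

Lemma cvg_scaled_tail k : (0 < k)%N ->
  F (k%:R * (t / M%:R)) / F (t / M%:R) @[t --> +oo] --> k%:R `^ (- a).
Proof.
move=> k0; have k0' : 0 < k%:R :> R by rewrite ltr0n.
have Mi : 0 < M%:R^-1 :> R by rewrite invr_gt0.
have := @cvg_comp _ _ _ (fun t : R => M%:R^-1 * t)
  (fun t => F (k%:R * t) / F t) _ _ _ (cvg_scale_pinfty Mi) (F_ratio k0').
by apply: cvg_trans; apply: near_eq_cvg; apply: nearW => t /=; rewrite [t / _]mulrC.
Qed.

(** A mark [b < M] is a difference of two tail events, whose probabilities
    relative to the jump rate converge by regular variation. *)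
Lemma cvg_pareto_weight b : b != ord0 ->
  q t b / jump_rate (q t) @[t --> +oo] --> pareto_weight b.
Proof.
move=> b0; have b_gt0 : (0 < b)%N by rewrite lt0n.
have h1 : F (b%:R * (t / M%:R)) / F (t / M%:R) -
    (if (b < M)%N then F (b.+1%:R * (t / M%:R)) / F (t / M%:R) else 0)
    @[t --> +oo] --> pareto_weight b.
  rewrite /pareto_weight (negbTE b0); apply: cvgB; first exact: cvg_scaled_tail.
  by case: ifP => _; [exact: cvg_scaled_tail|exact: cvg_cst].
apply: cvg_trans h1; apply: near_eq_cvg; near=> t.
have t0 : 0 < t by near: t; exact: nbhs_pinfty_gt.
by rewrite jump_rateE// mark_lawE// mulrBl; case: ifP => _ //; rewrite mul0r.
Unshelve. all: by end_near. Qed.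

Lemma pareto_weight_ge0 b : 0 <= pareto_weight b.
Proof.
have [->|b0] := eqVneq b ord0; first by rewrite /pareto_weight eqxx.
apply: (cvgr_to_ge (cvg_pareto_weight b0)); apply: nearW => t.
by rewrite divr_ge0 ?prob_ge0// sumr_ge0// => i _; exact: prob_ge0.
Qed.

Lemma pareto_weight_sum : \sum_(b | b != ord0) pareto_weight b = 1.
Proof.
have h1 : \sum_(b | b != ord0) (q t b / jump_rate (q t)) @[t --> +oo] -->
    \sum_(b | b != ord0) pareto_weight b.
  rewrite big_mkcond; under eq_fun do rewrite big_mkcond.
  apply: cvg_sum_seq => b; case: ifPn => b0; last exact: cvg_cst.
  exact: cvg_pareto_weight.
have h2 : \sum_(b | b != ord0) (q t b / jump_rate (q t)) @[t --> +oo] --> (1 : R).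
  apply: cvg_near_cst; near=> t.
  have t0 : 0 < t by near: t; exact: nbhs_pinfty_gt.
  by rewrite -mulr_suml -/(jump_rate (q t)) jump_rateE// divff// gt_eqF.
by rewrite -(cvg_lim _ h1)// (cvg_lim _ h2).
Unshelve. all: by end_near. Qed.

Variables (f : 'rV[R]_d -> R) (eps C B K x0 : R).
Hypotheses (cf : continuous f) (fB : forall x, `|f x| <= B) (C_ge0 : 0 <= C)
  (fC : forall x y, `|x| <= 1 -> `|f x - f y| <= eps + C * `|x - y|).
Hypotheses (x0_gt0 : 0 < x0)
  (karamata : forall x, x0 <= x -> truncated_mean T x <= K * x * F x).

Definition grid_limit : R :=
  limit_value (val : U -> _) (stationary_law eta_chain) pareto_weight f M (M, 0).

Let mB : 0 <= B. Proof. exact: le_trans (normr_ge0 _) (fB 0). Qed.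

(** Only the rounding error, of order [M ^ (a - 1)], survives as [t] grows: the
    errors of the averaging, which sum over the [O (1 / F t)] steps before the
    horizon, vanish because [F (t / M) / F t] converges. *)
Lemma expect_near_grid_limit : exists E : R -> R,
  E t @[t --> +oo] --> eps + 2 * C * K * (M%:R^-1 * M%:R^-1 `^ (- a)) /\
  \forall t \near +oo,
    `|expect P (fun w => f (rescaled_walk s eta t w)) - grid_limit| <= E t.
Proof.
have bf : exists B, forall x, `|f x| <= B by exists B.
have [Q poissonQ] := poisson_equation (stationary_law_inv eta_chain)
  (ex_intro _ u0 (lt0r_neq0 (stationary_law_gt0 eta_chain u0))) (harmonic_cst eta_chain).
pose k (t : R) := F (M%:R^-1 * t) / F t.
have ck : k t @[t --> +oo] --> M%:R^-1 `^ (- a) by apply: F_ratio; rewrite invr_gt0.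
pose cb := corrector_bound Q B.
pose D (t : R) := \sum_(b | b != ord0)
  `|q t b / jump_rate (q t) - pareto_weight b|.
have cD : D t @[t --> +oo] --> (0 : R).
  have DE t : D t = \sum_b (if b != ord0
      then `|q t b / jump_rate (q t) - pareto_weight b| else 0).
    by rewrite /D big_mkcond.
  under eq_fun do rewrite DE.
  have h0 : \sum_(b : 'I_M.+1) (0 : R) = 0 by rewrite big1.
  rewrite -[X in nbhs X]h0.
  apply: cvg_sum_seq => b; have [b0|b0] := boolP (b != ord0); last exact: cvg_cst.
  have h1 := cvg_norm (cvgB (cvg_pareto_weight b0) (cvg_cst (pareto_weight b))).
  by rewrite subrr normr0 in h1; exact: h1.
have cF : F (M%:R^-1 * t) @[t --> +oo] --> (0 : R).
  have Mi : 0 < M%:R^-1 :> R by rewrite invr_gt0.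
  exact: (@cvg_comp _ _ _ (fun t : R => M%:R^-1 * t) F _ _ _ (cvg_scale_pinfty Mi) (@cvg_tail0 _ _ _ _ T)).
(* In this order: the modulus of [f], the rounding error by Karamata's bound,
   the corrector at both ends, and the generator bound times [1 / F t]. *)
pose E (t : R) := eps + 2 * C * K * (M%:R^-1 * k t) + 2 * cb * F (M%:R^-1 * t) +
  (2 * B * D t + 2 * cb * F (M%:R^-1 * t)) * k t.
exists E; split.
  have -> : eps + 2 * C * K * (M%:R^-1 * M%:R^-1 `^ (- a)) =
    eps + 2 * C * K * (M%:R^-1 * M%:R^-1 `^ (- a)) +
    2 * cb * 0 + (2 * B * 0 + 2 * cb * 0) * M%:R^-1 `^ (- a).
    by rewrite !mulr0 !addr0 mul0r addr0.
  have m0 := fun (x : R) => @cvg_cst _ x _ (pinfty_nbhs R) _.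
  apply: cvgD; last first.
    by apply: cvgM => //; apply: cvgD; apply: cvgM => //; exact: m0.
  apply: cvgD; last by apply: cvgM => //; exact: m0.
  apply: cvgD; first exact: m0.
  by apply: cvgM; [exact: m0|apply: cvgM => //; exact: m0].
near=> t.
have t0 : 0 < t by near: t; exact: nbhs_pinfty_gt.
have tM : x0 <= t / M%:R.
  by rewrite ler_pdivlMr//; near: t; exact: nbhs_pinfty_ge.
have d_ge0 : 0 <= t / M%:R by rewrite divr_ge0// ltW.
have dE : M%:R^-1 * t = t / M%:R by rewrite mulrC.
have rt : jump_rate (q t) = F (t / M%:R) by exact: jump_rateE.
have mean n := grid_walk_mean (val : U -> _) (p_in_ge0 eta_chain) (p_in_sum eta_chain)
  (stationary_law_ge0 eta_chain) (stationary_law_sum eta_chain) pareto_weight_ge0 pareto_weight_sum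
  (mark_law_ge0 T (t / M%:R)) (mark_law_sum T M d_ge0) poissonQ fB u0
  (measurable_mark T d_ge0) (measurable_direction eta_chain)
  (prob_cylinderS T_def T_indep T_ident eta_chain eta_s_indep d_ge0) n.
have comp n := grid_compare U_unit s_0 s_incr T_def T_indep T_ident eta_chain
  M_gt0 t0 u0 n cf bf (F_gt0 t) C_ge0 fC.
have Fi : 0 < (F t)^-1 by rewrite invr_gt0.
have gb : generator_bound pareto_weight (q t) Q B / F t =
    (2 * B * D t + 2 * cb * F (M%:R^-1 * t)) * k t.
  have Fn : F (t / M%:R) != 0 by rewrite gt_eqF.
  rewrite /generator_bound rt /k dE -/cb.
  have -> : \sum_(b | b != ord0) `|q t b - F (t / M%:R) * pareto_weight b| =
      F (t / M%:R) * D t.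
    rewrite /D rt mulr_sumr; apply: eq_bigr => b _.
    rewrite -[X in X * `|_|](gtr0_norm (F_gt0 _)) -normrM mulrBr.
    by congr (`|_ - _|); rewrite [RHS]mulrC divfK.
  by field; rewrite gt_eqF.
have tr : 2 * truncated_mean T (t / M%:R) / (t * F t) <= 2 * K * (M%:R^-1 * k t).
  have := karamata tM => kt.
  have -> : 2 * K * (M%:R^-1 * k t) = 2 * (K * (t / M%:R) * F (t / M%:R)) / (t * F t).
    by rewrite /k dE; field; rewrite !gt_eqF.
  by rewrite ler_wpM2r ?invr_ge0 ?mulr_ge0 ?(ltW t0)// ler_wpM2l.
have CB : 0 < 2 * C + 2 * B + 1 by rewrite ltr_wpDl ?addr_ge0 ?mulr_ge0.
apply/ler_addgt0Pr => e e0.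
(* For fixed [t] the number of steps goes to infinity: the clock then passes [t]
   and the grid walk is absorbed, up to a probability that vanishes. *)
have [n ne] : exists n, (2 * C + 2 * B) * (1 - F t) ^+ n <= e.
  have c0 : (1 - F t) ^+ n @[n --> \oo] --> (0 : R).
    apply: cvg_expr; rewrite ger0_norm ?subr_ge0; last by case/andP: (tail01 T t).
    by rewrite gtrBl.
  have [N _ /(_ N (leqnn N)) /= eN] := cvgr_lt 0 c0 _ (divr_gt0 e0 CB).
  exists N; have r0 : 0 <= (1 - F t) ^+ N.
    by rewrite exprn_ge0// subr_ge0; case/andP: (tail01 T t).
  have : (1 - F t) ^+ N * (2 * C + 2 * B + 1) <= e by rewrite -ler_pdivlMr// ltW.
  rewrite mulrDr mulr1; lra.
have := mean n; have := comp n.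
set st := state _ _ _ _; rewrite -/grid_limit.
set X := expect P _; set Z := expect P _ => hXZ hZ.
have act i := prob_active_le T_indep T_ident eta_chain M_gt0 t0 u0 i.
have gb0 : 0 <= generator_bound pareto_weight (q t) Q B.
  exact: (generator_bound_ge0 _ _ (mark_law_ge0 T _) fB).
have sumact : \sum_(i < n) prob P [set w | (st i w).1 != 0%N] <= (F t)^-1.
  by rewrite (le_trans _ (sum_survival_le n (F_gt0 t)))// ler_sum.
have b3 := ler_wpM2l gb0 sumact; rewrite gb in b3.
have b1 := ler_wpM2l (mulr_ge0 (ler0n R 2) mB) (act n).
have b2 := ler_wpM2l C_ge0 tr.
have FE : F (M%:R^-1 * t) = F (t / M%:R) by rewrite dE.
rewrite rt -/cb -FE in hZ.
have := ler_normD (X - Z) (Z - grid_limit).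
rewrite addrA subrK /E; move: hXZ hZ b1 b2 b3 ne.
move: (generator_bound _ _ _ _) (\sum_(i < n) _) (truncated_mean _ _) (prob P _) => G S1 tm pr.
move: (k t) (D t) (F (M%:R^-1 * t)) ((1 - F t) ^+ n) => kt Dt Fm r.
move: `|X - grid_limit| `|X - Z| `|Z - grid_limit| => N1 N2 N3.
lra.
Unshelve. all: by end_near. Qed.

End grid_of_size_M.

(** The rounding error is made small by a fine grid, as [a < 1]. *)
Lemma cvg_expect_rescaled_walk (f : 'rV[R]_d -> R) : continuous f ->
  (exists B, forall x, `|f x| <= B) ->
  exists l : R, expect P (fun w => f (rescaled_walk s eta t w)) @[t --> +oo] --> l.
Proof.
move=> cf bf; apply: cvg_of_approximations => e e0; have [B fB] := bf.
have [C C0 fC] := continuous_affine_modulus cf bf (divr_gt0 e0 (ltr0n R 2)).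
have [K [x0 [K0 x00 kar]]] := truncated_mean_karamata.
have CK : 0 < 2 * C * K + 1 by rewrite ltr_wpDl// !mulr_ge0// ltW.
have a1 : 0 < 1 - a by rewrite subr_gt0.
have [r /= r0 rP] := cvgr_lt 0 (powR_cvg0 a1) _ (divr_gt0 (divr_gt0 e0 (ltr0n R 4)) CK).
have [n nr] := precision_small r0.
have n0 := precision_gt0 (R := R) n.
have nP : precision n * precision n `^ (- a) < e / 4 / (2 * C * K + 1).
  have := rP (precision n); rewrite /ball_ /= sub0r normrN gtr0_norm// => /(_ nr n0).
  by rewrite powRD ?powRr1 ?(ltW n0)// gt_eqF// implybT.
have [E [cE hE]] := expect_near_grid_limit (ltn0Sn n) cf fB C0 fC kar.
exists (grid_limit n.+1 f).
have Ee : e / 2 + 2 * C * K * (precision n * precision n `^ (- a)) < e.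
  have p0 : 0 <= precision n * precision n `^ (- a) by rewrite mulr_ge0 ?powR_ge0// ltW.
  move: nP; rewrite ltr_pdivlMr// mulrDr mulr1 [X in X + _]mulrC; lra.
near=> t; apply: le_trans (_ : E t <= e); first by near: t.
by near: t; apply: (cvgr_le _ cE).
Unshelve. all: by end_near. Qed.

End convergence_of_means.

(** * A long last step in a given direction *)

Definition tent (R : realType) (d : nat) (u : 'rV[R]_d) (rho : R) (y : 'rV[R]_d) : R :=
  Num.max 0 (1 - `|y - u| / rho).

Lemma tent_continuous_bounded (R : realType) (d : nat) (u : 'rV[R]_d) (rho : R) :
  0 < rho -> continuous (tent u rho) /\ exists B, forall y, `|tent u rho y| <= B.
Proof.
move=> rho0; split.
  have -> : tent u rho = ((fun=> 0) : 'rV[R]_d -> R^o) \max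
      (fun y => 1 - `|y - u| / rho) by [].
  move=> y; apply: continuous_max; first exact: cst_continuous.
  apply: continuousB; first exact: cst_continuous.
  apply: continuousM; last exact: cst_continuous.
  apply: continuous_comp; last exact: norm_continuous.
  by apply: continuousB; [exact: cvg_id|exact: cst_continuous].
exists 1 => y; rewrite ger0_norm ?le_max ?lexx// ge_max ler01 gerBl.
by rewrite divr_ge0// ltW.
Qed.

Section long_last_step.
Context {R : realType} {d : nat} {dO : measure_display}.
Context {Omega : measurableType dO}.
Variables (U : {fset 'rV[R]_d}) (P : probability Omega R).
Variables (s T : nat -> {RV P >-> R}) (eta : nat -> {RV P >-> borelV R d}).
Variables (p : 'rV[R]_d -> 'rV[R]_d -> R) (h : R -> R) (a c : R) (u : U).
Hypotheses (U_unit : forall u, u \in U -> enorm u = 1)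
  (s_0 : forall w, s 0%N w = 0)
  (s_incr : forall n w, s n w < s n.+1 w)
  (T_def : forall n w, T n w = s n.+1 w - s n w)
  (T_indep : mutually_independent T)
  (T_ident : identically_distributed T)
  (eta_chain : irreducible_stationary_markov_chain U p eta)
  (eta_s_indep : independent_processes eta s)
  (a_lt1 : a < 1) (c_gt0 : 0 < c)
  (h_rv : regularly_varying h a)
  (hF : h t * tail T t @[t --> +oo] --> c).

Local Notation F := (tail T).

Definition early_long_step (x t : R) (n : nat) : set Omega :=
  [set w | s n w <= x] `&` [set w | t < T n w].

Definition last_step_in (x t : R) (n : nat) : set Omega :=
  direction eta_chain n @^-1` [set u] `&` early_long_step x t n.

Lemma measurable_early_long_step x t n : measurable (early_long_step x t n).
Proof. by apply: measurableI; [exact: measurable_s_le|exact: measurable_T_gt]. Qed.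

Lemma measurable_last_step_in x t n : measurable (last_step_in x t n).
Proof.
by apply: measurableI; [exact: measurable_direction|exact: measurable_early_long_step].
Qed.

(** The direction is independent of the clock, and stationary. *)
Lemma prob_last_step_in x t n : prob P (last_step_in x t n) =
  stationary_law eta_chain u * prob P (early_long_step x t n).
Proof.
have mD := measurable_direction eta_chain n u.
have mE := measurable_early_long_step x t n.
rewrite -(prob_direction eta_chain n u) /prob eta_s_indep.
- by rewrite (probE P mD) (probE P mE).
- suff : measurable (direction eta_chain n @^-1` [set u] :
    set (g_sigma_algebraType (\bigcup_n g_sigma_algebra_preimage (eta n)))) by [].
  rewrite direction_fibre; apply: sub_sigma_algebra; exists n => //.
  by exists [set val u]; [exact: measurable_set1_borelV|rewrite setTI].
- suff : measurable (early_long_step x t n :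
    set (g_sigma_algebraType (\bigcup_n g_sigma_algebra_preimage (s n)))) by [].
  set G := \bigcup_n _.
  have ms k : measurable_fun setT (s k : g_sigma_algebraType G -> R).
    move=> _ C mC; rewrite setTI; apply: sub_sigma_algebra; exists k => //.
    by exists C => //; rewrite setTI.
  apply: measurableI.
    by rewrite -[X in measurable X]setTI; apply: measurable_fun_le => //; exact: measurable_cst.
  have mTn : measurable_fun setT
      ((fun w => s n.+1 w - s n w) : g_sigma_algebraType G -> R).
    exact: measurable_funB.
  have -> : [set w | t < T n w] = (fun w => s n.+1 w - s n w) @^-1` `]t, +oo[%classic.
    by apply/seteqP; split => w /=; rewrite in_itv /= andbT T_def.
  by rewrite -[X in measurable X]setTI; exact: mTn.
Qed.

Lemma prob_long_indep t n j (B : set R) : measurable B -> (j < n)%N ->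
  prob P ([set w | t < T n w] `&` T j @^-1` B) =
  prob P [set w | t < T n w] * prob P (T 0%N @^-1` B).
Proof.
move=> mB jn.
pose B' i : set R := if i == j then B else if i == n then `]t, +oo[%classic else setT.
have mB' i : measurable (B' i) by rewrite /B'; case: ifP => // _; case: ifP.
have nj : n == j = false by rewrite gtn_eqF.
have -> : [set w | t < T n w] `&` T j @^-1` B =
    \bigcap_(i in `I_n.+1) (T i @^-1` B' i).
  apply/seteqP; split => [w [tT wB] i _ /=|w wB].
    rewrite /B'; case: eqP => [->//|_]; case: eqP => // ->.
    by rewrite /= in_itv /= andbT.
  split => /=; last by have := wB j (ltnW jn : (j < n.+1)%N); rewrite /B' /= eqxx.
  by have := wB n (ltnSn n); rewrite /B' /= nj eqxx /= in_itv /= andbT.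
have -> : prob P [set w | t < T n w] = prob P (T 0%N @^-1` `]t, +oo[).
  rewrite -(prob_T T_ident n); last exact: measurable_itv.
  by congr (prob P _); apply/seteqP; split => w /=; rewrite in_itv /= andbT.
rewrite (prob_box T_indep T_ident n.+1 mB') (bigD1 (ord_max : 'I_n.+1))//=.
rewrite (bigD1 (Ordinal (ltnW jn : (j < n.+1)%N)))/=; last by rewrite -val_eqE /= ltn_eqF.
rewrite {1}/B' nj eqxx {1}/B' eqxx big1 ?mulr1// => i /andP[in_ ij].
rewrite /B' ifF; last by apply/negbTE; move: ij; rewrite -val_eqE.
rewrite ifF; last by apply/negbTE; move: in_; rewrite -val_eqE.
by rewrite preimage_setT /prob probability_setT.
Qed.

Lemma prob_T_gt t n : prob P [set w | t < T n w] = F t.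
Proof.
have := prob_T T_ident n (measurable_itv `]t, +oo[).
rewrite /tail => e.
have E k : [set w | t < T k w] = T k @^-1` `]t, +oo[%classic.
  by apply/seteqP; split => w /=; rewrite in_itv /= andbT.
by rewrite !E.
Qed.

Lemma sum_min_ge (x : R) n w : 0 < x -> x < s n w ->
  x <= \sum_(j < n) Num.min (T j w) x.
Proof.
move=> x0 xs; suff : Num.min (s n w) x <= \sum_(j < n) Num.min (T j w) x.
  by rewrite min_r// ltW.
elim: n {xs} => [|n IH]; first by rewrite big_ord0 s_0 ge_min lexx.
rewrite big_ord_recr /= (le_trans _ (lerD IH (lexx _)))//.
have sE : s n.+1 w = s n w + T n w by rewrite T_def addrC subrK.
have Tn := T_gt0 s_incr T_def n w.
have sn : 0 <= s n w.
  by rewrite -(s_0 w); exact: (@clock_le _ _ (fun n => s n : _ -> _) w (s_incr ^~ w)).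
rewrite sE !minEle; case: ifP; case: ifP; case: ifP; lra.
Qed.

(** Markov's inequality for the sum of the previous holding times truncated at
    [x], which is at least [x] when the clock is; the long step is independent
    of them. *)
Lemma prob_early_long_step_ge (x t : R) n : 0 < x ->
  F t * (1 - n%:R * (truncated_mean T x / x)) <= prob P (early_long_step x t n).
Proof.
move=> x0; pose A := [set w | t < T n w].
have mA : measurable A by exact: measurable_T_gt.
have bA : bounded_measurable (\1_A : Omega -> R) := bm_indic mA.
have bT j : bounded_measurable (fun w => \1_A w * Num.min (T j w) x : R).
  exact: bmM bA (bm_truncated s_incr T_def j (ltW x0)).
have mE := measurable_early_long_step x t n.
pose V j w : R := \1_A w * Num.min (T j w) x.
have bS : bounded_measurable (fun w => x^-1 * \sum_(j < n) V j w).
  by apply: bmM; [exact: bm_cst|apply: bm_sum => j; exact: bT].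
have h1 : expect P \1_A <= expect P (fun w => \1_(early_long_step x t n) w +
    x^-1 * \sum_(j < n) V j w).
  apply: expect_le => //; first by apply: bmD => //; exact: bm_indic.
  move=> w; rewrite /V -mulr_sumr.
  have min0 j : 0 <= Num.min (T j w) x.
    by rewrite le_min (ltW x0) (ltW (T_gt0 s_incr T_def _ _)).
  have i0 : 0 <= x^-1 * (\1_A w * \sum_(j < n) Num.min (T j w) x).
    by rewrite mulr_ge0 ?invr_ge0 ?(ltW x0)// mulr_ge0// sumr_ge0.
  have [sx|xs] := leP (s n w) x.
    have -> : \1_(early_long_step x t n) w = \1_A w :> R.
      by rewrite !indicE in_setI (mem_set (sx : [set v | s n v <= x] w)).
    by rewrite lerDl.
  rewrite (@le_trans _ _ (x^-1 * (\1_A w * \sum_(j < n) Num.min (T j w) x)))//.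
    rewrite mulrCA ler_peMr//.
    by rewrite ler_pdivlMl// mulr1 sum_min_ge.
  by rewrite lerDr.
have bE : bounded_measurable (\1_(early_long_step x t n) : Omega -> R).
  exact: bm_indic.
rewrite (expect_indic _ mA) prob_T_gt (expectD _ bE bS) (expect_indic _ mE) in h1.
have e1 : expect P (fun w => x^-1 * \sum_(j < n) V j w) =
    x^-1 * \sum_(j < n) expect P (V j).
  rewrite expectZ; last by apply: bm_sum => j; exact: bT.
  by rewrite expect_sum// => j; exact: bT.
rewrite e1 in h1.
have e j : (j < n)%N -> expect P (V j) =
    F t * truncated_mean T x.
  move=> jn; rewrite -(prob_T_gt t n).
  exact: (expect_indep_minT s_incr T_def mA x0 (fun B mB => prob_long_indep t mB jn)).
rewrite (eq_bigr (fun=> F t * truncated_mean T x)) in h1; last by move=> j _; exact: e.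
rewrite sumr_const card_ord -mulr_natl in h1.
have -> : F t * (1 - n%:R * (truncated_mean T x / x)) =
  F t - x^-1 * (n%:R * (F t * truncated_mean T x)) by ring.
by rewrite lerBlDr.
Qed.

(** The later step would begin after the long one has ended. *)
Lemma last_step_in_disjoint (x t : R) m n w : x <= t -> (m < n)%N ->
  last_step_in x t m w -> ~ last_step_in x t n w.
Proof.
move=> xt mn [_ [_ /= tT]] [_ [/= sx _]].
have sm := @clock_le _ _ (fun n => s n : _ -> _) w (s_incr ^~ w).
have := sm _ _ mn; have := sm _ _ (leq0n m); rewrite s_0.
have := T_def m w; lra.
Qed.

(** Before its last step the walk stays within [x] of the origin, and the last
    step is shorter than [t] by at most [x]. *)
Lemma last_step_in_near (x t : R) n w : 0 < t -> x <= t ->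
  last_step_in x t n w -> `|rescaled_walk s eta t w - val u| <= 2 * (x / t).
Proof.
move=> t0 xt [/= du [/= sx tT]].
have du' : eta n w = val u by rewrite -du.
have el := fun n => eta_le1 U_unit eta_chain n w.
have sn : 0 <= s n w.
  by rewrite -(s_0 w); exact: (@clock_le _ _ (fun n => s n : _ -> _) w (s_incr ^~ w)).
have tsn : t < s n.+1 w by have := T_def n w; lra.
rewrite /rescaled_walk t0 (@drrw_clip _ _ _ _ _ w t _ _ _ n.+1) ?(ltW t0)//.
rewrite big_ord_recr /=; set S := \sum_(i < n) _.
have hS : `|S| <= s n w.
  rewrite (le_trans (ler_norm_sum _ _ _))//.
  apply: le_trans (_ : Num.min (s n w) t <= s n w); last by rewrite ge_min lexx.
  rewrite -(@sum_clip _ _ (fun n => s n) w t (s_0 w) (ltW t0) n) ler_sum// => i _.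
  have c0 : 0 <= clip (fun n => s n) w t i by exact: clip_ge0.
  by rewrite normrZ ger0_norm// ler_piMr.
have -> : clip (fun n => s n) w t n = t - s n w.
  by rewrite /clip min_r ?(ltW tsn)// min_l// (le_trans sx).
have -> : t^-1 *: (S + (t - s n w) *: eta n w) - val u =
    t^-1 *: (S - s n w *: val u).
  rewrite du' scalerBl addrCA scalerDr scalerA mulVf ?gt_eqF// scale1r.
  by rewrite addrAC subrr add0r.
rewrite normrZ ger0_norm ?invr_ge0 ?(ltW t0)// mulrC.
have h2 : `|S - s n w *: val u| <= 2 * x.
  have := ler_normB S (s n w *: val u).
  have : `|s n w *: val u| <= s n w by rewrite normrZ ger0_norm// ler_piMr// -du'.
  lra.
by rewrite mulrA ler_wpM2r// invr_ge0 ltW.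
Qed.

Let F_ge0 x : 0 <= F x. Proof. by case/andP: (tail01 T x). Qed.
Let F_le x y (xy : x <= y) : F y <= F x. Proof. exact: tail_le. Qed.
Let F_gt0 x : 0 < F x. Proof. exact: (tail_gt0 c_gt0 hF F_ge0 F_le). Qed.

(** Renewal theory in crude form: of order [1 / F x] steps begin before time
    [x], and each of them lasts longer than [t] independently with probability
    [F t], which is comparable with [F x] when [x / t] is constant. *)
Lemma sum_last_step_in_ge (dl : R) : 0 < dl ->
  exists2 c0, 0 < c0 & \forall t \near +oo, exists n,
    c0 <= \sum_(i < n) prob P (last_step_in (dl * t) t i).
Proof.
move=> dl0.
have [K [x0 [K0 x00 kar]]] :=
  truncated_mean_karamata s_incr T_def a_lt1 c_gt0 h_rv hF.
have pu := stationary_law_gt0 eta_chain u.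
have dla : 0 < dl `^ a by rewrite powR_gt0.
have ratio := tail_ratio c_gt0 h_rv hF F_ge0 F_le dl0.
have cF0 : F (dl * t) @[t --> +oo] --> (0 : R).
  exact: (@cvg_comp _ _ _ (fun t : R => dl * t) F _ _ _ (cvg_scale_pinfty dl0)
    (@cvg_tail0 _ _ _ _ T)).
have r0 : 0 < dl `^ (- a) by rewrite powR_gt0.
(* About [y / 2] steps are used, with [y] below, each with probability at least
   half of [stationary_law u * F t]; the factor 2 left in 16 is for the ratio
   [F (dl * t) / F t], which is at most twice its limit. *)
pose c0 := stationary_law eta_chain u / (16 * K * dl `^ (- a)).
have KK : 0 < 4 * K by rewrite mulr_gt0.
exists c0; first by rewrite divr_gt0// !mulr_gt0.
near=> t.
have t0 : 0 < t by near: t; exact: nbhs_pinfty_gt.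
have x_gt0 : 0 < dl * t by rewrite mulr_gt0.
have xx0 : x0 <= dl * t.
  by rewrite mulrC -ler_pdivrMr//; near: t; exact: nbhs_pinfty_ge.
have Fx := F_gt0 (dl * t); have Ft := F_gt0 t.
have rat : F (dl * t) / F t < 2 * dl `^ (- a).
  by near: t; apply: (cvgr_lt _ ratio); lra.
have Fsmall : F (dl * t) < (4 * K)^-1.
  by near: t; apply: (cvgr_lt _ cF0); rewrite invr_gt0.
(* Up to [y] steps the expected truncated sum is at most half of [dl * t]. *)
pose y := (2 * K * F (dl * t))^-1.
have y0 : 0 < y by rewrite invr_gt0 !mulr_gt0.
have y2 : 2 <= y.
  rewrite /y -[leLHS]invrK lef_pV2 ?posrE ?invr_gt0 ?mulr_gt0//.
  have : F (dl * t) * (4 * K) <= 1 by rewrite -ler_pdivlMr// div1r ltW.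
  lra.
pose n := Num.truncn y; exists n.
have [n1 n2] : n%:R <= y /\ y < n.+1%:R.
  by have /andP[] := truncn_itv (ltW y0).
have g : truncated_mean T (dl * t) / (dl * t) <= K * F (dl * t).
  by rewrite ler_pdivrMr// (le_trans (kar _ xx0))// mulrAC.
have each (i : 'I_n) : stationary_law eta_chain u * (F t / 2) <=
    prob P (last_step_in (dl * t) t i).
  rewrite prob_last_step_in ler_wpM2l ?(ltW pu)//.
  apply: le_trans (prob_early_long_step_ge t i x_gt0).
  rewrite ler_wpM2l ?F_ge0//.
  have : i%:R * (truncated_mean T (dl * t) / (dl * t)) <= y * (K * F (dl * t)).
    apply: ler_pM => //.
      rewrite divr_ge0 ?(ltW x_gt0)//; apply: expect_ge0 => w.
      by rewrite le_min (ltW x_gt0) (ltW (T_gt0 s_incr T_def _ _)).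
    by rewrite (le_trans _ n1)// ler_nat ltnW.
  have -> : y * (K * F (dl * t)) = 2^-1.
    by rewrite /y; field; rewrite !gt_eqF.
  lra.
apply: le_trans (ler_sum _ (fun i _ => each i)).
rewrite sumr_const card_ord -[_ *+ n]mulr_natl.
have nn : y / 2 <= n%:R by move: n2; rewrite -natr1; lra.
apply: le_trans (_ : y / 2 * (stationary_law eta_chain u * (F t / 2)) <= _); last first.
  by rewrite ler_wpM2r// mulr_ge0 ?divr_ge0// ltW.
have -> : y / 2 * (stationary_law eta_chain u * (F t / 2)) =
    stationary_law eta_chain u / (8 * K * (F (dl * t) / F t)).
  by rewrite /y; field; rewrite !gt_eqF.
rewrite /c0 ler_wpM2l ?(ltW pu)// lef_pV2 ?posrE ?mulr_gt0 ?invr_gt0//.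
have -> : 16 * K * dl `^ (- a) = 8 * K * (2 * dl `^ (- a)) by ring.
by rewrite ler_wpM2l ?mulr_ge0 ?(ltW K0)// ltW.
Unshelve. all: by end_near. Qed.

(** The events that a step in direction [u] begins before [dl * t] and is not
    over at [t] are disjoint, and on each of them the interpolated indicator of
    the ball around [u] is at least [1 / 2]. *)
Lemma tent_mean_ge (rho : R) : 0 < rho -> exists2 c0, 0 < c0 &
  \forall t \near +oo, c0 <= expect P (fun w => tent (val u) rho (rescaled_walk s eta t w)).
Proof.
move=> rho0; pose dl := Num.min 1 (rho / 4).
have dl0 : 0 < dl by rewrite lt_min ltr01 divr_gt0.
have [c0 c00 hc] := sum_last_step_in_ge dl0.
exists (c0 / 2); first by rewrite divr_gt0.
have [cf fB] := tent_continuous_bounded (val u) rho0.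
near=> t.
have t0 : 0 < t by near: t; exact: nbhs_pinfty_gt.
have [n hn] : exists n, c0 <= \sum_(i < n) prob P (last_step_in (dl * t) t i).
  by near: t.
have xt : dl * t <= t by rewrite ler_piMl ?(ltW t0)// ge_min lexx.
have m i := measurable_last_step_in (dl * t) t i.
apply: le_trans (_ : expect P (fun w => 2^-1 * \sum_(i < n) \1_(last_step_in (dl * t) t i) w) <= _).
  rewrite expectZ; last by apply: bm_sum => i; exact: bm_indic.
  rewrite mulrC ler_wpM2l// (le_trans hn)// expect_sum => [|i]; last exact: bm_indic.
  by apply: ler_sum => i _; rewrite expect_indic.
apply: expect_le => [||w].
- apply: bmM; first exact: bm_cst.
  by apply: bm_sum => i; exact: bm_indic.
- exact: (bm_rescaled_walk U_unit s_0 s_incr eta_chain t cf fB).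
have [[i iw]|/forallNP no] := pselect (exists i : 'I_n, last_step_in (dl * t) t i w).
  rewrite (bigD1 i)//= big1 => [|j ji]; last first.
    rewrite indicE memNset// => jw.
    move: ji; rewrite -val_eqE /= neq_ltn => /orP[] ij.
      exact: (last_step_in_disjoint xt ij jw iw).
    exact: (last_step_in_disjoint xt ij iw jw).
  rewrite indicE mem_set// addr0 mulr1 le_max; apply/orP; right.
  have := last_step_in_near t0 xt iw; rewrite mulfK ?gt_eqF// => hd.
  have : `|rescaled_walk s eta t w - val u| / rho <= 2^-1.
    rewrite ler_pdivrMr// (le_trans hd)//.
    have : dl <= rho / 4 by rewrite ge_min lexx orbT.
    lra.
  lra.
rewrite big1 ?mulr0 ?le_max ?lexx// => j _.
by rewrite indicE memNset//; exact: no.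
Unshelve. all: by end_near. Qed.

End long_last_step.

(** * The weak limit *)

Lemma expect_point_mass (R : realType) (d : nat) (mu : probability (borelV R d) R)
    (x : 'rV[R]_d) (f : 'rV[R]_d -> R) : continuous f ->
  (exists B, forall y, `|f y| <= B) -> mu [set x] = 1%E ->
  (\int[mu]_y (f y)%:E)%E = (f x)%:E.
Proof.
move=> cf [B fB] mux.
have bf : bounded_measurable (f : borelV R d -> R).
  split; last by exists B.
  by have := @measurable_continuous_comp R d _ (borelV R d) f id cf; apply; exact: measurable_id.
have mx := measurable_set1_borelV x.
rewrite expectE//; congr (_%:E).
apply/eqP; rewrite -subr_eq0 -normr_le0.
have bd : bounded_measurable (fun y : borelV R d => f y - f x).
  by apply: bmB => //; exact: bm_cst.
have bi : bounded_measurable (fun y : borelV R d => 2 * B * \1_(~` [set x]) y : R).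
  by apply: bmM; [exact: bm_cst|apply: bm_indic; exact: measurableC].
have -> : expect mu f - f x = expect mu (fun y => f y - f x).
  by rewrite expectB ?expect_cst//; exact: bm_cst.
rewrite (le_trans (expect_norm mu bd))//.
apply: (@le_trans _ _ (expect mu (fun y : borelV R d => 2 * B * \1_(~` [set x]) y))).
  apply: expect_le => //; first exact: bm_norm.
  move=> y; rewrite indicE; have [->|/eqP xy] := eqVneq y x.
    by rewrite subrr normr0 memNset ?mulr0// => /=; exact.
  rewrite mem_set//= mulr1.
  have := ler_normB (f y) (f x); have := fB y; have := fB x; lra.
rewrite expectZ; last by apply: bm_indic; exact: measurableC.
rewrite expect_indic; last exact: measurableC.
by rewrite prob_setC// /prob mux /= subrr mulr0.
Qed.

Theorem theorem6 (R : realType) (d : nat) (U : {fset 'rV[R]_d})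
    (dO : measure_display) (Omega : measurableType dO)
    (P : probability Omega R)
    (s T : nat -> {RV P >-> R}) (eta : nat -> {RV P >-> borelV R d})
    (p : 'rV[R]_d -> 'rV[R]_d -> R) (h : R -> R) (a : R)
    (U_unit : forall u, u \in U -> enorm u = 1)
    (U_ge2 : (2 <= #|` U|)%N)
    (s_0 : forall w, s 0%N w = 0)
    (s_incr : forall n w, s n w < s n.+1 w)
    (T_def : forall n w, T n w = s n.+1 w - s n w)
    (T_indep : mutually_independent T)
    (T_ident : identically_distributed T)
    (eta_chain : irreducible_stationary_markov_chain U p eta)
    (eta_s_indep : independent_processes eta s)
    (a_gt0 : 0 < a) (a_lt1 : a < 1)
    (h_rv : regularly_varying h a)
    (tail : exists c : R, 0 < c /\
       h t * fine (P [set w | t < T 0%N w]) @[t --> +oo] --> c) :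
  exists mu : probability (borelV R d) R,
    nondegenerate_law mu /\
    cvg_weakly P (fun t w => t^-1 *: drrw s eta t w) mu.
Proof.
have [c [c_gt0 hF]] := tail.
have /card_gt1P[u' [v' [_ _ uv]]] : (1 < #|{: U}|)%N by rewrite -cardfE.
pose u := val u'; pose v := val v'.
have [mu muP] := limit_law_exists P
  (measurable_rescaled_walk eta s_0 s_incr)
  (rescaled_walk_le1 U_unit s_0 s_incr eta_chain).
have cvgE f (cf : continuous f) (bf : exists B, forall y, `|f y| <= B) :
    exists2 l : R, expect P (fun w => f (rescaled_walk s eta t w)) @[t --> +oo] --> l
      & (\int[mu]_x (f x)%:E)%E = l%:E.
  have [l fl] := cvg_expect_rescaled_walk u' U_unit s_0 s_incr T_def T_indep T_ident
    eta_chain eta_s_indep a_lt1 c_gt0 h_rv hF cf bf.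
  by exists l => //; exact: (muP f cf bf l fl).
exists mu; split; last first.
  move=> f cf bf; have [l fl ->] := cvgE f cf bf.
  have fle : (expect P (fun w => f (rescaled_walk s eta t w)))%:E @[t --> +oo] --> l%:E.
    by apply: cvg_EFin => //; exact: nearW.
  apply: cvg_trans fle; apply: near_eq_cvg; near=> t.
  have t0 : 0 < t by near: t; exact: nbhs_pinfty_gt.
  rewrite -expectE; last exact: (bm_rescaled_walk U_unit s_0 s_incr eta_chain t cf bf).
  by apply: eq_integral => w _; rewrite /rescaled_walk t0.
move=> [x mux].
(* A point mass would be within [rho] of both directions. *)
pose rho := `|u - v| / 2.
have rho0 : 0 < rho by rewrite divr_gt0// normr_gt0 subr_eq0 (inj_eq val_inj).
have near_dir (z : U) : `|x - val z| < rho.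
  have [cf bf] := tent_continuous_bounded (val z) rho0.
  have [c0 c00 hc] := tent_mean_ge z U_unit s_0 s_incr T_def T_indep T_ident
    eta_chain eta_s_indep a_lt1 c_gt0 h_rv hF rho0.
  have [l fl] := cvgE _ cf bf.
  rewrite (expect_point_mass cf bf mux) => -[xl].
  have : c0 <= l by exact: (cvgr_to_ge fl).
  rewrite -xl /tent => cx; have := lt_le_trans c00 cx.
  by rewrite lt_max ltxx /= subr_gt0 ltr_pdivrMr// mul1r.
have hu := near_dir u'; have hv := near_dir v'.
have := ler_normB (x - v) (x - u).
have -> : x - v - (x - u) = u - v by rewrite opprB [LHS]addrC addrA subrK.
by rewrite /u /v; move: hu hv; rewrite /rho /u /v; lra.
Unshelve. all: by end_near. Qed.
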